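(* Let $p$ be a prime number and let $\epsilon\in(0,1-1/p]$ be a fixed real number. For each $n\ge 1$, let $A_n\in\mathrm{Mat}_n(\mathbb{F}_p)$ be a random matrix whose entries are independent and $\epsilon$-balanced (not necessarily identically distributed). Let $f_1,\ldots,f_r\in\mathbb{F}_p[t]$ be distinct monic, irreducible, nonconstant polynomials. Then the distribution of the $r$-tuple of random partitions $(\lambda^{(f_1)}(A_n),\ldots,\lambda^{(f_r)}(A_n))$ converges pointwise, as $n\to\infty$, to the product measure $\prod_{i=1}^r\mu_{f_i}$ on $\mathbb{Y}^r$, where for all $1\le i\le r$, $$\mu_{f_i}(\lambda)=\frac{1}{\#\mathrm{Aut}_{f_i}(\lambda)}\prod_{j=1}^\infty\left(1-p^{-j\deg f_i}\right),\qquad \forall \lambda=(\lambda_1,\lambda_2,\ldots)\in\mathbb{Y}.$$ That is, for all $\lambda^{(1)},\ldots,\lambda^{(r)}\in\mathbb{Y}$, $$\lim_{n\to\infty}\mathbf{P}\left(\lambda^{(f_i)}(A_n)=\lambda^{(i)}\text{ for all }1\le i\le r\right)=\prod_{i=1}^r\mu_{f_i}(\lambda^{(i)}).$$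
   Context: $\mathrm{Mat}_n(\mathbb{F}_p)$ is the set of $n\times n$ matrices over the finite field $\mathbb{F}_p$, and $\mathrm{GL}_n(\mathbb{F}_p)$ is its subset of invertible matrices. $\mathbb{Y}$ is the set of integer partitions, i.e. sequences $\lambda=(\lambda_1,\lambda_2,\ldots)$ of integers with $\lambda_1\ge\lambda_2\ge\cdots\ge 0$ and $\lambda_i=0$ for all but finitely many $i$ (sequences differing only by trailing zeros are identified). A random variable $\xi\in\mathbb{F}_p$ is $\epsilon$-balanced if $\mathbf{P}(\xi=a)\le 1-\epsilon$ for all $a\in\mathbb{F}_p$. Partitions $\lambda^{(f)}(A)$: let $A\in\mathrm{Mat}_n(\mathbb{F}_p)$ and factor its characteristic polynomial as $\det(tI_n-A)=\prod_{i=1}^k g_i(t)^{e_i}$ with $g_1,\ldots,g_k$ distinct monic irreducible nonconstant polynomials. Then $A$ is conjugate under $\mathrm{GL}_n(\mathbb{F}_p)$ to a block diagonal matrix $\mathrm{diag}(R_1,\ldots,R_k)$, where $R_i\in\mathrm{Mat}_{e_i\deg g_i}(\mathbb{F}_p)$ is block diagonal with blocks $C(g_i^{\lambda_1^{(g_i)}}),C(g_i^{\lambda_2^{(g_i)}}),\ldots,C(g_i^{\lambda_{j_i}^{(g_i)}})$ for a partition $\lambda^{(g_i)}=(\lambda_1^{(g_i)},\ldots,\lambda_{j_i}^{(g_i)})\in\mathbb{Y}$ with $\lambda_1^{(g_i)}+\cdots+\lambda_{j_i}^{(g_i)}=e_i$. Here, for monic $f=t^m+a_{m-1}t^{m-1}+\cdots+a_0$,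 $C(f)$ is the $m\times m$ companion matrix with $1$'s on the superdiagonal, last row $(-a_0,-a_1,\ldots,-a_{m-1})$, and zeros elsewhere. The partitions $\lambda^{(g_i)}$ are uniquely determined by $A$ (rational canonical form). This defines $\lambda^{(f)}(A)$ for each monic irreducible $f$ dividing the characteristic polynomial of $A$; for every other monic irreducible nonconstant $f$, $\lambda^{(f)}(A)$ is the zero partition. $\mathrm{Aut}_{f}(\lambda)$ is the group of automorphisms of the $\mathbb{F}_p[t]$-module $\bigoplus_{j\ge 1}\mathbb{F}_p[t]/(f^{\lambda_j})$, and $\#$ denotes the cardinality of a finite set. *)

(* Defs.v *)
From HB Require Import structures.
From mathcomp Require Import all_boot all_order all_algebra all_fingroup.
From mathcomp Require Import all_classical all_reals all_analysis.

Set Implicit Arguments.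
Unset Strict Implicit.
Unset Printing Implicit Defensive.

Import Order.TTheory GRing.Theory Num.Theory.
Import numFieldNormedType.Exports.

Local Open Scope ring_scope.

(* An integer partition is represented by the sequence of its nonzero parts in
   nonincreasing order, so that sequences differing only by trailing zeros are
   the same partition; the zero partition is [::]. *)
Record intpartn : predArgType := IntPartn {
  parts :> seq nat;
  _ : sorted geq parts && (0%N \notin parts) }.

HB.instance Definition _ := [isSub for parts].
HB.instance Definition _ := [Countable of intpartn by <:].

Definition zero_partn : intpartn := @IntPartn [::] isT.

Notation part lam j := (nth 0%N (parts lam) j).

Section RationalCanonicalForm.
Variable F : fieldType.
Implicit Types (g : {poly F}) (lam : intpartn).

(* diag(C(g^lam_1), ..., C(g^lam_l)), of size (deg g) * (lam_1 + ... + lam_l) *)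
Definition primary_dim g lam : nat :=
  (\sum_(j < size lam) (size (g ^+ part lam j)).-1)%N.

Definition primary_block g lam : 'M[F]_(primary_dim g lam) :=
  \mxdiag_(j < size lam) companionmx (g ^+ part lam j).

(* [is_canonical_data A L]: L is the family of partitions indexed by monic
   irreducible polynomials that is read off a rational canonical form of A;
   it is extended by the zero partition to all other polynomials. *)
Definition is_canonical_data (n : nat) (A : 'M[F]_n)
    (L : {poly F} -> intpartn) : Prop :=
  exists (k : nat) (g : 'I_k -> {poly F}) (e : 'I_k -> nat),
  [/\ injective g,
      forall i, [/\ g i \is monic, irreducible_poly (g i) & (0 < e i)%N],
      char_poly A = \prod_(i < k) g i ^+ e i,
      forall i, sumn (L (g i)) = e i &
      (exists eq_dim : (\sum_(i < k) primary_dim (g i) (L (g i)))%N = n,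
        A ~_{in unitmx}
          castmx (eq_dim, eq_dim) (\mxdiag_(i < k) primary_block (g i) (L (g i))))
      /\ (forall f, (forall i, g i != f) -> L f = zero_partn)].

(* The partition lambda^(f)(A): a definite description, the canonical data of
   A existing and being unique. *)
Definition canonical_partn (n : nat) (f : {poly F}) (A : 'M[F]_n) : intpartn :=
  xget zero_partn (fun lam => exists2 L, is_canonical_data A L & L f = lam).

End RationalCanonicalForm.

Section TorsionModule.
Variables (F : finFieldType) (f : {poly F}) (lam : intpartn).

(* The F[t]-module F[t]/(f^lam_1) (+) ... (+) F[t]/(f^lam_l); for f monic and
   nonconstant every f^lam_j is monic and nonconstant (lam_j > 0), hence the
   type {poly %/ f ^+ lam_j} is the expected quotient. *)
Definition torsion_module : Type :=
  {dffun forall j : 'I_(size lam), {poly %/ f ^+ part lam j}}.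

HB.instance Definition _ := Finite.on torsion_module.

Implicit Types (u v w : torsion_module) (q : {poly F}).

Definition tm_zero : torsion_module :=
  [ffun j : 'I_(size lam) => 0 : {poly %/ f ^+ part lam j}].
Definition tm_opp u : torsion_module :=
  [ffun j : 'I_(size lam) => - u j : {poly %/ f ^+ part lam j}].
Definition tm_add u v : torsion_module :=
  [ffun j : 'I_(size lam) => u j + v j : {poly %/ f ^+ part lam j}].
Definition tm_scale q u : torsion_module :=
  [ffun j : 'I_(size lam) => in_qpoly (f ^+ part lam j) q * u j : {poly %/ f ^+ part lam j}].

Fact tm_addA : associative tm_add.
Proof. by move=> u v w; apply/ffunP => j; rewrite !ffunE addrA. Qed.
Fact tm_addC : commutative tm_add.
Proof. by move=> u v; apply/ffunP => j; rewrite !ffunE addrC. Qed.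
Fact tm_add0 : left_id tm_zero tm_add.
Proof. by move=> u; apply/ffunP => j; rewrite !ffunE add0r. Qed.
Fact tm_addN : left_inverse tm_zero tm_opp tm_add.
Proof. by move=> u; apply/ffunP => j; rewrite !ffunE addNr. Qed.

HB.instance Definition _ :=
  GRing.isZmodule.Build torsion_module tm_addA tm_addC tm_add0 tm_addN.

Fact tm_scaleA q r u : tm_scale q (tm_scale r u) = tm_scale (q * r) u.
Proof. by apply/ffunP => j; rewrite !ffunE in_qpolyM mulrA. Qed.
Fact tm_scale1 : left_id 1 tm_scale.
Proof. by move=> u; apply/ffunP => j; rewrite !ffunE in_qpoly1 mul1r. Qed.
Fact tm_scaleDr : right_distributive tm_scale +%R.
Proof. by move=> q u v; apply/ffunP => j; rewrite !ffunE mulrDr. Qed.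
Fact tm_scaleDl u : {morph tm_scale^~ u : q r / q + r}.
Proof. by move=> q r; apply/ffunP => j; rewrite !ffunE in_qpolyD mulrDl. Qed.

HB.instance Definition _ := GRing.Zmodule_isLmodule.Build {poly F}
  torsion_module tm_scaleA tm_scale1 tm_scaleDr tm_scaleDl.

Definition module_Aut : {set {perm torsion_module}} :=
  [set s : {perm torsion_module} |
    `[< linear (s : torsion_module -> torsion_module) >]].

End TorsionModule.

Local Open Scope classical_set_scope.

Definition limit_measure (R : realType) (p : nat) (f : {poly 'F_p})
    (lam : intpartn) : R :=
  (#|module_Aut f lam|%:R)^-1 *
  limn (fun m => \prod_(1 <= j < m.+1) (1 - p%:R ^- (j * (size f).-1)) : R).

Section RandomVariables.
Context (R : realType) (d : measure_display) (T : measurableType d).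
Variable P : probability T R.

(* Random variables with values in a set S carrying the discrete
   sigma-algebra. *)
Definition discrete_rv (S : Type) (X : T -> S) : Prop :=
  forall B : set S, measurable (X @^-1` B).

Definition mutually_independent (I : finType) (S : Type) (X : I -> T -> S)
    : Prop :=
  forall (J : {set I}) (B : I -> set S),
    P [set w | forall i, i \in J -> B i (X i w)] =
    (\prod_(i in J) P (X i @^-1` B i))%E.

Definition balanced (S : Type) (eps : R) (X : T -> S) : Prop :=
  forall a : S, (P [set w | X w = a] <= (1 - eps)%:E)%E.

End RandomVariables.

(* Main.v *)
(* Row vectors form an F_p[t]-module V_A on which t acts by A.  For B the block diagonal
   matrix of type (lam i) at f i, the event in question is counted by the injective module
   maps V_B -> V_A whose cokernel has no f i-torsion: there are #Aut(V_B) of them when A has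
   type lam i at every f i, and none otherwise.

   Such maps are reached from all injective maps V_B -> V_A by a sieve.  If the f-torsion of
   the cokernel has dimension e over F_p[t]/(f), with Q = p^deg f elements, the number of its
   independent k-tuples is prod_(j < k) (Q^e - Q^j), and a pair (injection, independent
   k-tuple) is the same as an injection of an extension of V_B by (F_p[t]/(f))^k.  The
   alternating sum over k detects e = 0, so all one needs are the expected numbers of
   injections V_B -> V_A; each tends to 1, and Euler's expansion
   prod_j (1 - Q^-j) = sum_k (-1)^k / prod_(i <= k) (Q^i - 1) gives the limit.

   The expected number of injections is the sum over m x n matrices phi of rank m of
   P(phi A = B phi), where the n columns of A are independent.  Group the columns of phi by
   value.  A sum of k (p - 1) balanced variables is exponentially close to uniform on F_p, so
   if the values taken at least k (p - 1) times span F_p^m, then P(phi A = B phi) is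
   p^(-m n) up to a factor tending to 1.  Otherwise all but few columns of phi lie in a proper
   subspace of dimension h, there are few such phi, and each column of A contributes at most
   (1 - eps) times about p^-h. *)
Require Import Defs.
From HB Require Import structures.
From mathcomp Require Import all_boot all_order all_algebra all_fingroup.
From mathcomp Require Import boolp zify ring lra.

Set Implicit Arguments.
Unset Strict Implicit.
Unset Printing Implicit Defensive.

Import Order.TTheory GRing.Theory Num.Theory.

Local Open Scope ring_scope.

(** * Polynomials in a matrix *)

(** The sieve replaces [B] by extensions of it, so it closes up only because the limiting moment is
    1 for every [B] of every size: the law of each column of phi A is bounded pointwise, whatever
    the target B phi. A torsion tuple has [#|F| ^ (m * k)] lifts from the cokernel to row vectors;
    this is also the number of matrices [Y] parametrising the extensions, and the two cancel.
    Several polynomials are handled one at a time: an extension by f-torsion leaves the h-torsion of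
    the cokernel unchanged for h coprime to f.

    The delicate parameter of the moments is k in the threshold k (p - 1). It must grow with n, as
    the relative mixing error accumulates over m n factors; but the bound on the number of
    exceptional phi near a subspace of dimension h is of the form C^k (p^h (1 + eps))^n. Taking k
    close to n / D with D large meets both demands, because (1 + eps) (1 - eps) < 1.

    Partitions are compared only through the ranks of the kernels of f(A)^k. This gives the
    uniqueness of the canonical form, and it shows that an embedding with torsion-free cokernel
    forces the type of A. *)

Section PolyOfMatrix.
Variable F : fieldType.
Implicit Types (g h : {poly F}) (m n : nat).

(* [horner_mx] requires a nonempty matrix; the value for size 0 is irrelevant. *)
Definition pmx n (A : 'M[F]_n) g : 'M[F]_n :=
  (if n is n'.+1 then fun A : 'M[F]_n'.+1 => horner_mx A g else fun=> 0) A.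

Lemma pmx0 n (A : 'M[F]_n) : pmx A 0 = 0.
Proof. by case: n A => [|n] A //=; rewrite rmorph0. Qed.

Lemma pmxC n (A : 'M[F]_n) c : pmx A c%:P = c%:M.
Proof. by case: n A => [|n] A /=; [rewrite [RHS]thinmx0|exact: horner_mx_C]. Qed.

Lemma pmx1 n (A : 'M[F]_n) : pmx A 1 = 1%:M.
Proof. exact: pmxC. Qed.

Lemma pmxX n (A : 'M[F]_n) : pmx A 'X = A.
Proof. by case: n A => [|n] A /=; [rewrite [RHS]thinmx0|exact: horner_mx_X]. Qed.

Lemma pmxD n (A : 'M[F]_n) g h : pmx A (g + h) = pmx A g + pmx A h.
Proof. by case: n A => [|n] A /=; [rewrite addr0|rewrite rmorphD]. Qed.

Lemma pmxM n (A : 'M[F]_n) g h : pmx A (g * h) = pmx A g *m pmx A h.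
Proof. by case: n A => [|n] A /=; [rewrite mulmx0|rewrite rmorphM]. Qed.

Lemma pmxZ n (A : 'M[F]_n) c g : pmx A (c *: g) = c *: pmx A g.
Proof. by rewrite -mul_polyC pmxM pmxC mul_scalar_mx. Qed.

Lemma pmx_comm n (A : 'M[F]_n) g h : pmx A g *m pmx A h = pmx A h *m pmx A g.
Proof. by rewrite -!pmxM mulrC. Qed.

Lemma pmx_char_poly n (A : 'M[F]_n) : pmx A (char_poly A) = 0.
Proof. by case: n A => [|n] A //=; exact: Cayley_Hamilton. Qed.

Lemma pmx_Xn n (A : 'M[F]_n) k : pmx A 'X^k = A ^+ k.
Proof.
elim: k => [|k IHk]; first by rewrite !expr0 pmx1.
by rewrite !exprS pmxM pmxX IHk.
Qed.

Lemma pmx_intertwine m n (A : 'M[F]_n) (B : 'M[F]_m) (X : 'M[F]_(m, n)) g :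
  X *m A = B *m X -> X *m pmx A g = pmx B g *m X.
Proof.
move=> XA; elim/poly_ind: g => [|g c IHg]; first by rewrite !pmx0 mulmx0 mul0mx.
rewrite !pmxD !pmxM !pmxX !pmxC mulmxDr mulmxDl mulmxA IHg -!mulmxA XA.
by rewrite scalar_mxC.
Qed.

Lemma pmx_dvd n m (A : 'M[F]_n) (X : 'M[F]_(m, n)) g h :
  g %| h -> X *m pmx A g = 0 -> X *m pmx A h = 0.
Proof.
by move=> /dvdpP[u ->] Xg; rewrite mulrC pmxM mulmxA Xg mul0mx.
Qed.

Lemma pmx_unit n (A : 'M[F]_n) g h :
  coprimep g h -> pmx A h = 0 -> pmx A g \in unitmx.
Proof.
move=> /Bezout_eq1_coprimepP[[u v] /= uv] Ah.
have: pmx A u *m pmx A g = 1%:M by rewrite -(pmx1 A) -uv pmxD !pmxM Ah mulmx0 addr0.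
by case/mulmx1_unit.
Qed.

(** Bezout in the quotient by the invariant subspace [U]: a class killed by two coprime polynomials
    in [A] is zero. *)
Lemma pmx_coprime_submx m1 m n (A : 'M[F]_n) (U : 'M[F]_(m, n))
    (x : 'M[F]_(m1, n)) g h : coprimep g h -> stablemx U A ->
  (x *m pmx A g <= U)%MS -> (x *m pmx A h <= U)%MS -> (x <= U)%MS.
Proof.
move=> /Bezout_eq1_coprimepP[[u v] /= uv] UA xg xh.
have Ust k : stablemx U (pmx A k).
  elim/poly_ind: k => [|k c IHk]; first by rewrite pmx0 mulmx0 sub0mx.
  by rewrite pmxD pmxM pmxX pmxC stablemxD ?stablemxC // mulmxA (submx_trans _ UA) ?submxMr.
rewrite -[x]mulmx1 -(pmx1 A) -uv pmxD (mulrC u) (mulrC v) !pmxM mulmxDr !mulmxA.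
by rewrite addmx_sub // ?(submx_trans (submxMr _ xg)) ?(submx_trans (submxMr _ xh)) ?Ust.
Qed.

(** Two sizes are allowed so that callers need no cast; the mutually inverse [P] and [Q] force them
    to agree. *)
Lemma char_poly_intertwine n m (A : 'M[F]_n) (B : 'M[F]_m) P Q :
  P *m Q = 1%:M -> Q *m P = 1%:M -> P *m A = B *m P -> char_poly A = char_poly B.
Proof.
move=> PQ QP PA.
have eq_mn : m = n.
  apply/eqP; rewrite eqn_leq; apply/andP; split.
    by rewrite -{1}(mxrank1 F m) -PQ (leq_trans (mxrankM_maxr _ _)) ?rank_leq_row.
  by rewrite -{1}(mxrank1 F n) -QP (leq_trans (mxrankM_maxr _ _)) ?rank_leq_row.
subst m; have -> : B = P *m A *m Q by rewrite PA -mulmxA PQ mulmx1.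
have QP' : map_mx (@polyC F) Q *m map_mx (@polyC F) P = 1%:M.
  by rewrite -map_mxM QP map_mx1.
have PQ' : map_mx (@polyC F) P *m map_mx (@polyC F) Q = 1%:M.
  by rewrite -map_mxM PQ map_mx1.
rewrite /char_poly /char_poly_mx !map_mxM.
set P' := map_mx _ P in QP' PQ' *; set Q' := map_mx _ Q in QP' PQ' *.
have -> : 'X%:M - P' *m map_mx polyC A *m Q' = P' *m ('X%:M - map_mx polyC A) *m Q'.
  by rewrite mulmxBr mulmxBl mul_mx_scalar -scalemxAl PQ' scalemx1.
by rewrite !det_mulmx mulrAC -det_mulmx PQ' det1 mul1r.
Qed.

End PolyOfMatrix.

(** * Companion matrices as multiplication by t on F[t]/(h) *)

Section Companion.
Variable F : fieldType.
Implicit Types (g h : {poly F}).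

Lemma mulmx_companion h (v : 'rV[F]_(size h).-1) : h \is monic ->
  v *m companionmx h = poly_rV ((rVpoly v * 'X) %% h).
Proof.
move=> h_mon; have h0 := monic_neq0 h_mon; have h_sz : (0 < size h)%N by rewrite size_poly_gt0.
have szE k : (k < size h)%N = (k <= (size h).-1)%N by rewrite -[in RHS]ltnS prednK.
(* One step of Euclidean division: the product has degree at most deg h, so the quotient is a
   constant, the coefficient of [rVpoly v] at index deg h - 1. *)
have -> : (rVpoly v * 'X) %% h = rVpoly v * 'X - (rVpoly v)`_((size h).-2) *: h.
  set c := _`_ _; rewrite -[in LHS](subrK (c *: h) (rVpoly v * 'X)) modpD modpZl modpp scaler0 addr0.
  rewrite modp_small // szE; apply/leq_sizeP => j hj.
  rewrite coefB coefMX coefZ.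
  case: (ltngtP j (size h).-1) hj => // [hj _|-> _].
    rewrite [h`_j]nth_default ?mulr0 ?subr0; last by rewrite leqNgt szE -ltnNge.
    case: j hj => // j hj; rewrite /= nth_default // (leq_trans (size_poly _ _)) //.
  rewrite -/(lead_coef h) (monicP h_mon) mulr1.
  case: eqP => [E|_]; last by rewrite subrr.
  by rewrite sub0r /c nth_default ?oppr0 // (leq_trans (size_poly _ _)) // {1}E.
apply/rowP => j; rewrite !mxE coefB coefMX coefZ.
have d_gt0 : (0 < (size h).-1)%N by apply: leq_ltn_trans (ltn_ord j).
have last_lt : ((size h).-2 < (size h).-1)%N by rewrite prednK.
rewrite (bigD1 (Ordinal last_lt)) //= !mxE /= eqxx mulrN.
have -> : (rVpoly v)`_((size h).-2) = v 0 (Ordinal last_lt).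
  by rewrite -[X in (rVpoly v)`_X]/(val (Ordinal last_lt)) coef_rVpoly_ord.
rewrite addrC; congr (_ - _).
case: (posnP j) => [j0|j_gt0].
  rewrite big1 // => i; rewrite -val_eqE /= => /negPf ni; rewrite mxE ni j0 /= mulr0 //.
have j1_lt : (j.-1 < (size h).-1)%N by rewrite (leq_ltn_trans (leq_pred _)).
have j1_neq : j.-1 != (size h).-2 by rewrite neq_ltn -ltnS !prednK // ltn_ord.
rewrite -[j.-1]/(val (Ordinal j1_lt)) coef_rVpoly_ord.
rewrite (bigD1 (Ordinal j1_lt)) /=; last first.
  by rewrite -val_eqE.
rewrite mxE /= (negPf j1_neq).
rewrite prednK // eqxx mulr1 big1 ?addr0 // => i /andP[i1 i2].
rewrite mxE; move: i1 i2; rewrite -!val_eqE /= => /negPf -> i2.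
case: eqP => [E|]; last by rewrite mulr0.
by rewrite -E eqxx in i2.
Qed.

Lemma mulmx_pmx_companion h g (v : 'rV[F]_(size h).-1) : h \is monic ->
  v *m pmx (companionmx h) g = poly_rV ((rVpoly v * g) %% h).
Proof.
move=> h_mon; have h0 := monic_neq0 h_mon; have h_sz : (0 < size h)%N by rewrite size_poly_gt0.
have szE k : (k < size h)%N = (k <= (size h).-1)%N by rewrite -[in RHS]ltnS prednK.
have modsz (u : {poly F}) : (size (u %% h)%R <= (size h).-1)%N by rewrite -szE ltn_modp.
elim/poly_ind: g => [|g c IHg]; first by rewrite pmx0 mulmx0 mulr0 mod0p linear0.
rewrite pmxD pmxM pmxX pmxC mulmxDr mulmxA IHg mulmx_companion // poly_rV_K //.
rewrite mul_mx_scalar -{2}[v]rVpolyK -linearZ /= -linearD; congr (poly_rV _).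
rewrite mulrDr mulrA modpD; congr (_ + _).
  by rewrite mulrC modp_mul mulrC.
by rewrite mulrC mul_polyC modp_small // szE (leq_trans (size_scale_leq _ _)) ?size_poly.
Qed.

Lemma pmx_companion h : h \is monic -> pmx (companionmx h) h = 0.
Proof. by move=> h_mon; rewrite -[X in pmx _ X](companionmxK h_mon) pmx_char_poly. Qed.

End Companion.

(** * Decompositions into invariant subspaces *)

Section CompanionKernel.
Variable F : fieldType.
Implicit Types (f g h : {poly F}).

Lemma rank_ker_unit n (A : 'M[F]_n) : A \in unitmx -> \rank (kermx A) = 0.
Proof. by rewrite -row_free_unit mxrank_ker => /eqP ->; rewrite subnn. Qed.

Lemma rank_ker_companion_coprime g h : h \is monic -> coprimep g h ->
  \rank (kermx (pmx (companionmx h) g)) = 0.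
Proof. by move=> h_mon gh; apply/rank_ker_unit/(pmx_unit gh)/pmx_companion. Qed.

(** For k < a, the kernel of multiplication by f^k on F[t]/(f^a) is the ideal generated by f^(a-k),
    with basis X^i f^(a-k) for i < k deg f: these are the rows of [M]. As [k] varies, such ranks
    recover the exponents of the cyclic summands. *)
Lemma rank_ker_companion_exp f a k : f \is monic ->
  \rank (kermx (pmx (companionmx (f ^+ a)) (f ^+ k))) = ((size f).-1 * minn k a)%N.
Proof.
move=> f_mon; have f0 := monic_neq0 f_mon.
have fa_mon b : f ^+ b \is monic by rewrite monic_exp.
have fa0 b : f ^+ b != 0 by rewrite expf_neq0.
have [ak|ka] := leqP a k.
  rewrite -[f ^+ k]mulr1 -(subnK ak) exprD mulr1 pmxM pmx_companion //.
  by rewrite mulmx0 mxrank_ker mxrank0 subn0 size_exp.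
have [b abk] : exists b, a = (b + k)%N by exists (a - k)%N; rewrite subnK // ltnW.
pose M : 'M[F]_((size f).-1 * k, (size (f ^+ a)).-1) :=
  \matrix_i poly_rV ('X^i * f ^+ b).
have MP (u : 'rV_((size f).-1 * k)) : u *m M = poly_rV (rVpoly u * f ^+ b).
  rewrite mulmx_sum_row /rVpoly poly_def mulr_suml linear_sum; apply: eq_bigr => i _.
  by rewrite rowK insubT // => lt_i; rewrite (bool_irrelevance lt_i (ltn_ord i)) -scalerAl
    linearZ /=; congr (u 0 _ *: _); apply: val_inj.
have size_mul_le (u : {poly F}) : (size u <= (size f).-1 * k)%N ->
    (size (u * f ^+ b)%R <= (size (f ^+ a)).-1)%N.
  move=> su; rewrite size_exp {1}abk mulnDr.
  have [->|u0] := eqVneq u 0; first by rewrite mul0r size_poly0.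
  rewrite size_Mmonic // -size_exp -[size (f ^+ b)]prednK ?size_poly_gt0 //.
  by rewrite addnS /= addnC leq_add2l.
have M_free : row_free M.
  apply: inj_row_free => u; rewrite MP => /(congr1 rVpoly); rewrite poly_rV_K ?size_mul_le ?size_poly //.
  by rewrite linear0 => /eqP; rewrite mulf_eq0 (negPf (fa0 b)) orbF => /eqP u0;
    apply: (can_inj rVpolyK); rewrite u0 linear0.
rewrite -(eqP M_free); apply/eqP; rewrite eqn_leq !mxrankS //.
  apply/row_subP => i; apply/sub_kermxP; rewrite rowK mulmx_pmx_companion //.
  rewrite poly_rV_K; last by rewrite size_mul_le // size_polyXn.
  by rewrite -mulrA -exprD -abk modp_mull linear0.
apply/rV_subP => v /sub_kermxP; rewrite mulmx_pmx_companion // => /(congr1 rVpoly).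
rewrite poly_rV_K; last first.
  by rewrite -ltnS prednK ?size_poly_gt0 // ltn_modp.
rewrite linear0 => /eqP; rewrite -/(_ %| _) {1}abk exprD dvdp_mul2r // => /dvdpP[u vu].
apply/submxP; exists (poly_rV u); rewrite MP poly_rV_K; first by rewrite -vu rVpolyK.
have [->|u0] := eqVneq u 0; first by rewrite size_poly0.
have : (size (rVpoly v) <= (size (f ^+ a)).-1)%N by rewrite size_poly.
rewrite vu size_Mmonic // !size_exp {1}abk mulnDr -[size (f ^+ b)]prednK ?size_poly_gt0 //.
by rewrite addnS /= size_exp addnC leq_add2l.
Qed.

End CompanionKernel.

Section Decomposition.
Variable F : fieldType.

(** A direct sum decomposition of the module of [A] into the modules of the [C i], with inclusions
    [P i] and projections [Q i]. Unlike a block diagonal form, it does not require [n] to be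
    syntactically the sum of the [d i], so it can be reindexed, regrouped and transported without
    casts. *)
Definition mxdecomp n (A : 'M[F]_n) (I : finType) (d : I -> nat)
    (C : forall i, 'M[F]_(d i)) (P : forall i, 'M[F]_(d i, n))
    (Q : forall i, 'M[F]_(n, d i)) : Prop :=
  [/\ forall i, P i *m Q i = 1%:M, forall i j, i != j -> P i *m Q j = 0,
      \sum_i Q i *m P i = 1%:M & forall i, P i *m A = C i *m P i].

Section Theory.
Variables (n : nat) (A : 'M[F]_n) (I : finType) (d : I -> nat).
Variables (C : forall i, 'M[F]_(d i)) (P : forall i, 'M[F]_(d i, n)).
Variable (Q : forall i, 'M[F]_(n, d i)).
Hypothesis decA : mxdecomp A C P Q.

Lemma mxdecompQ i : A *m Q i = Q i *m C i.
Proof.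
case: decA => PQ1 PQ0 QP PA.
rewrite -[A *m _]mul1mx -QP mulmx_suml (bigD1 i) //= big1 ?addr0; last first.
  by move=> j ji; rewrite -!mulmxA (mulmxA (P j)) PA -mulmxA PQ0 // !mulmx0.
by rewrite -!mulmxA (mulmxA (P i)) PA -(mulmxA (C i)) PQ1 mulmx1.
Qed.

Lemma mxdecompP_pmx g i : P i *m pmx A g = pmx (C i) g *m P i.
Proof. by case: decA => _ _ _ PA; apply: pmx_intertwine. Qed.

Lemma mxdecompQ_pmx g i : pmx A g *m Q i = Q i *m pmx (C i) g.
Proof. by apply/esym/pmx_intertwine/esym/mxdecompQ. Qed.

Lemma mxdecomp_row_sum m (x : 'M[F]_(m, n)) : x = \sum_i x *m Q i *m P i.
Proof.
case: decA => _ _ QP _; rewrite -[LHS]mulmx1 -QP mulmx_sumr.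
by apply: eq_bigr => i _; rewrite mulmxA.
Qed.

Lemma mxdecomp_rank_ker g :
  \rank (kermx (pmx A g)) = (\sum_i \rank (kermx (pmx (C i) g)))%N.
Proof.
case: decA => PQ1 PQ0 QP PA.
have freeP i : row_free (P i).
  by apply/row_freeP; exists (Q i).
pose K i := (kermx (pmx (C i) g) *m P i)%R.
have rK i : \rank (K i) = \rank (kermx (pmx (C i) g)) by rewrite mxrankMfree.
under eq_bigr do rewrite -rK.
have dir : mxdirect (\sum_i <<K i>>)%MS.
  apply/mxdirect_sumsP => i _; apply/eqP/rowV0P => v; rewrite sub_capmx genmxE => /andP[vi].
  have PiQ : forall j, j != i -> (K j *m Q i)%R = 0 by move=> j ji; rewrite /K -mulmxA PQ0 ?mulmx0.
  move=> vj; have v0 : v *m Q i = 0.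
    apply/eqP; rewrite -submx0.
    apply: (submx_trans (submxMr _ vj)); rewrite sumsmxMr_gen; apply/sumsmx_subP => j /= ji.
    have : (<<K j>> *m Q i <= K j *m Q i)%MS by rewrite submxMr ?genmxE.
    by rewrite PiQ // genmxE => /submx_trans -> //; apply: sub0mx.
  case/submxP: vi v0 => u ->; rewrite /K !mulmxA -(mulmxA _ (P i)) PQ1 mulmx1.
  by move=> ->; rewrite mul0mx.
have := mxdirectP dir; rewrite /= => rS.
under [RHS]eq_bigr => i _ do rewrite -genmxE.
rewrite -rS; apply/eqP; rewrite eqn_leq !mxrankS //; last first.
  rewrite [X in (X <= _)%MS]mxdecomp_row_sum summx_sub_sums // => i _.
  rewrite genmxE submxMr //; apply/sub_kermxP.
  by rewrite -mulmxA -mxdecompQ_pmx mulmxA mulmx_ker mul0mx.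
apply/sumsmx_subP => i _; rewrite genmxE; apply/sub_kermxP.
by rewrite /K -mulmxA mxdecompP_pmx mulmxA mulmx_ker mul0mx.
Qed.

End Theory.

End Decomposition.

(** * Cyclic decomposition *)

Section IrreducibleFactors.
Variable F : fieldType.
Implicit Types (f g h : {poly F}).

Lemma exists_irreducible_factor g : (1 < size g)%N ->
  exists f, [/\ f \is monic, irreducible_poly f & f %| g].
Proof.
elim/ltn_ind: {g}(size g) {-2}g (erefl (size g)) => s IH g sg g_gt1.
have g0 : g != 0 by rewrite -size_poly_gt0 (ltn_trans _ g_gt1).
have [g_irr|g_red] := EM (irreducible_poly g).
  have lc0 : (lead_coef g)^-1 != 0 by rewrite invr_eq0 lead_coef_eq0.
  exists ((lead_coef g)^-1 *: g); split.
  - by rewrite monicE lead_coefZ mulVf // lead_coef_eq0.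
  - case: g_irr => g1 gP; split; first by rewrite size_scale.
    by move=> q q1; rewrite dvdpZr // => /(gP _ q1) /eqp_trans -> //; rewrite eqp_sym eqp_scale.
  - by rewrite dvdpZl.
have [q [q1 qg nqg]] : exists q : {poly F}, [/\ size q != 1, q %| g & ~~ (q %= g)].
  apply: contrapT => H; apply: g_red; split=> //.
  move=> q q1 qg; apply/negPn/negP => nqg; apply: H; exists q; split=> //.
have q0 : q != 0 by apply: contraTneq qg => ->; rewrite dvd0p.
have q_lt : (size q < s)%N.
  rewrite -sg ltn_neqAle dvdp_leq // andbT; apply: contra nqg => /eqP E.
  by rewrite -dvdp_size_eqp // E.
have q_gt1 : (1 < size q)%N by case: (size q) (size_poly_eq0 q) q1 => [|[]] //; rewrite (negPf q0).
case: (IH _ q_lt q erefl); first by [].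
by move=> f [f1 f2 f3]; exists f; split=> //; apply: dvdp_trans qg.
Qed.

Lemma exists_multiplicity f g : (1 < size f)%N -> g != 0 ->
  exists c h, g = f ^+ c * h /\ ~~ (f %| h).
Proof.
move=> f_gt1; have f0 : f != 0 by rewrite -size_poly_gt0 (ltn_trans _ f_gt1).
elim/ltn_ind: {g}(size g) {-2}g (erefl (size g)) => s IH g sg g0.
have [/dvdpP[q gq]|nfg] := boolP (f %| g); last by exists 0%N, g; rewrite expr0 mul1r.
have q0 : q != 0 by apply: contra_neq g0 => q0; rewrite gq q0 mul0r.
have q_lt : (size q < s)%N.
  rewrite -sg gq size_mul // -(ltn_predK f_gt1) addnS /= -[X in (X < _)%N]addn0.
  by rewrite ltn_add2l -ltnS (ltn_predK f_gt1).
have [c [h [qE nfh]]] := IH _ q_lt q erefl q0.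
by exists c.+1, h; rewrite gq qE exprS mulrC mulrA.
Qed.

Lemma irreducible_coprime f g : irreducible_poly f -> ~~ (f %| g) -> coprimep f g.
Proof.
move=> [f_gt1 f_irr] nfg; apply: contraT => nco; case/negP: nfg.
have := f_irr _ nco (dvdp_gcdl f g) => /andP[_ fd]; apply: dvdp_trans fd _.
exact: dvdp_gcdr.
Qed.

Lemma monic_irreducible_coprime f g : f \is monic -> g \is monic ->
  irreducible_poly f -> irreducible_poly g -> f != g -> coprimep f g.
Proof.
move=> f_mon g_mon f_irr g_irr fg; apply: irreducible_coprime => //.
apply: contra fg => f_dvd_g; rewrite -eqp_monic //.
by case: g_irr => _; apply=> //; case: f_irr => /gtn_eqF ->.
Qed.

End IrreducibleFactors.

Section CyclicSplitting.
Variable F : fieldType.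
Implicit Types (f g h : {poly F}).

Lemma pmx_tr n (A : 'M[F]_n) g : pmx A^T g = (pmx A g)^T.
Proof.
elim/poly_ind: g => [|g c IHg]; first by rewrite !pmx0 trmx0.
by rewrite !pmxD [in LHS]mulrC !pmxM !pmxX !pmxC linearD /= trmx_mul tr_scalar_mx IHg.
Qed.

Definition krylov n (A : 'M[F]_n) (w : 'rV[F]_n) d : 'M[F]_(d, n) :=
  \matrix_(l < d) (w *m A ^+ l).

Lemma mul_krylov n (A : 'M[F]_n) w d (v : 'rV_d) :
  v *m krylov A w d = w *m pmx A (rVpoly v).
Proof.
rewrite mulmx_sum_row /rVpoly poly_def.
elim/big_rec2: _ => [|i x y _ ->]; first by rewrite pmx0 mulmx0.
rewrite pmxD mulmxDr rowK pmxZ pmx_Xn -scalemxAr; congr (_ *: _ + _).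
by rewrite insubT // => lt_i; congr (v 0 _); apply: val_inj.
Qed.

Lemma mul_pmx_modp n (A : 'M[F]_n) m (w : 'M_(m, n)) g h :
  w *m pmx A h = 0 -> w *m pmx A (g %% h) = w *m pmx A g.
Proof.
move=> wh; rewrite {2}(divp_eq g h) pmxD (mulrC _ h) pmxM mulmxDr mulmxA wh.
by rewrite mul0mx add0r.
Qed.

Lemma krylov_intertwine n (A : 'M[F]_n) w h : h \is monic -> w *m pmx A h = 0 ->
  krylov A w (size h).-1 *m A = companionmx h *m krylov A w (size h).-1.
Proof.
move=> h_mon wh; apply/row_matrixP => i; rewrite !rowE !mulmxA mul_krylov.
rewrite mulmx_companion // mul_krylov poly_rV_K; last first.
  by rewrite -ltnS prednK ?size_poly_gt0 ?ltn_modp ?monic_neq0.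
by rewrite mul_pmx_modp // pmxM pmxX mulmxA.
Qed.

Lemma krylov_free n (A : 'M[F]_n) w d :
  (forall g, (size g <= d)%N -> w *m pmx A g = 0 -> g = 0) ->
  row_free (krylov A w d).
Proof.
move=> ann; apply: inj_row_free => v; rewrite mul_krylov => /ann v0.
by apply: (can_inj rVpolyK); rewrite v0 ?size_poly ?linear0.
Qed.

(* The complement of the cyclic submodule generated by [w] is the annihilator of the
   functionals x |-> x A^l u, where u sends w A^l to [l = d - 1]: on the cyclic submodule
   they have an anti-triangular Hankel matrix with ones on the antidiagonal. *)
Lemma split_cyclic n (A : 'M[F]_n) (w : 'rV_n) (e h : {poly F}) : h \is monic ->
  w *m pmx A h = 0 ->
  (forall g, (size g <= (size h).-1)%N -> w *m pmx A g = 0 -> g = 0) ->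
  w *m pmx A e = w -> pmx A (e * h) = 0 ->
  exists (P : 'M_((size h).-1, n)) (Q : 'M_(n, (size h).-1)),
    [/\ P *m Q = 1%:M, P *m A = companionmx h *m P & A *m Q = Q *m companionmx h].
Proof.
move=> h_mon wh ann we eh; set d := (size h).-1; set C := companionmx h.
pose P : 'M_(d, n) := krylov A w d.
have PA : P *m A = C *m P by apply: krylov_intertwine.
have P_free : row_free P by apply: krylov_free.
pose u : 'cV_n := pinvmx P *m (\col_(i < d) (i.+1 == d)%:R).
have Pu : P *m u = \col_(i < d) (i.+1 == d)%:R by rewrite mulmxA mulmxVp ?mul1mx.
(* On the cyclic submodule [e(A)] is the identity, so [u'] takes the same values there as [u]; since
   [e * h] kills everything, [h(A)] kills [u'], and the [d] vectors A^l u' span an invariant space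
   of columns. *)
clearbody u; pose u' : 'cV_n := pmx A e *m u.
pose Q0 : 'M_(n, d) := (krylov A^T u'^T d)^T.
have Q0A : A *m Q0 = Q0 *m C^T.
  apply: trmx_inj; rewrite !trmx_mul !trmxK; apply: krylov_intertwine => //.
  by rewrite pmx_tr -trmx_mul mulmxA -pmxM mulrC eh mul0mx trmx0.
have PQ0_unit : P *m Q0 \in unitmx.
  rewrite -row_free_unit; apply: inj_row_free => c; rewrite mulmxA mul_krylov => cQ.
  apply: (can_inj rVpolyK); rewrite linear0; set g := rVpoly c.
  apply/eqP/negPn/negP => g0; have g_sz : (size g <= d)%N by apply: size_poly.
  have g_gt0 : (0 < size g)%N by rewrite size_poly_gt0.
  (* Multiplication by X^k raises the degree of [g] to exactly d - 1, the coefficient that [u]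
     reads: the leading coefficient of [g] would then be 0. *)
  pose k := (d - size g)%N.
  have k_lt : (k < d)%N by rewrite ltn_subrL g_gt0 (leq_trans g_gt0).
  have d_gt0 : (0 < d)%N by apply: leq_trans k_lt.
  have yQ (v : 'rV_d) : w *m pmx A g *m pmx A (rVpoly v) *m u' = 0.
    apply: trmx_inj; rewrite trmx0 trmx_mul [(w *m _ *m _)^T]trmx_mul -pmx_tr mulmxA -mul_krylov.
    by rewrite -mulmxA -[krylov _ _ _]trmxK -trmx_mul cQ trmx0 mulmx0.
  have gX_sz : (size (g * 'X^k)%R <= d)%N.
    by rewrite size_mulXn // subnK.
  have := yQ (poly_rV 'X^k); rewrite poly_rV_K ?size_polyXn //.
  have -> : w *m pmx A g *m pmx A 'X^k *m u' = w *m pmx A (g * 'X^k) *m u.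
    rewrite -[in RHS]we -!mulmxA; congr (w *m _); rewrite !mulmxA -!pmxM.
    by rewrite [e * _]mulrC.
  rewrite -[g * _](poly_rV_K gX_sz) -mul_krylov -mulmxA -/P Pu.
  move=> /matrixP/(_ 0 0); rewrite !mxE.
  have d1_lt : (d.-1 < d)%N by rewrite prednK.
  rewrite (bigD1 (Ordinal d1_lt)) //= !mxE /= prednK // eqxx mulr1 big1 ?addr0; last first.
    move=> i; rewrite -val_eqE /= => ni; rewrite [X in _ * X]mxE; case: eqP => [E|]; last by rewrite mulr0.
    by case/eqP: ni; rewrite -[X in _ = X.-1]E.
  rewrite coefMXn ifF; last first.
    apply/negbTE; rewrite -leqNgt /k -subn1 leq_sub2l //.
  move=> lc0; case/negP: g0; rewrite -lead_coef_eq0 /lead_coef.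
  by have <- : (d.-1 - k)%N = (size g).-1; [rewrite /k -!subn1 subnAC subKn|apply/eqP].
(* The inverse of the Hankel matrix normalises the projection. By [CH] that matrix intertwines the
   companion matrix with its transpose, which turns the [C^T] in [Q0A] into [C]. *)
pose Q : 'M_(n, d) := Q0 *m invmx (P *m Q0).
have CH : C *m (P *m Q0) = (P *m Q0) *m C^T by rewrite mulmxA -PA -!mulmxA Q0A.
exists P, Q; split=> //; first by rewrite mulmxA mulmxV.
rewrite /Q mulmxA Q0A -!mulmxA; congr (_ *m _).
apply: (can_inj (mulKmx PQ0_unit)); rewrite mulKVmx // mulmxA -CH.
by rewrite -(mulmxA C) mulmxV // mulmx1.
Qed.

(** If the minimal polynomial is f^a h with h prime to f, some w = w0 h(A) is killed by f^a but not
    by f^(a-1). From the Bezout relation s f^a + t h = 1, the polynomial t h acts as the identity on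
    w, and t h f^a kills the whole space: this is the [e] required by [split_cyclic]. *)
Lemma exists_split n (A : 'M[F]_n) : (0 < n)%N ->
  exists (f : {poly F}) (a : nat) (P : 'M_((size (f ^+ a)).-1, n)) (Q : 'M_(n, (size (f ^+ a)).-1)),
    [/\ f \is monic, irreducible_poly f, (0 < a)%N & [/\ P *m Q = 1%:M,
      P *m A = companionmx (f ^+ a) *m P & A *m Q = Q *m companionmx (f ^+ a)]].
Proof.
case: n A => // n A _; have mu_mon := mxminpoly_monic A.
have mu_gt1 : (1 < size (mxminpoly A))%N by rewrite size_mxminpoly ltnS mxminpoly_nonconstant.
have [f [f_mon f_irr f_mu]] := exists_irreducible_factor mu_gt1.
have f_gt1 : (1 < size f)%N by case: f_irr.
have f0 := monic_neq0 f_mon.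
have [a [h [muE nfh]]] := exists_multiplicity f_gt1 (monic_neq0 mu_mon).
have a_gt0 : (0 < a)%N.
  by rewrite lt0n; apply: contra nfh => /eqP a0; rewrite -[h]mul1r -(expr0 f) -a0 -muE.
have co_fa_h : coprimep (f ^+ a) h by rewrite coprimep_expl // irreducible_coprime.
have /Bezout_eq1_coprimepP[[s t] /= st] := co_fa_h.
have h0 : h != 0 by apply: contra nfh => /eqP ->; apply: dvdp0.
have pmx_dvdmu g : (pmx A g == 0) = (mxminpoly A %| g) by rewrite dvd_mxminpoly.
have [w0 w0P] : exists w0 : 'rV_n.+1, w0 *m pmx A (f ^+ a.-1 * h) != 0.
  have : pmx A (f ^+ a.-1 * h) != 0.
    rewrite pmx_dvdmu muE dvdp_mul2r // -(prednK a_gt0) dvdp_Pexp2l // -ltnNge prednK //.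
  case/rowV0Pn => v /submxP[w0 vE] v0; exists w0; by rewrite -vE.
pose w := w0 *m pmx A h.
have wfa : w *m pmx A (f ^+ a) = 0.
  rewrite /w -mulmxA -pmxM mulrC -muE; have /eqP -> : pmx A (mxminpoly A) == 0 by rewrite pmx_dvdmu.
  by rewrite mulmx0.
have wfa1 : w *m pmx A (f ^+ a.-1) != 0 by rewrite /w -mulmxA -pmxM mulrC.
clearbody w; have we : w *m pmx A (t * h) = w.
  have wsf : w *m pmx A (s * f ^+ a) = 0 by rewrite mulrC pmxM mulmxA wfa mul0mx.
  by rewrite -[in RHS](mulmx1 w) -(pmx1 A) -st pmxD mulmxDr wsf add0r.
have ehfa : pmx A (t * h * f ^+ a) = 0.
  by apply/eqP; rewrite pmx_dvdmu muE -mulrA (mulrC h) dvdp_mull.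
have [|P [Q PQ]] := split_cyclic (monic_exp a f_mon) wfa _ we ehfa; last by exists f, a, P, Q.
(* Write g = f^c g1 with g1 prime to f. The degree bound forces c < a, and g1 acts invertibly on
   vectors killed by f^a, so already f^c kills [w], against the choice of [w]. *)
move=> g g_sz wg; apply/eqP/negPn/negP => g0.
have [c [g1 [gE nfg1]]] := exists_multiplicity f_gt1 g0.
have c_lt : (c < a)%N.
  have : f ^+ c %| g by rewrite gE dvdp_mulr.
  move/(dvdp_leq g0); rewrite ltnNge; apply: contraL => ac; rewrite -ltnNge.
  have fa0 b : f ^+ b != 0 by rewrite expf_neq0.
  rewrite (leq_ltn_trans g_sz) // (leq_trans (_ : _ < size (f ^+ a))%N) ?prednK ?size_poly_gt0 //.
  by rewrite dvdp_leq // dvdp_exp2l.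
have wfc : w *m pmx A (f ^+ c) = 0.
  have co : coprimep g1 (f ^+ a) by rewrite coprimep_sym coprimep_expl // irreducible_coprime.
  have : (w *m pmx A (f ^+ c) <= (0 : 'M_n.+1))%MS.
    apply: (@pmx_coprime_submx _ _ _ _ A _ _ g1 (f ^+ a) co).
    - by rewrite mul0mx sub0mx.
    - by rewrite -mulmxA -pmxM -gE wg sub0mx.
    - by rewrite -mulmxA pmx_comm mulmxA wfa mul0mx sub0mx.
  by rewrite submx0 => /eqP.
case/negP: wfa1; apply/eqP; apply: (pmx_dvd _ wfc).
by rewrite dvdp_exp2l // -ltnS prednK.
Qed.

End CyclicSplitting.

Section DecompositionExistence.
Variable F : fieldType.

(** Once a cyclic summand is split off, the kernel of its projection [Q0] is an invariant complement
    of smaller dimension, with basis [R] and coordinate map [S]; the induction applies to the action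
    [A'] on it. *)
Lemma exists_mxdecomp n (A : 'M[F]_n) :
  exists (I : finType) (f : I -> {poly F}) (a : I -> nat),
    (forall i, [/\ f i \is monic, irreducible_poly (f i) & (0 < a i)%N]) /\
    exists P Q, mxdecomp A (fun i => companionmx (f i ^+ a i)) P Q.
Proof.
elim/ltn_ind: n A => n IHn A.
have [n0|n_gt0] := posnP n.
  exists void, (of_void _), (of_void _); split=> [[]|].
  exists (fun=> 0), (fun=> 0).
  by split=> [[]|[]||[]]; subst n; rewrite [LHS]flatmx0 [RHS]flatmx0.
have [f [a [P0 [Q0 [f_mon f_irr a_gt0 [PQ PA AQ]]]]]] := exists_split A n_gt0.
set C0 := companionmx _ in PA AQ.
pose R := row_base (kermx Q0); pose r := \rank (kermx Q0).
have R_free : row_free R by apply: row_base_free.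
have RQ0 : R *m Q0 = 0 by apply/sub_kermxP; rewrite eq_row_base.
pose S : 'M_(n, r) := (1%:M - Q0 *m P0) *m pinvmx R.
have SR : S *m R = 1%:M - Q0 *m P0.
  rewrite /S mulmxKpV // eq_row_base; apply/sub_kermxP.
  by rewrite mulmxBl mul1mx -mulmxA PQ mulmx1 subrr.
clearbody S; clearbody R.
have RS : R *m S = 1%:M.
  apply: (row_free_inj R_free); rewrite -mulmxA SR mul1mx mulmxBr mulmx1.
  by rewrite mulmxA RQ0 mul0mx subr0.
have P0S : P0 *m S = 0.
  apply: (row_free_inj R_free); rewrite -mulmxA SR mul0mx mulmxBr mulmx1.
  by rewrite mulmxA PQ mul1mx subrr.
pose A' : 'M_r := R *m A *m S.
have RA : R *m A = A' *m R.
  rewrite /A' -!mulmxA SR mulmxBr mulmx1 mulmxBr (mulmxA A) AQ -!mulmxA.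
  by rewrite (mulmxA R) RQ0 mul0mx subr0.
clearbody A'; have r_lt : (r < n)%N.
  rewrite /r mxrank_ker ltn_subrL n_gt0 andbT lt0n mxrank_eq0.
  have C0_gt0 : (0 < (size (f ^+ a)).-1)%N.
    by rewrite size_exp muln_gt0 a_gt0 andbT -ltnS prednK; case: f_irr => // /ltnW.
  apply: contra_eqN PQ => /eqP ->; rewrite mulmx0 eq_sym -mxrank_eq0 mxrank1.
  by rewrite -lt0n.
have [I [g [b [gb [P [Q [PQ1 PQ0 QP PA']]]]]]] := IHn r r_lt A'.
exists (unit + I)%type, (fun x => if x is inr i then g i else f), (fun x => if x is inr i then b i else a).
split; first by case=> [[]|i] //=.
exists (fun x => match x return 'M_((size ((if x is inr i then g i else f) ^+ (if x is inr i then b i else a))).-1, n) with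
  inr i => P i *m R | inl _ => P0 end).
exists (fun x => match x return 'M_(n, (size ((if x is inr i then g i else f) ^+ (if x is inr i then b i else a))).-1) with
  inr i => S *m Q i | inl _ => Q0 end).
split.
- by case=> [[]|i] //=; rewrite mulmxA -(mulmxA _ R) RS mulmx1.
- case=> [[]|i] [[]|j] //= ij; rewrite ?mulmxA ?P0S ?mul0mx //.
    by rewrite -mulmxA RQ0 mulmx0.
  by rewrite -(mulmxA _ R) RS mulmx1 PQ0.
- rewrite big_sumType /= big_const cardE enumT unlock /= addr0.
  under eq_bigr do rewrite -mulmxA (mulmxA (Q _)).
  by rewrite -mulmx_sumr -mulmx_suml QP mul1mx SR addrC subrK.
- by case=> [[]|i] //=; rewrite -mulmxA RA !mulmxA PA'.
Qed.

Lemma mxdecomp_reindex n (A : 'M[F]_n) (I J : finType) (t : J -> I) (d : I -> nat)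
    (C : forall i, 'M_(d i)) P Q : bijective t -> mxdecomp A C P Q ->
  mxdecomp A (fun j => C (t j)) (fun j => P (t j)) (fun j => Q (t j)).
Proof.
move=> t_bij [PQ1 PQ0 QP PA]; split=> // [i j ij|].
  by rewrite PQ0 // (inj_eq (bij_inj t_bij)).
by rewrite -QP [RHS](reindex t) //; apply: onW_bij.
Qed.

(** The sizes of the blocks depend on the polynomials, so rewriting a single block is ill-typed;
    equality of the whole families is needed. *)
Lemma mxdecomp_eq_companion n (A : 'M[F]_n) (I : finType) (c c' : I -> {poly F}) :
  c =1 c' -> (exists P Q, mxdecomp A (fun i => companionmx (c i)) P Q) ->
  exists P Q, mxdecomp A (fun i => companionmx (c' i)) P Q.
Proof. by move=> /funext ->. Qed.

Lemma mxdecomp_conj m n (A : 'M[F]_n) (D : 'M[F]_m) X Y (I : finType) (d : I -> nat)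
    (C : forall i, 'M_(d i)) P Q :
  X *m Y = 1%:M -> Y *m X = 1%:M -> X *m A = D *m X -> mxdecomp D C P Q ->
  mxdecomp A C (fun i => P i *m X) (fun i => Y *m Q i).
Proof.
move=> XY YX XA [PQ1 PQ0 QP PD]; split.
- by move=> i; rewrite mulmxA -(mulmxA (P i)) XY mulmx1 PQ1.
- by move=> i j ij; rewrite mulmxA -(mulmxA (P i)) XY mulmx1 PQ0.
- rewrite -[RHS]YX -[X in RHS]mul1mx -QP mulmx_suml mulmx_sumr.
  by apply: eq_bigr => i _; rewrite !mulmxA.
- by move=> i; rewrite -mulmxA XA !mulmxA PD.
Qed.

End DecompositionExistence.

Section BlockDiagonal.
Variables (F : fieldType) (k : nat) (p_ : 'I_k -> nat).

Definition mxincl i : 'M[F]_(p_ i, \sum_i p_ i) := submxcol 1%:M i.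
Definition mxproj i : 'M[F]_(\sum_i p_ i, p_ i) := submxrow 1%:M i.

Lemma mxdecomp_mxdiag (C : forall i, 'M[F]_(p_ i)) :
  mxdecomp (mxdiag C) C mxincl mxproj.
Proof.
have PQ i j : mxincl i *m mxproj j = submxblock 1%:M i j.
  by rewrite /mxincl /mxproj mul_submxrow mulmx1 submxblockEv.
split.
- by move=> i; rewrite PQ -mxdiagZ submxblock_diag.
- by move=> i j ij; rewrite PQ -mxdiagZ mxblockK (negPf ij).
- by rewrite -mul_mxrow_mxcol submxrowK submxcolK mulmx1.
- move=> i; rewrite /mxincl submxcol_mul mul1mx -[mxdiag C]mulmx1 -[X in mxdiag C *m X]submxcolK.
  by rewrite mul_mxdiag_mxcol mxcolK.
Qed.

Lemma mxdecomp_similar n (A : 'M[F]_n) (C : forall i, 'M[F]_(p_ i)) P Q :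
  mxdecomp A C P Q ->
  [/\ mxcol P *m mxrow Q = 1%:M, mxrow Q *m mxcol P = 1%:M &
      mxcol P *m A = mxdiag C *m mxcol P].
Proof.
move=> [PQ1 PQ0 QP PA]; split.
- rewrite mul_mxcol_mxrow -mxdiagZ; apply/eq_mxblock => i j.
  by have [->|ij] := eqVneq i j; rewrite ?PQ1 ?conform_mx_id ?PQ0.
- by rewrite mul_mxrow_mxcol.
- rewrite mul_mxdiag_mxcol mxcol_mul; apply: eq_mxcol => i; exact: PA.
Qed.

End BlockDiagonal.

Lemma mxdecomp_group (F : fieldType) n (A : 'M[F]_n) k (l : 'I_k -> nat)
    (d : forall i, 'I_(l i) -> nat) (C : forall i j, 'M_(d i j))
    (P : forall x : {i : 'I_k & 'I_(l i)}, 'M_(d (tag x) (tagged x), n)) Q :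
  mxdecomp A (fun x : {i : 'I_k & 'I_(l i)} => C (tag x) (tagged x)) P Q ->
  mxdecomp A (fun i => \mxdiag_j C i j)
    (fun i => \mxcol_j P (Tagged _ j)) (fun i => \mxrow_j Q (Tagged _ j)).
Proof.
move=> [PQ1 PQ0 QP PA]; split.
- move=> i; rewrite mul_mxcol_mxrow -mxdiagZ; apply/eq_mxblock => j j'.
  have [->|jj'] := eqVneq j j'; first by rewrite conform_mx_id (PQ1 (Tagged _ j')).
  by rewrite (PQ0 (Tagged _ j) (Tagged _ j')) // eq_Tagged.
- move=> i i' ii'; rewrite mul_mxcol_mxrow -[RHS]mxblock0; apply/eq_mxblock => j j'.
  rewrite (PQ0 (Tagged _ j) (Tagged _ j')) //; apply: contra ii' => /eqP E.
  by have := congr1 tag E => /= ->.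
- rewrite -[RHS]QP. under eq_bigr do rewrite mul_mxrow_mxcol.
  rewrite sig_big_dep /=; apply: eq_bigr => -[i j] _ //.
- move=> i; rewrite mul_mxdiag_mxcol mxcol_mul; apply: eq_mxcol => j.
  exact: (PA (Tagged _ j)).
Qed.

(** Passing from k to k + 1 raises the sum by the number of parts exceeding k. These numbers form
    the conjugate partition, and their differences are the multiplicities of the parts. *)
Lemma eq_sorted_geq (s t : seq nat) :
  sorted geq s && (0%N \notin s) -> sorted geq t && (0%N \notin t) ->
  (forall k, \sum_(x <- s) minn k x = \sum_(x <- t) minn k x)%N -> s = t.
Proof.
move=> /andP[s_sort s0] /andP[t_sort t0] st.
have cntE k (u : seq nat) : (\sum_(x <- u) minn k.+1 x = \sum_(x <- u) minn k x + count (ltn k) u)%N.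
  elim: u => [|x u IHu]; first by rewrite !big_nil.
  rewrite !big_cons IHu /= addnACA; congr (_ + _)%N.
  by case: (ltnP k x) => kx; lia.
have cnt k : count (ltn k) s = count (ltn k) t.
  by have := st k.+1; rewrite !cntE st => /addnI.
apply: (sorted_eq (leT := geq)) => //.
- by move=> x y z /= yx xz; apply: leq_trans xz yx.
- by move=> x y /= /andP[xy yx]; apply/eqP; rewrite eqn_leq xy yx.
apply/allP => x _ /=; case: x => [|x].
  by rewrite (count_memPn s0) (count_memPn t0).
have memE (u : seq nat) : (count_mem x.+1 u + count (ltn x.+1) u = count (ltn x) u)%N.
  elim: u => //= y u <-; rewrite addnACA; congr (_ + _)%N.
  by case: ltngtP => //.
by rewrite -(eqn_add2r (count (ltn x.+1) s)) memE cnt -memE cnt.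
Qed.

(** * Embeddings of modules *)

Section Embeddings.
Variable F : finFieldType.
Implicit Types (f g h : {poly F}).

(* A square matrix A makes row vectors an F[t]-module, t acting by right multiplication:
   phi is an injective F[t]-linear map from the module of B to that of A. *)
Definition embeddings m n (B : 'M[F]_m) (A : 'M[F]_n) : {set 'M[F]_(m, n)} :=
  [set phi | row_free phi && (phi *m A == B *m phi)].

(* The cokernel of phi has no f-torsion. *)
Definition torsion_free m n f (A : 'M[F]_n) (phi : 'M[F]_(m, n)) : bool :=
  [forall x : 'rV[F]_n, (x *m pmx A f <= phi)%MS ==> (x <= phi)%MS].

(** The automorphism group of the module of [B]. *)
Definition unit_centralizer m (B : 'M[F]_m) : {set 'M[F]_m} :=
  [set X | (X \in unitmx) && (X *m B == B *m X)].

Lemma torsion_freeP m n f (A : 'M[F]_n) (phi : 'M_(m, n)) :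
  reflect (forall k (x : 'M_(k, n)), (x *m pmx A f <= phi)%MS -> (x <= phi)%MS)
          (torsion_free f A phi).
Proof.
apply: (iffP forallP) => [tf k x xf|tf x]; last by apply/implyP; apply: tf.
apply/row_subP => i; apply: (implyP (tf _)).
by rewrite -row_mul (submx_trans (row_sub _ _)).
Qed.

Lemma torsion_freeM m n f g (A : 'M[F]_n) (phi : 'M_(m, n)) :
  torsion_free f A phi -> torsion_free g A phi -> torsion_free (f * g) A phi.
Proof.
move=> /torsion_freeP f_free /torsion_freeP g_free; apply/torsion_freeP => k x.
by rewrite pmxM mulmxA => /g_free/f_free.
Qed.

Lemma torsion_free1 m n (A : 'M[F]_n) (phi : 'M_(m, n)) : torsion_free 1 A phi.
Proof. by apply/torsion_freeP => k x; rewrite pmx1 mulmx1. Qed.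

Lemma torsion_freeX m n f k (A : 'M[F]_n) (phi : 'M_(m, n)) :
  torsion_free f A phi -> torsion_free (f ^+ k) A phi.
Proof.
move=> f_free; elim: k => [|k IHk]; first exact: torsion_free1.
by rewrite exprS torsion_freeM.
Qed.

Lemma torsion_free_eqmx m1 m2 n f (A : 'M[F]_n) (U : 'M_(m1, n)) (V : 'M_(m2, n)) :
  (U :=: V)%MS -> torsion_free f A U = torsion_free f A V.
Proof. by move=> UV; apply: eq_forallb => x; rewrite !UV. Qed.

(** Torsion-freeness places the whole kernel of [g(A)] inside the image of [phi], which is a copy of
    the module of [B]. *)
Lemma rank_ker_embedding m n (B : 'M[F]_m) (A : 'M[F]_n) phi g :
  phi \in embeddings B A -> torsion_free g A phi ->
  \rank (kermx (pmx A g)) = \rank (kermx (pmx B g)).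
Proof.
rewrite inE => /andP[phi_free /eqP phiA] /torsion_freeP tf.
rewrite -(mxrankMfree (kermx (pmx B g)) phi_free); apply/eqP.
rewrite eqn_leq !mxrankS //.
  apply/sub_kermxP; rewrite -mulmxA (pmx_intertwine _ phiA) mulmxA mulmx_ker.
  by rewrite mul0mx.
have /submxP[y kE] : (kermx (pmx A g) <= phi)%MS by apply: tf; rewrite mulmx_ker sub0mx.
rewrite kE submxMr //; apply/sub_kermxP/(row_free_inj phi_free).
by rewrite mul0mx -mulmxA -(pmx_intertwine _ phiA) mulmxA -kE mulmx_ker.
Qed.

(** As [g] kills the source, every embedding lands in the kernel of [g(A)], hence in the image of
    [phi0]. So it is X phi0 for a unique X, invertible by ranks and commuting with [B]; conversely,
    composition with an automorphism keeps the image, on which alone [P] depends. *)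
Lemma card_torsion_free_embeddings m n (B : 'M[F]_m) (A : 'M[F]_n) phi0 (P : pred 'M[F]_(m, n)) g :
  (forall phi psi : 'M_(m, n), (phi :=: psi)%MS -> P phi -> P psi) ->
  (forall phi, P phi -> torsion_free g A phi) -> pmx B g = 0 ->
  phi0 \in embeddings B A -> P phi0 ->
  #|[set phi in embeddings B A | P phi]| = #|unit_centralizer B|.
Proof.
move=> Peq Ptf Bg phi0_emb Pphi0.
have := phi0_emb; rewrite inE => /andP[phi0_free /eqP phi0A].
rewrite -(card_imset _ (row_free_inj phi0_free)).
apply: eq_card => phi; rewrite inE; apply/andP/imsetP; last first.
  move=> [X]; rewrite inE => /andP[X_unit /eqP XB] ->.
  split; last by apply: Peq Pphi0; apply: eqmx_sym; apply: eqmxMfull; rewrite row_full_unit.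
  rewrite inE -!mulmxA phi0A !mulmxA XB eqxx andbT.
  by rewrite /row_free mxrankMfree // -/(row_free X) row_free_unit.
rewrite inE => -[/andP[phi_free /eqP phiA] _].
have /submxP[X phiE] : (phi <= phi0)%MS.
  apply: (torsion_freeP _ _ _ (Ptf _ Pphi0)).
  by rewrite (pmx_intertwine _ phiA) Bg mul0mx sub0mx.
exists X => //; rewrite inE -row_free_unit /row_free -(mxrankMfree X phi0_free) -phiE.
rewrite -/(row_free phi) phi_free; apply/eqP/(row_free_inj phi0_free).
by rewrite -mulmxA -phi0A mulmxA -phiE phiA phiE mulmxA.
Qed.

End Embeddings.

(** * Independent torsion tuples of the cokernel *)

Section Tuples.
Variables (F : finFieldType) (d : nat) (f : {poly F}).
Hypotheses (f_mon : f \is monic) (f_irr : irreducible_poly f) (f_sz : size f = d.+2).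

Lemma card_rowspace m n (U : 'M[F]_(m, n)) :
  #|[set x : 'rV_n | (x <= U)%MS]| = (#|F| ^ \rank U)%N.
Proof.
have E : [set x : 'rV_n | (x <= U)%MS] = [set y *m row_base U | y in [set: 'rV_(\rank U)]].
  apply/setP => x; rewrite inE -(eq_row_base U); apply/submxP/imsetP => [[y ->]|[y _ ->]].
    by exists y.
  by exists y.
rewrite E card_imset ?cardsT ?card_mx ?mul1n //.
exact/row_free_inj/row_base_free.
Qed.

Section FixedMatrix.
Variables (m n : nat) (A : 'M[F]_n) (phi : 'M[F]_(m, n)).

(** Here [d.+1] is the degree of [f]. When f(A) sends [Psi] into the invariant span of [phi], the
    powers up to A^d generate the rest modulo [phi]. *)
Definition orbit_rows k (Psi : 'M[F]_(k, n)) : 'M[F]_(\sum_(l < d.+1) k, n) :=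
  \mxcol_(l < d.+1) (Psi *m A ^+ l).

Definition extension k (Psi : 'M[F]_(k, n)) : 'M[F]_(m + \sum_(l < d.+1) k, n) :=
  col_mx phi (orbit_rows Psi).

(* The tuples Psi of f-torsion elements of the cokernel of phi that are linearly
   independent over F[t]/(f). *)
Definition torsion_tuples k : {set 'M[F]_(k, n)} :=
  [set Psi | (Psi *m pmx A f <= phi)%MS && row_free (extension Psi)].

(** The preimage, among row vectors, of the f-torsion of the cokernel of [phi]. *)
Definition torsion_space : 'M[F]_n := kermx (pmx A f *m cokermx phi).

Lemma sub_torsion_space k (x : 'M[F]_(k, n)) :
  (x <= torsion_space)%MS = (x *m pmx A f <= phi)%MS.
Proof. by rewrite (sameP sub_kermxP eqP) mulmxA -submxE. Qed.

Hypotheses (phi_free : row_free phi) (phi_stable : (phi *m A <= phi)%MS).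

Lemma stable_pmx k (U : 'M[F]_(k, n)) g : (U *m A <= U)%MS -> (U *m pmx A g <= U)%MS.
Proof.
move=> UA; elim/poly_ind: g => [|g c IHg]; first by rewrite pmx0 mulmx0 sub0mx.
rewrite pmxD pmxM pmxX pmxC mulmxDr addmx_sub ?mul_mx_scalar ?scalemx_sub //.
by rewrite mulmxA (submx_trans (submxMr _ IHg)).
Qed.

Lemma torsion_space_stable : (torsion_space *m A <= torsion_space)%MS.
Proof.
rewrite sub_torsion_space -mulmxA -[X in X *m pmx A f](pmxX A) pmx_comm pmxX mulmxA.
by rewrite (submx_trans (submxMr _ _) phi_stable) // -sub_torsion_space.
Qed.

Lemma phi_sub_torsion_space : (phi <= torsion_space)%MS.
Proof. by rewrite sub_torsion_space stable_pmx. Qed.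

Lemma orbit_rows_sub k l (Psi : 'M[F]_(k, n)) (U : 'M[F]_(l, n)) :
  reflect (forall j : 'I_d.+1, (Psi *m A ^+ j <= U)%MS) (orbit_rows Psi <= U)%MS.
Proof.
apply: (iffP idP) => [PsiU j|PsiU].
  apply: submx_trans PsiU; rewrite -(mxcolK (fun l : 'I_d.+1 => Psi *m A ^+ l) j).
  by rewrite -[mxcol _]mul1mx -submxcol_mul submxMl.
apply/row_subP => i; rewrite row_mxcol.
by apply: submx_trans (PsiU _); apply: row_sub.
Qed.

Lemma extension_sub k l (Psi : 'M[F]_(k, n)) (U : 'M[F]_(l, n)) :
  (extension Psi <= U)%MS = (phi <= U)%MS && (orbit_rows Psi <= U)%MS.
Proof. by rewrite col_mx_sub. Qed.

Lemma sub_extension k (Psi : 'M[F]_(k, n)) (g : {poly F}) :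
  (size g <= d.+1)%N -> (Psi *m pmx A g <= extension Psi)%MS.
Proof.
move=> g_sz; have orb : (orbit_rows Psi <= extension Psi)%MS.
  by have := submx_refl (extension Psi); rewrite extension_sub => /andP[].
rewrite -[g]coefK; move: g_sz; set s := size g => g_sz; rewrite poly_def.
apply: (big_ind (fun g => Psi *m pmx A g <= extension Psi)%MS).
- by rewrite pmx0 mulmx0 sub0mx.
- by move=> g1 g2 s1 s2; rewrite pmxD mulmxDr addmx_sub.
- move=> i _; rewrite pmxZ pmx_Xn -scalemxAr scalemx_sub //.
  have /orbit_rows_sub/(_ (Ordinal (leq_trans (ltn_ord i) g_sz))) := orb.
  by [].
Qed.

Lemma extension_pmx_mod k (Psi : 'M[F]_(k, n)) (g : {poly F}) :
  (Psi *m pmx A f <= phi)%MS -> (Psi *m pmx A g <= extension Psi)%MS.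
Proof.
move=> Psif; have phiU : (phi <= extension Psi)%MS.
  by have := submx_refl (extension Psi); rewrite extension_sub => /andP[].
rewrite (divp_eq g f) pmxD mulmxDr addmx_sub //; last first.
  by rewrite sub_extension // -ltnS -f_sz ltn_modp monic_neq0.
rewrite mulrC pmxM mulmxA (submx_trans _ phiU) // (submx_trans (submxMr _ Psif)) //.
exact: stable_pmx.
Qed.

Lemma extension_stable k (Psi : 'M[F]_(k, n)) :
  (Psi *m pmx A f <= phi)%MS -> (extension Psi *m A <= extension Psi)%MS.
Proof.
move=> Psif; rewrite /extension mul_col_mx -/(extension Psi) col_mx_sub.
have phiU : (phi <= extension Psi)%MS.
  by have := submx_refl (extension Psi); rewrite extension_sub => /andP[].
rewrite (submx_trans phi_stable phiU) /orbit_rows mxcol_mul.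
apply/row_subP => i; rewrite row_mxcol (submx_trans (row_sub _ _)) //.
have -> : Psi *m A ^+ tagnat.sig1 i *m A = Psi *m pmx A ('X^(tagnat.sig1 i) * 'X).
  by rewrite pmxM pmxX pmx_Xn mulmxA.
exact: extension_pmx_mod.
Qed.

Lemma extension_sub_torsion_space k (Psi : 'M[F]_(k, n)) :
  (Psi *m pmx A f <= phi)%MS -> (extension Psi <= torsion_space)%MS.
Proof.
move=> Psif; rewrite extension_sub phi_sub_torsion_space /=.
apply/orbit_rows_sub => j; rewrite -(pmx_Xn A).
have := stable_pmx 'X^j torsion_space_stable; apply: submx_trans.
by rewrite submxMr // sub_torsion_space.
Qed.

(* If x f(A) lies in phi but x is not in the stable space U above phi, then the g with
   x g(A) in U form the proper ideal (f), so x, xA, ..., x A^d are independent modulo U. *)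
Lemma rank_add_krylov k (U : 'M[F]_(k, n)) (x : 'rV_n) :
  (U *m A <= U)%MS -> (x *m pmx A f <= U)%MS -> ~~ (x <= U)%MS ->
  \rank (U + krylov A x d.+1)%MS = (\rank U + d.+1)%N.
Proof.
move=> UA xf xU; have key (g : {poly F}) : (size g <= d.+1)%N -> (x *m pmx A g <= U)%MS -> g = 0.
  move=> g_sz xg; apply/eqP/negPn/negP => g0; case/negP: xU.
  have co : coprimep f g.
    apply: irreducible_coprime => //; apply/negP => /(dvdp_leq g0).
    by rewrite f_sz leqNgt ltnS g_sz.
  exact: (pmx_coprime_submx co UA).
have kry_free : row_free (krylov A x d.+1).
  by apply: krylov_free => g g_sz xg; apply: key => //; rewrite xg sub0mx.
rewrite mxrank_disjoint_sum; first by rewrite (eqP kry_free).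
apply/eqP/rowV0P => v; rewrite sub_capmx => /andP[vU /submxP[c vc]].
move: vU; rewrite vc mul_krylov => /key c0.
by rewrite c0 ?size_poly ?pmx0 ?mulmx0.
Qed.

Lemma extension_col_mx k (x : 'rV_n) (Psi : 'M[F]_(k, n)) :
  (extension (col_mx x Psi) :=: extension Psi + krylov A x d.+1)%MS.
Proof.
apply/eqmxP/andP; split; last first.
  rewrite addsmx_sub extension_sub.
  have := submx_refl (extension (col_mx x Psi)).
  rewrite {1}extension_sub => /andP[-> /orbit_rows_sub xPsi] /=.
  apply/andP; split.
    apply/orbit_rows_sub => j; apply: submx_trans (xPsi j).
    by rewrite mul_col_mx; have := submx_refl (col_mx (x *m A ^+ j) (Psi *m A ^+ j));
      rewrite {1}col_mx_sub => /andP[].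
  apply/row_subP => j; rewrite rowK; apply: submx_trans (xPsi j).
  by rewrite mul_col_mx; have := submx_refl (col_mx (x *m A ^+ j) (Psi *m A ^+ j));
    rewrite {1}col_mx_sub => /andP[].
rewrite extension_sub; have := addsmxSl (extension Psi) (krylov A x d.+1).
rewrite extension_sub => /andP[-> /orbit_rows_sub Psi_sub] /=.
apply/orbit_rows_sub => j; rewrite mul_col_mx col_mx_sub Psi_sub andbT.
apply: submx_trans (addsmxSr _ _).
by rewrite -[x *m _](rowK (fun l : 'I_d.+1 => x *m A ^+ l)) row_sub.
Qed.

Lemma col_mx_torsion_tuples k (x : 'rV_n) (Psi : 'M[F]_(k, n)) :
  (col_mx x Psi \in torsion_tuples k.+1) =
  [&& Psi \in torsion_tuples k, (x <= torsion_space)%MS & ~~ (x <= extension Psi)%MS].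
Proof.
rewrite !inE (mul_col_mx x Psi) (col_mx_sub (x *m _) (Psi *m _)) sub_torsion_space.
case xf : (x *m pmx A f <= phi)%MS; last by rewrite !andbF.
case Psif : (Psi *m pmx A f <= phi)%MS => //=.
have phiU : (phi <= extension Psi)%MS.
  by have := submx_refl (extension Psi); rewrite extension_sub => /andP[].
rewrite {1}/row_free extension_col_mx.
have [xU|xU] := boolP (x <= extension Psi)%MS; rewrite ?andbF ?andbT.
  have -> : \rank (extension Psi + krylov A x d.+1)%MS = \rank (extension Psi).
    apply/eqmx_rank/eqmxP; apply: addsmx_idPl.
    apply/row_subP => j; rewrite rowK -(pmx_Xn A).
    apply: submx_trans (stable_pmx 'X^j (extension_stable Psif)).
    by rewrite submxMr.
  apply/negbTE; rewrite neq_ltn (leq_ltn_trans (rank_leq_row _)) //.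
  by rewrite ltn_add2l !sum_nat_const card_ord ltn_pmul2l.
rewrite rank_add_krylov ?extension_stable // ?(submx_trans xf) // /row_free.
have -> : (\sum_(l < d.+1) k.+1 = \sum_(l < d.+1) k + d.+1)%N.
  by rewrite !sum_nat_const card_ord mulnS addnC.
by rewrite addnA eqn_add2r.
Qed.

(** A tuple can be prolonged exactly by the vectors of the torsion space outside its own extension,
    which has dimension m + k deg f. Whenever a tuple exists its extension lies in the torsion
    space, so the subtraction is not truncated there. *)
Lemma card_torsion_tuplesS k :
  #|torsion_tuples k.+1| =
  (#|torsion_tuples k| * (#|F| ^ \rank torsion_space - #|F| ^ (m + k * d.+1)))%N.
Proof.
rewrite -[LHS]sum1_card.
rewrite (reindex (fun xP : 'rV[F]_n * 'M[F]_(k, n) => col_mx xP.1 xP.2 : 'M_(k.+1, n))) /=; last first.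
  exists (fun M : 'M_(1 + k, n) => (usubmx M, dsubmx M)) => [[x P] _|M _] /=.
    by rewrite col_mxKu col_mxKd.
  by rewrite vsubmxK.
rewrite (eq_bigl (fun xP => (xP.2 \in torsion_tuples k) &&
  (xP.1 \in [set x : 'rV_n | (x <= torsion_space)%MS] :\: [set x : 'rV_n | (x <= extension xP.2)%MS]))); last first.
  by move=> [x P] /=; rewrite col_mx_torsion_tuples [x \in _ :\: _]inE [x \in [set _ | _]]inE
    [x \in [set _ | _]]inE [~~ _ && _]andbC.
pose S P := [set x : 'rV_n | (x <= torsion_space)%MS] :\: [set x : 'rV_n | (x <= @extension k P)%MS].
rewrite -(pair_big_dep (fun x : 'rV_n => true)
  (fun x P => (P \in torsion_tuples k) && (x \in S P)) (fun _ _ => 1%N)) /=.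
rewrite (exchange_big_dep (mem (torsion_tuples k))) /=; last by move=> x P _ /andP[].
rewrite -sum_nat_const; apply: eq_bigr => P PT.
rewrite (eq_bigl (mem (S P))); last by move=> x; rewrite PT.
rewrite sum1_card cardsD; move: PT; rewrite inE => /andP[Pf Pfree].
rewrite card_rowspace; congr (_ - _)%N.
have -> : [set x : 'rV_n | (x <= torsion_space)%MS] :&: [set x : 'rV_n | (x <= extension P)%MS] =
    [set x : 'rV_n | (x <= extension P)%MS].
  apply/setIidPr/subsetP => x; rewrite !inE => xP.
  by apply: submx_trans xP _; apply: extension_sub_torsion_space.
rewrite card_rowspace (eqP Pfree); congr (_ ^ (_ + _))%N.
by rewrite sum_nat_const card_ord mulnC.
Qed.

Lemma card_torsion_tuples0 : #|torsion_tuples 0| = 1%N.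
Proof.
rewrite -(cards1 (0 : 'M[F]_(0, n))); apply: eq_card => Psi.
rewrite !inE [Psi]flatmx0 eqxx mul0mx sub0mx /= /row_free.
suff -> : \rank (extension (0 : 'M_(0, n))) = m by rewrite sum_nat_const muln0 addn0 eqxx.
rewrite -[RHS](eqP phi_free); apply/eqmx_rank/eqmxP/eqmxP/andP.
rewrite extension_sub submx_refl; split.
  by apply/orbit_rows_sub => j; rewrite mul0mx sub0mx.
by have := submx_refl (extension (0 : 'M_(0, n))); rewrite extension_sub => /andP[].
Qed.

End FixedMatrix.
End Tuples.

Section TupleCount.
Variables (F : finFieldType) (d : nat) (f : {poly F}).
Hypotheses (f_mon : f \is monic) (f_irr : irreducible_poly f) (f_sz : size f = d.+2).
Variables (m n : nat) (A : 'M[F]_n) (phi : 'M[F]_(m, n)).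
Hypotheses (phi_free : row_free phi) (phi_stable : (phi *m A <= phi)%MS).

(** The number [e] is the length of a longest independent tuple, which avoids giving the torsion of
    the cokernel an explicit vector space structure over F[t]/(f). *)
Lemma rank_torsion_space : exists e, \rank (torsion_space f A phi) = (m + e * d.+1)%N.
Proof.
have ex0 : exists k, #|torsion_tuples d f A phi k.+1| == 0%N.
  exists n; rewrite cards_eq0; apply/eqP/setP => Psi; rewrite !inE.
  apply/negbTE/negP => /andP[_ /eqP E].
  have := rank_leq_col (extension d A phi Psi); rewrite E sum_nat_const card_ord.
  by nia.
case: (ex_minnP ex0) => e e0 e_min; exists e; apply/eqP.
have Te : #|torsion_tuples d f A phi e| != 0%N.
  case: e e_min e0 => [|e] e_min _; first by rewrite card_torsion_tuples0.
  by apply/negP => /e_min; rewrite ltnn.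
rewrite eqn_leq; apply/andP; split.
  move: e0; rewrite card_torsion_tuplesS // muln_eq0 (negPf Te) /= subn_eq0.
  by rewrite leq_exp2l ?card_finNzRing_gt1.
rewrite cards_eq0 in Te; case/set0Pn: Te => Psi; rewrite inE => /andP[Psif /eqP rk].
have /mxrankS : (extension d A phi Psi <= torsion_space f A phi)%MS.
  exact: extension_sub_torsion_space.
by rewrite rk sum_nat_const card_ord mulnC.
Qed.

Lemma torsion_free_rank :
  torsion_free f A phi = (\rank (torsion_space f A phi) == m).
Proof.
have phi_sub : (phi <= torsion_space f A phi)%MS by apply: phi_sub_torsion_space.
have : (\rank phi == \rank (torsion_space f A phi)) = (torsion_space f A phi <= phi)%MS.
  by apply/eqP/idP => [E|E]; [rewrite -(geq_leqif (mxrank_leqif_sup phi_sub)) E|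
     apply/eqP; rewrite eqn_leq !mxrankS].
rewrite (eqP phi_free) eq_sym => ->; apply/torsion_freeP/idP => [tf|le k x].
  by apply: tf; rewrite -sub_torsion_space.
by rewrite -sub_torsion_space => /submx_trans; apply.
Qed.

(** The power of [#|F|] counts the lifts of a tuple from the cokernel, [#|F| ^ m] for each of its
    [k] members; the product counts independent k-tuples in an e-dimensional space over the residue
    field, and its factor j = e makes it vanish for k > e. *)
Lemma card_torsion_tuples (R : realDomainType) : exists e,
  (torsion_free f A phi = (e == 0%N)) /\
  forall k, #|torsion_tuples d f A phi k|%:R =
    #|F|%:R ^+ (m * k) * \prod_(j < k) ((#|F| ^ d.+1)%N%:R ^+ e - (#|F| ^ d.+1)%N%:R ^+ j) :> R.
Proof.
have [e rk] := rank_torsion_space; exists e; split.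
  by rewrite torsion_free_rank rk -[X in _ == X]addn0 eqn_add2l muln_eq0 orbF.
elim=> [|k IHk]; first by rewrite card_torsion_tuples0 // muln0 big_ord0 mulr1.
rewrite card_torsion_tuplesS // natrM IHk big_ord_recr /= rk.
have [ke|ek] := leqP k e; last first.
  rewrite [\prod_(j < k) _](bigD1 (Ordinal ek)) //= subrr mul0r mulr0 mul0r.
  by rewrite mul0r mulr0.
rewrite natrB; last by rewrite leq_exp2l ?card_finNzRing_gt1 // leq_add2l leq_mul2r ke orbT.
set D := _ - _; set P := \prod_(i < k) _.
have -> : D = #|F|%:R ^+ m * ((#|F| ^ d.+1)%:R ^+ e - (#|F| ^ d.+1)%:R ^+ k).
  by rewrite /D !expnD !natrM mulrBr !natrX -!exprM ![(_ * d.+1)%N]mulnC.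
by rewrite (mulnS m k) exprD; ring.
Qed.

End TupleCount.

(** * Matrices of extensions by copies of F[t]/(f) *)

Section ExtensionMatrix.
Variables (F : finFieldType) (d : nat) (f : {poly F}).
Hypotheses (f_mon : f \is monic) (f_sz : size f = d.+2).

(* The block [d.+1 * k] square matrix is the action of t on k copies of F[t]/(f), the
   coordinates being grouped by powers of t; Y records where f(t) sends the k generators. *)
Definition ext_coef (l l' : 'I_d.+1) : F :=
  if l == d :> nat then - f`_l' else (l.+1 == l' :> nat)%:R.

Definition ext_mx m k (B : 'M[F]_m) (Y : 'M[F]_(k, m)) : 'M[F]_(m + \sum_(l < d.+1) k) :=
  block_mx B 0 (\mxcol_(l < d.+1) (if l == d :> nat then Y else 0 : 'M[F]_(k, m)))
    (\mxblock_(l < d.+1, l' < d.+1) ((ext_coef l l')%:M : 'M[F]_(k, k))).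

Variables (m n k : nat) (B : 'M[F]_m) (A : 'M[F]_n).

Lemma ext_mx_intertwine (phi : 'M[F]_(m, n)) (X : 'M[F]_(\sum_(l < d.+1) k, n)) Y :
  col_mx phi X *m A = ext_mx B Y *m col_mx phi X <->
  phi *m A = B *m phi /\ forall l : 'I_d.+1, submxcol X l *m A =
    (if l == d :> nat then Y *m phi else 0) + \sum_l' ext_coef l l' *: submxcol X l'.
Proof.
rewrite mul_col_mx mul_block_col mul0mx addr0.
have -> : (\mxcol_(l < d.+1) (if l == d :> nat then Y else 0 : 'M[F]_(k, m))) *m phi +
    \mxblock_(l < d.+1, l' < d.+1) ((ext_coef l l')%:M : 'M[F]_(k, k)) *m X =
    \mxcol_(l < d.+1) ((if l == d :> nat then Y *m phi else 0) +
      \sum_l' ext_coef l l' *: submxcol X l').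
  rewrite mxcolD mxcol_mul -{1}[X]submxcolK mul_mxblock_mxrow.
  congr (_ + _); apply: eq_mxcol => l; first by case: ifP; rewrite ?mul0mx.
  by apply: eq_bigr => l' _; rewrite mul_scalar_mx.
have -> : X *m A = \mxcol_l (submxcol X l *m A) by rewrite -mxcol_mul submxcolK.
split.
  by case/eq_col_mx => -> /eq_mxcolP E; split.
by case=> -> E; congr col_mx; apply/eq_mxcolP.
Qed.

Lemma mul_pmx_f (Psi : 'M[F]_(k, n)) :
  Psi *m pmx A f = Psi *m A ^+ d.+1 + \sum_(l < d.+1) f`_l *: (Psi *m A ^+ l).
Proof.
have -> : pmx A f = A ^+ d.+1 + \sum_(l < d.+1) f`_l *: A ^+ l.
  rewrite -{1}[f]coefK f_sz poly_def big_ord_recr /=.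
  have -> : f`_d.+1 = 1 by have /monicP := f_mon; rewrite /lead_coef f_sz.
  rewrite scale1r pmxD pmx_Xn addrC; congr (_ + _).
  elim/big_rec2: _ => [|i y x _ <-]; first exact: pmx0.
  by rewrite pmxD pmxZ pmx_Xn.
rewrite mulmxDr mulmx_sumr; congr (_ + _).
by apply: eq_bigr => l _; rewrite scalemxAr.
Qed.

Lemma ext_coef_sum (l : 'I_d.+1) (g : nat -> 'M[F]_(k, n)) : (l < d)%N ->
  \sum_l' ext_coef l l' *: g l' = g l.+1.
Proof.
move=> l_lt; have l1_lt : (l.+1 < d.+1)%N by [].
rewrite (bigD1 (Ordinal l1_lt)) //= /ext_coef ltn_eqF //= eqxx scale1r big1 ?addr0 //.
by move=> l'; rewrite -val_eqE /= eq_sym => /negPf ->; rewrite scale0r.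
Qed.

Lemma ext_coef_sum_last (l : 'I_d.+1) (g : nat -> 'M[F]_(k, n)) : l == d :> nat ->
  \sum_l' ext_coef l l' *: g l' = - \sum_(l' < d.+1) f`_l' *: g l'.
Proof.
by move=> ld; rewrite -sumrN; apply: eq_bigr => l' _; rewrite /ext_coef ld scaleNr.
Qed.

Lemma extension_intertwine (phi : 'M[F]_(m, n)) (Psi : 'M[F]_(k, n)) Y :
  extension d A phi Psi *m A = ext_mx B Y *m extension d A phi Psi <->
  phi *m A = B *m phi /\ Psi *m pmx A f = Y *m phi.
Proof.
have shift l : Psi *m A ^+ l *m A = Psi *m A ^+ l.+1 by rewrite exprSr -mulmxE mulmxA.
have subE (l : 'I_d.+1) : submxcol (orbit_rows d A Psi) l = Psi *m A ^+ l by rewrite mxcolK.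
have sumE (l : 'I_d.+1) : \sum_l' ext_coef l l' *: submxcol (orbit_rows d A Psi) l' =
    \sum_l' ext_coef l l' *: (Psi *m A ^+ l').
  by apply: eq_bigr => l' _; rewrite subE.
rewrite ext_mx_intertwine mul_pmx_f; split=> -[phiA E]; split=> //.
  have := E ord_max; rewrite subE sumE shift eqxx.
  by rewrite (ext_coef_sum_last (fun l => Psi *m A ^+ l)) // => ->; rewrite subrK.
move=> l; rewrite subE sumE shift; case: ifP => [ld|/negbT ld].
  rewrite (ext_coef_sum_last (fun l => Psi *m A ^+ l)) // -E (eqP ld) addrK.
  by [].
have l_lt : (l < d)%N by rewrite ltn_neqAle ld -ltnS ltn_ord.
by rewrite (ext_coef_sum (fun l => Psi *m A ^+ l)) // add0r.
Qed.

(** Before the last block row, [ext_mx] only shifts: each block of [X] is the previous one times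
    [A], so the first block determines all of them. *)
Lemma ext_mx_orbit (phi : 'M[F]_(m, n)) (X : 'M[F]_(\sum_(l < d.+1) k, n)) Y :
  col_mx phi X *m A = ext_mx B Y *m col_mx phi X ->
  X = orbit_rows d A (submxcol X ord0 : 'M_(k, n)).
Proof.
case/ext_mx_intertwine => _ E.
have key l : (l <= d)%N -> submxcol X (inord l) = submxcol X ord0 *m A ^+ l :> 'M_(k, n).
  elim: l => [|l IHl] l_le.
    by rewrite expr0 mulmx1; congr submxcol; apply: val_inj; rewrite /= inordK.
  have lE : (inord l : 'I_d.+1) = l :> nat by rewrite inordK // ltnS ltnW.
  rewrite exprSr -mulmxE mulmxA -IHl 1?ltnW // E lE ltn_eqF // add0r.
  have := @ext_coef_sum (inord l) (fun l => submxcol X (inord l)); rewrite lE => <- //.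
  by apply: eq_bigr => l' _; rewrite inord_val.
rewrite -[LHS]submxcolK; apply: eq_mxcol => l.
by rewrite -key ?inord_val // -ltnS.
Qed.

End ExtensionMatrix.

Section ExtensionSums.
Variables (F : finFieldType) (d : nat) (f : {poly F}).
Hypotheses (f_mon : f \is monic) (f_irr : irreducible_poly f) (f_sz : size f = d.+2).
Variables (m n k : nat) (B : 'M[F]_m) (A : 'M[F]_n).

Lemma extension_free (phi : 'M[F]_(m, n)) (Psi : 'M[F]_(k, n)) :
  row_free (extension d A phi Psi) -> row_free phi.
Proof.
move=> ext_free; apply: inj_row_free => v v0.
have : row_mx v 0 *m extension d A phi Psi = 0 by rewrite mul_row_col mul0mx addr0.
rewrite -[RHS](mul0mx _ (extension d A phi Psi)) => /(row_free_inj ext_free).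
by rewrite -[0 in RHS]row_mx0 => /eq_row_mx[].
Qed.

Lemma extension_embedding (phi : 'M[F]_(m, n)) (Psi : 'M[F]_(k, n)) Y :
  (extension d A phi Psi \in embeddings (ext_mx d f B Y) A) =
  [&& phi \in embeddings B A, Psi \in torsion_tuples d f A phi k &
      Y == Psi *m pmx A f *m pinvmx phi].
Proof.
rewrite !inE; case ext_free : (row_free _); last by rewrite andbF /= andbF.
have phi_free := extension_free ext_free; rewrite phi_free andbT /=.
apply/eqP/and3P => [/(extension_intertwine f_mon f_sz)[-> E]|[/eqP phiA Psif /eqP YE]].
  by split; rewrite ?E ?submxMl ?mulmxKp.
by apply/(extension_intertwine f_mon f_sz); split=> //; rewrite YE mulmxKpV.
Qed.

(** Stacking [phi] above the orbit of [Psi] is the bijection. The matrix [Y] is determined by the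
    pair through Psi f(A) = Y phi, so summing over all [Y] meets each pair exactly once. *)
Lemma sum_torsion_tuples (R : nmodType) (G : 'M[F]_(m, n) -> R) :
  \sum_(phi in embeddings B A) G phi *+ #|torsion_tuples d f A phi k| =
  \sum_(Y : 'M[F]_(k, m)) \sum_(phi in embeddings (ext_mx d f B Y) A) G (usubmx phi).
Proof.
pose h (p : 'M[F]_(m, n) * 'M[F]_(k, n)) := extension d A p.1 p.2.
pose h' (phi : 'M[F]_(m + \sum_(l < d.+1) k, n)) : 'M[F]_(m, n) * 'M[F]_(k, n) :=
  (usubmx phi, submxcol (dsubmx phi) (ord0 : 'I_d.+1)).
have hK p : h' (h p) = p.
  by case: p => phi Psi; rewrite /h' /h /extension col_mxKu col_mxKd mxcolK expr0 mulmx1.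
have h'K Y phi : phi \in embeddings (ext_mx d f B Y) A -> h (h' phi) = phi.
  rewrite inE => /andP[_ /eqP]; rewrite -[phi in X in X -> _]vsubmxK => /ext_mx_orbit E.
  by rewrite /h /h' /extension /= -E vsubmxK.
under [RHS]eq_bigr => Y _ do rewrite (reindex_onto h h' (h'K Y)) /=.
rewrite (exchange_big_dep xpredT) //=.
rewrite (eq_bigr (fun phi => \sum_(Psi in torsion_tuples d f A phi k) G phi)); last first.
  by move=> phi _; rewrite sumr_const.
rewrite pair_big_dep /= big_mkcond; apply: eq_bigr => -[phi Psi] _ /=.
rewrite (eq_bigl (fun Y => [&& phi \in embeddings B A, Psi \in torsion_tuples d f A phi k &
      Y == Psi *m pmx A f *m pinvmx phi])); last first.
  by move=> Y; rewrite hK eqxx andbT extension_embedding.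
case: (phi \in _); last by rewrite big_pred0.
case: (Psi \in _); last by rewrite big_pred0.
by rewrite big_pred1_eq /h /extension col_mxKu.
Qed.

(** The image of [phi] differs from that of its upper part by f-torsion only, which is invisible to
    [h]. Hence conditions at the other polynomials pass through the extension step of the sieve. *)
Lemma torsion_free_usubmx h (phi : 'M[F]_(m + \sum_(l < d.+1) k, n)) Y :
  coprimep h f -> phi \in embeddings (ext_mx d f B Y) A ->
  torsion_free h A phi = torsion_free h A (usubmx phi).
Proof.
move=> co_hf; rewrite inE => /andP[phi_free /eqP phiA].
have := phiA; rewrite -{1 2}[phi]vsubmxK => phiA'.
have XE := ext_mx_orbit phiA'; rewrite XE in phiA'.
set phi0 := usubmx phi in phiA' *; set Psi : 'M_(k, n) := submxcol _ _ in phiA'.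
have phiE : phi = extension d A phi0 Psi by rewrite /extension -XE vsubmxK.
case/(extension_intertwine f_mon f_sz): phiA' => phi0A Psif.
have phi0_stable : (phi0 *m A <= phi0)%MS by rewrite phi0A submxMl.
have phi_stable : (phi *m A <= phi)%MS by rewrite phiA submxMl.
have phi0_sub : (phi0 <= phi)%MS.
  by rewrite -[phi in X in (_ <= X)%MS]vsubmxK -addsmxE addsmxSl.
have phif : (phi *m pmx A f <= phi0)%MS.
  rewrite -sub_torsion_space phiE; apply: extension_sub_torsion_space => //.
  by rewrite Psif submxMl.
apply/torsion_freeP/torsion_freeP => tf l x xh.
  have xphi : (x <= phi)%MS by apply/tf/(submx_trans xh).
  apply: (pmx_coprime_submx co_hf phi0_stable xh).
  by rewrite (submx_trans (submxMr _ xphi)).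
have xf : (x *m pmx A f <= phi0)%MS.
  apply: tf; rewrite -mulmxA pmx_comm mulmxA.
  by rewrite (submx_trans (submxMr _ xh)).
by apply: (pmx_coprime_submx co_hf phi_stable xh); apply: submx_trans xf _.
Qed.

End ExtensionSums.

(** * The group algebra of laws *)

Section GroupAlgebra.
Variables (G : finZmodType) (R : comNzRingType).

(** Laws on [G] as elements of its group algebra: the law of a sum of independent variables is a
    convolution, so with a commutative ring structure big products express laws of sums. *)
Definition galg : Type := {ffun G -> R}.
HB.instance Definition _ := GRing.Zmodule.on galg.
Implicit Types (u v w : galg).

Definition galg_one : galg := [ffun b : G => (b == 0)%:R].
Definition galg_mul u v : galg := [ffun b : G => \sum_c u c * v (b - c)].

Fact galg_mulC : commutative galg_mul.
Proof.
move=> u v; apply/ffunP => b; rewrite !ffunE (reindex_inj (inv_inj (subKr b))) /=.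
by apply: eq_bigr => c _; rewrite subKr mulrC.
Qed.

Fact galg_mulA : associative galg_mul.
Proof.
move=> u v w; apply/ffunP => b; rewrite !ffunE.
under eq_bigr do rewrite ffunE mulr_sumr.
under [RHS]eq_bigr do rewrite ffunE mulr_suml.
rewrite [RHS]exchange_big; apply: eq_bigr => c _ /=.
rewrite [RHS](reindex_inj (addrI c)) /=; apply: eq_bigr => a _.
by rewrite [c + a]addrC addrK mulrA opprD addrA addrAC.
Qed.

Fact galg_mul1 : left_id galg_one galg_mul.
Proof.
move=> u; apply/ffunP => b; rewrite ffunE (bigD1 0) //= ffunE eqxx mul1r subr0.
by rewrite big1 ?addr0 // => c /negPf c0; rewrite ffunE c0 mul0r.
Qed.

Fact galg_mulDl : left_distributive galg_mul +%R.
Proof.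
move=> u v w; apply/ffunP => b; rewrite !ffunE -big_split.
by apply: eq_bigr => c _; rewrite ffunE mulrDl.
Qed.

HB.instance Definition _ :=
  GRing.Zmodule_isComPzRing.Build galg galg_mulA galg_mulC galg_mul1 galg_mulDl.

Lemma galg_mulE u v b : (u * v) b = \sum_c u c * v (b - c).
Proof. by rewrite /GRing.mul /= ffunE. Qed.

Lemma galg_oneE b : (1 : galg) b = (b == 0)%:R.
Proof. by rewrite /GRing.one /= ffunE. Qed.

Lemma galg_sumE I (r : seq I) (P : pred I) (u : I -> galg) b :
  (\sum_(i <- r | P i) u i) b = \sum_(i <- r | P i) u i b.
Proof. exact: sum_ffunE. Qed.

Definition mass u : R := \sum_b u b.

Lemma massM u v : mass (u * v) = mass u * mass v.
Proof.
rewrite /mass mulr_suml; under eq_bigr do rewrite galg_mulE.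
rewrite exchange_big; apply: eq_bigr => c _ /=; rewrite mulr_sumr.
rewrite (reindex_inj (addIr c)) /=; apply: eq_bigr => b _.
by rewrite addrK.
Qed.

Lemma mass1 : mass 1 = 1.
Proof.
rewrite /mass (bigD1 0) //= galg_oneE eqxx big1 ?addr0 // => b /negPf b0.
by rewrite galg_oneE b0.
Qed.

Lemma mass_prod I (r : seq I) (P : pred I) (u : I -> galg) :
  mass (\prod_(i <- r | P i) u i) = \prod_(i <- r | P i) mass (u i).
Proof. exact: (big_morph mass massM mass1). Qed.

(* The element c * [g] of the group algebra. *)
Definition dirac (c : R) (g : G) : galg := [ffun b => c *+ (b == g)].

Lemma diracM c c' g g' : dirac c g * dirac c' g' = dirac (c * c') (g + g').
Proof.
apply/ffunP => b; rewrite galg_mulE ffunE (bigD1 g) //= !ffunE eqxx mulr1n.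
rewrite big1 ?addr0 => [|a /negPf ag]; last by rewrite ffunE ag mulr0n mul0r.
by rewrite -mulrnAr subr_eq [g' + g]addrC.
Qed.

Lemma dirac1 : dirac 1 0 = 1.
Proof. by apply/ffunP => b; rewrite [RHS]galg_oneE [LHS]ffunE. Qed.

Lemma dirac_prod I (r : seq I) (P : pred I) (c : I -> R) (g : I -> G) :
  \prod_(i <- r | P i) dirac (c i) (g i) =
  dirac (\prod_(i <- r | P i) c i) (\sum_(i <- r | P i) g i).
Proof.
by elim/big_rec3: _ => [|i x y z _ ->]; rewrite ?dirac1 // diracM.
Qed.

End GroupAlgebra.

Section PushForward.
Variables (F : finFieldType) (m : nat) (R : comNzRingType).
Local Notation G := 'rV[F]_m.

(** The law of [a *: v] when [a] has law [u]; additivity in [a] makes it multiplicative for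
    convolution. *)
Definition push (v : G) (u : galg F R) : galg G R := \sum_a dirac (u a) (a *: v).

Lemma pushM v (u u' : galg F R) : push v (u * u') = push v u * push v u'.
Proof.
rewrite /push mulr_suml; under [RHS]eq_bigr do rewrite mulr_sumr.
have dirac_sum (g : G) (I : finType) (c : I -> R) : dirac (\sum_i c i) g = \sum_i dirac (c i) g.
  by apply/ffunP => b; rewrite galg_sumE ffunE -sumrMnl; apply: eq_bigr => i _; rewrite ffunE.
transitivity (\sum_a \sum_c dirac (u c * u' (a - c)) (a *: v)).
  by apply: eq_bigr => a _; rewrite galg_mulE dirac_sum.
rewrite exchange_big; apply: eq_bigr => c _ /=.
rewrite (reindex_inj (addIr c)) /=; apply: eq_bigr => a _.
by rewrite addrK diracM scalerDl [c *: v + _]addrC.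
Qed.

Lemma push1 v : push v 1 = 1.
Proof.
rewrite /push (bigD1 0) //= galg_oneE eqxx scale0r dirac1 big1 ?addr0 // => a /negPf a0.
by rewrite galg_oneE a0; apply/ffunP => b; rewrite !ffunE mul0rn.
Qed.

Lemma push_prod v I (r : seq I) (P : pred I) (u : I -> galg F R) :
  push v (\prod_(i <- r | P i) u i) = \prod_(i <- r | P i) push v (u i).
Proof. exact: (big_morph _ (pushM v) (push1 v)). Qed.

Lemma pushE v u b : push v u b = \sum_a u a *+ (b == a *: v).
Proof. by rewrite galg_sumE; apply: eq_bigr => a _; rewrite ffunE. Qed.

Lemma mass_push v u : mass (push v u) = mass u.
Proof.
rewrite /mass; under eq_bigr do rewrite pushE.
rewrite exchange_big; apply: eq_bigr => a _ /=.
by rewrite (bigD1 (a *: v)) //= eqxx big1 ?addr0 // => b /negPf ->.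
Qed.

(* The law of the sum of the independent vectors [x_j *: row j Phi], i.e. of [x *m Phi]. *)
Lemma prod_pushE n (Phi : 'M[F]_(n, m)) (w : 'I_n -> galg F R) b :
  (\prod_j push (row j Phi) (w j)) b =
  \sum_(x : 'rV[F]_n) (\prod_j w j (x 0 j)) *+ (x *m Phi == b).
Proof.
rewrite bigA_distr_bigA /= galg_sumE.
rewrite (reindex (fun x : 'rV[F]_n => [ffun j => x 0 j])) /=; last first.
  exists (fun f : {ffun 'I_n -> F} => \row_j f j) => [x _|f _].
    by apply/rowP => j; rewrite mxE ffunE.
  by apply/ffunP => j; rewrite ffunE mxE.
apply: eq_bigr => x _; rewrite dirac_prod ffunE eq_sym mulmx_sum_row.
rewrite [in LHS](eq_bigr (fun j => w j (x 0 j))) => [|j _]; last by rewrite ffunE.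
by rewrite (eq_bigr (fun j => x 0 j *: row j Phi)
  (F1 := fun j => [ffun j => x 0 j] j *: row j Phi)) // => j _; rewrite ffunE.
Qed.

End PushForward.

Section Nonnegative.
Variables (G : finZmodType) (R : realDomainType).
Implicit Types (u v w : galg G R).

Lemma galg_mul_ge0 u v : (forall b, 0 <= u b) -> (forall b, 0 <= v b) ->
  forall b, 0 <= (u * v) b.
Proof. by move=> u0 v0 b; rewrite galg_mulE sumr_ge0 // => c _; rewrite mulr_ge0. Qed.

Lemma galg_prod_ge0 I (r : seq I) (P : pred I) (u : I -> galg G R) :
  (forall i b, P i -> 0 <= u i b) -> forall b, 0 <= (\prod_(i <- r | P i) u i) b.
Proof.
move=> u0; apply: (big_ind (fun u : galg G R => forall b, 0 <= u b)).
- by move=> b; rewrite galg_oneE ler0n.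
- exact: galg_mul_ge0.
- by move=> i Pi b; apply: u0.
Qed.

Lemma galg_mul_bound u v c : (forall b, u b <= c) -> (forall b, 0 <= v b) ->
  forall b, (u * v) b <= c * mass v.
Proof.
move=> uc v0 b; rewrite mulrC galg_mulE /mass mulr_sumr; apply: ler_sum => a _.
by rewrite [leLHS]mulrC ler_wpM2r.
Qed.

Lemma galg_le_mass u : (forall b, 0 <= u b) -> forall b, u b <= mass u.
Proof. by move=> u0 b; rewrite /mass (bigD1 b) //= lerDl sumr_ge0. Qed.

End Nonnegative.

Lemma push_ge0 (F : finFieldType) m (R : realDomainType) (v : 'rV[F]_m) (u : galg F R) :
  (forall a, 0 <= u a) -> forall b, 0 <= push v u b.
Proof. by move=> u0 b; rewrite pushE sumr_ge0 // => a _; rewrite mulrn_wge0. Qed.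

(** * Mixing of balanced laws *)

Definition balanced_law (F : finFieldType) (R : realFieldType) (eps : R) (u : galg F R) : Prop :=
  (forall a, 0 <= u a <= 1 - eps) /\ mass u = 1.

Section Mixing.
Variables (p : nat) (R : realFieldType) (eps : R).
Hypotheses (p_prime : prime p) (eps_gt0 : 0 < eps) (eps_le1 : eps <= 1).
Local Notation F := 'F_p.
Implicit Types (u v : galg F R) (s : seq (galg F R)).

Let cardF : #|F| = p. Proof. exact: card_Fp. Qed.
Let p_gt1 : (1 < p)%N. Proof. exact: prime_gt1. Qed.
Let p_gt0 : 0 < p%:R :> R. Proof. by rewrite ltr0n ltnW. Qed.

(** If the union of the two translates were no larger than [S], then [S] would be stable under
    adding y - x, which generates the additive group of F_p. *)
Lemma card_translates (S : {set F}) (x y : F) : x != y -> S != set0 -> S != setT ->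
  (#|S| < #|[set (x + a)%R | a in S] :|: [set (y + a)%R | a in S]|)%N.
Proof.
move=> xy S0 ST; rewrite ltnNge; apply/negP => le.
have cardT z : #|[set (z + a)%R | a in S]| = #|S| by apply/card_imset/addrI.
have subx : [set (x + a)%R | a in S] = [set (x + a)%R | a in S] :|: [set (y + a)%R | a in S].
  by apply/eqP; rewrite eqEcard subsetUl cardT.
have suby : [set (y + a)%R | a in S] \subset [set (x + a)%R | a in S] by rewrite subx subsetUr.
have closed a : a \in S -> a + (y - x) \in S.
  move=> aS; have /(subsetP suby)/imsetP[b bS] : y + a \in [set (y + a)%R | a in S] by apply: imset_f.
  by move=> E; have -> : a + (y - x) = b by rewrite addrCA addrA E addrC addKr.
have closedn a k : a \in S -> a + (y - x) *+ k \in S.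
  by move=> aS; elim: k => [|k IHk]; rewrite ?addr0 // mulrSr addrA closed.
case/set0Pn: S0 => a aS; case/eqP: ST; apply/setP => b; rewrite inE.
have yx0 : y - x != 0 by rewrite subr_eq0 eq_sym.
have := closedn a ((b - a) / (y - x)) aS.
rewrite -mulr_natr natr_Zp mulrC divfK // addrC subrK => ->.
by [].
Qed.

(** At least [eps] of mass lies on the p - 1 other points, so they cannot all have mass below eps /
    p. *)
Lemma exists_atom u (x0 : F) : balanced_law eps u -> exists2 y, y != x0 & eps / p%:R <= u y.
Proof.
move=> [u01 u1]; apply/exists_inP; apply: contraT; rewrite negb_exists_in => /forall_inP small.
have le : \sum_(a | a != x0) u a <= p.-1%:R * (eps / p%:R).
  apply: (@le_trans _ _ (\sum_(a : F | a != x0) eps / p%:R)).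
    by apply: ler_sum => a /small; rewrite -ltNge => /ltW.
  rewrite sumr_const mulr_natl le_eqVlt; apply/orP; left; apply/eqP; congr (_ *+ _).
  by transitivity #|F|.-1; [rewrite -(cardC1 x0); apply: eq_card|rewrite cardF].
have lt : p.-1%:R * (eps / p%:R) < eps.
  by rewrite mulrA ltr_pdivrMr // mulrC ltr_pM2l // ltr_nat prednK // ltnW.
have := u1; rewrite /mass (bigD1 x0) //=; have /andP[_ ux0] := u01 x0.
lra.
Qed.

(* Each balanced summand has two atoms of mass at least eps / p, so by Cauchy-Davenport
   the set of likely values grows by one with each summand until it is everything. *)
Lemma card_likely s : (forall u, u \in s -> balanced_law eps u) ->
  (minn p (size s).+1 <= #|[set a | ((eps / p%:R) ^+ size s <= (\prod_(u <- s) u) a)%R]|)%N.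
Proof.
elim: s => [|u s IHs] s_bal.
  rewrite big_nil /= expr0; apply: (leq_trans (geq_minr _ _)).
  by apply/card_gt0P; exists 0; rewrite inE galg_oneE eqxx.
have u_bal : balanced_law eps u by apply: s_bal; rewrite mem_head.
have {}IHs := IHs (fun v vs => s_bal v (mem_behead (s := u :: s) vs)).
set S := [set a | _] in IHs; set S' := [set a | _].
have [x _ ux] := exists_atom 0 u_bal; have [y yx uy] := exists_atom x u_bal.
have u0 a : 0 <= u a by case: u_bal => /(_ a)/andP[].
have prod0 b : 0 <= (\prod_(u <- s) u) b.
  by rewrite big_seq; apply: galg_prod_ge0 => v a vs;
    case: (s_bal v (mem_behead (s := u :: s) vs)) => /(_ a)/andP[].
have e0 : 0 <= eps / p%:R by rewrite divr_ge0 // ltW.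
have sub z : eps / p%:R <= u z -> [set (z + a)%R | a in S] \subset S'.
  move=> uz; apply/subsetP => _ /imsetP[a aS ->]; rewrite inE in aS; rewrite inE big_cons galg_mulE.
  rewrite (bigD1 z) //= (addrC z) addrK exprS -[leLHS]addr0 lerD //.
    by rewrite ler_pM // exprn_ge0.
  by apply: sumr_ge0 => c _; rewrite mulr_ge0.
have [ST|ST] := eqVneq S setT.
  have : (#|[set (x + a)%R | a in S]| <= #|S'|)%N by rewrite subset_leq_card ?sub.
  rewrite card_imset; last exact: addrI.
  by rewrite ST cardsT cardF; apply: leq_trans; rewrite geq_minl.
have S0 : S != set0.
  by rewrite -card_gt0 (leq_trans _ IHs) // leq_min (ltnW p_gt1).
have lt := card_translates yx S0 ST.
have : (#|[set (y + a)%R | a in S] :|: [set (x + a)%R | a in S]| <= #|S'|)%N.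
  by rewrite subset_leq_card // subUset !sub.
move=> le; rewrite /= geq_min; apply/orP.
move: IHs; rewrite geq_min => /orP[le1|le1]; [left|right].
  exact: leq_trans le1 (leq_trans (ltnW lt) le).
exact: leq_ltn_trans le1 (leq_trans lt le).
Qed.

(** A pointwise lower bound for the convolution of p - 1 balanced laws (a Doeblin minorisation).
    Each block of p - 1 summands then contracts the distance to uniform by 1 - p delta. *)
Let delta : R := (eps / p%:R) ^+ p.-1.
Definition mix_rate : R := 1 - p%:R * delta.

Let delta_gt0 : 0 < delta.
Proof. by rewrite exprn_gt0 // divr_gt0. Qed.

Lemma mix_rate_bounds : 0 <= mix_rate < 1.
Proof.
rewrite /mix_rate ltrBlDr ltrDl mulr_gt0 // andbT subr_ge0 /delta.
have -> : p.-1 = p.-2.+1 by rewrite prednK // -ltnS prednK // ltnW.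
rewrite exprS mulrA mulrCA divff ?gt_eqF // mulr1.
have e0 : 0 <= eps / p%:R by rewrite divr_ge0 // ltW.
have e1 : eps / p%:R <= 1 by rewrite ler_pdivrMr // mul1r (le_trans eps_le1) // ler1n ltnW.
by apply: mulr_ile1; rewrite ?exprn_ge0 ?exprn_ile1 // ltW.
Qed.

Lemma prod_law_prob s : (forall u, u \in s -> balanced_law eps u) ->
  (forall b, 0 <= (\prod_(u <- s) u) b) /\ mass (\prod_(u <- s) u) = 1.
Proof.
move=> s_bal; split.
  by move=> b; rewrite big_seq; apply: galg_prod_ge0 => v a vs; case: (s_bal v vs) => /(_ a)/andP[].
by rewrite mass_prod big_seq big1 // => u us; case: (s_bal u us).
Qed.

(** The deviation of [v] from 1/p has sum zero, so subtracting the constant [delta] from [u] does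
    not change its convolution with that deviation, and leaves nonnegative weights of total 1 - p
    delta. *)
Lemma doeblin u v D : (forall a, delta <= u a) -> mass u = 1 -> mass v = 1 ->
  (forall a, `|v a - p%:R^-1| <= D) -> forall a, `|(u * v) a - p%:R^-1| <= mix_rate * D.
Proof.
move=> u_ge u1 v1 vD b.
have sum_v : \sum_c (v (b - c) - p%:R^-1) = 0.
  rewrite sumrB sumr_const cardF -[_ *+ p]mulr_natl divff ?gt_eqF // -v1 /mass.
  by rewrite [X in _ - X](reindex_inj (inv_inj (subKr b))) /= subrr.
have -> : (u * v) b - p%:R^-1 = \sum_c (u c - delta) * (v (b - c) - p%:R^-1).
  under eq_bigr do rewrite mulrBl mulrBr.
  rewrite !sumrB -mulr_sumr sum_v mulr0 subr0 galg_mulE; congr (_ - _).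
  by rewrite -mulr_suml -[\sum_c u c]/(mass u) u1 mul1r.
apply: le_trans (ler_norm_sum _ _ _) _.
apply: (@le_trans _ _ (\sum_c (u c - delta) * D)).
  by apply: ler_sum => c _; rewrite normrM ger0_norm ?subr_ge0 // ler_wpM2l ?subr_ge0.
rewrite -mulr_suml sumrB -[\sum_c u c]/(mass u) u1 sumr_const cardF -[delta *+ p]mulr_natl.
exact: lexx.
Qed.

Lemma mixing k s : (forall u, u \in s -> balanced_law eps u) -> (k * p.-1 <= size s)%N ->
  forall a, `|(\prod_(u <- s) u) a - p%:R^-1| <= mix_rate ^+ k.
Proof.
elim: k s => [|k IHk] s s_bal sz a.
  have [prod0 prod1] := prod_law_prob s_bal.
  have le1 : (\prod_(u <- s) u) a <= 1 by rewrite -prod1; apply: galg_le_mass.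
  have ip0 : 0 <= p%:R^-1 :> R by rewrite invr_ge0 ltW.
  have ip1 : p%:R^-1 <= 1 :> R by rewrite invf_le1 // ler1n ltnW.
  have := prod0 a; rewrite expr0 ler_norml; lra.
rewrite -(cat_take_drop p.-1 s) big_cat /= exprS.
have take_bal u : u \in take p.-1 s -> balanced_law eps u by move/mem_take; apply: s_bal.
have drop_bal u : u \in drop p.-1 s -> balanced_law eps u by move/mem_drop; apply: s_bal.
have sz_take : size (take p.-1 s) = p.-1.
  by rewrite size_takel // (leq_trans _ sz) // mulSn leq_addr.
apply: doeblin.
- move=> b; have := card_likely take_bal; rewrite sz_take prednK ?(ltnW p_gt1) // minnn.
  rewrite -[X in (X <= _)%N]cardF => le.
  have /setP/(_ b) : [set a | (eps / p%:R) ^+ p.-1 <= (\prod_(u <- take p.-1 s) u) a] = setT.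
    by apply/eqP; rewrite eqEcard subsetT cardsT.
  by rewrite !inE.
- by case: (prod_law_prob take_bal).
- by case: (prod_law_prob drop_bal).
- apply: IHk => //; rewrite size_drop leq_subRL; first by rewrite -mulSn.
  by rewrite (leq_trans _ sz) // mulSn leq_addr.
Qed.

End Mixing.

(** * Laws of the columns of phi A *)

Lemma galg_mul_lbound (G : finZmodType) (R : realDomainType) (u v : galg G R) c :
  (forall b, c <= u b) -> (forall b, 0 <= v b) -> forall b, c * mass v <= (u * v) b.
Proof.
move=> uc v0 b; rewrite [u * v]mulrC galg_mulE /mass mulr_sumr; apply: ler_sum => a _.
by rewrite [leRHS]mulrC ler_wpM2r.
Qed.

Lemma sum_prod_row (F : finType) (R : comNzRingType) n m (g : 'I_n -> 'rV[F]_m -> R) :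
  \sum_(M : 'M[F]_(n, m)) \prod_i g i (row i M) = \prod_i \sum_v g i v.
Proof.
rewrite bigA_distr_bigA /= (reindex (fun M : 'M[F]_(n, m) => [ffun i => row i M])) /=; last first.
  exists (fun f : {ffun 'I_n -> 'rV[F]_m} => \matrix_(i, j) f i 0 j) => [M _|f _].
    by apply/matrixP => i j; rewrite mxE ffunE mxE.
  by apply/ffunP => i; rewrite ffunE; apply/rowP => j; rewrite !mxE.
by apply: eq_bigr => M _; apply: eq_bigr => i _; rewrite ffunE.
Qed.

(** * Grouping rows by value, and counting matrices close to a subspace *)

Section Basis.
Variables (F : finFieldType) (R : realFieldType) (m : nat).

Lemma row_free_row_inj h (U : 'M[F]_(h, m)) : row_free U -> injective (fun l => row l U).
Proof.
move=> U_free l l'; rewrite /= !rowE => /(row_free_inj U_free)/rowP/(_ l)/eqP.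
by have [//|/negPf ll'] := eqVneq l l'; rewrite !mxE !eqxx ll' oner_eq0.
Qed.

Lemma prod_push_le h (U : 'M[F]_(h, m)) (K : 'I_h -> galg F R) (c : 'I_h -> R) :
  row_free U -> (forall l a, 0 <= K l a <= c l) ->
  forall b, (\prod_l push (row l U) (K l)) b <= \prod_l c l.
Proof.
move=> U_free Kc b; rewrite prod_pushE.
have c0 l : 0 <= c l by have /andP[/le_trans + ?] := Kc l 0; apply.
have [/existsP[x /eqP xU]|/existsPn no] := boolP [exists x, x *m U == b].
  rewrite (bigD1 x) //= xU eqxx [X in _ + X]big1 ?addr0 => [|x' x'x].
    by apply: ler_prod => l _; apply: Kc.
  by case: eqP => // x'U; case/eqP: x'x; apply: (row_free_inj U_free); rewrite x'U.
by rewrite big1 ?prodr_ge0 // => x _; rewrite (negPf (no x)).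
Qed.

Lemma prod_push_ge (U : 'M[F]_m) (K : 'I_m -> galg F R) (c : R) :
  row_free U -> 0 <= c -> (forall l a, c <= K l a) ->
  forall b, c ^+ m <= (\prod_l push (row l U) (K l)) b.
Proof.
move=> U_free c0 Kc b; rewrite row_free_unit in U_free.
have K0 l a : 0 <= K l a by apply: le_trans (Kc l a).
rewrite prod_pushE (bigD1 (b *m invmx U)) //= mulmxKV // eqxx -[c ^+ m]addr0.
apply: lerD; last by apply: sumr_ge0 => x _; rewrite mulrn_wge0 ?prodr_ge0.
rewrite -[m in c ^+ m]card_ord -prodr_const; apply: ler_prod => l _.
by rewrite c0 Kc.
Qed.

(** The law of [x *m Phi] for a row [x] of independent entries with laws [w i]. Here [Phi] is the
    transpose of an embedding, so its rows are the columns to be grouped by value. *)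
Definition column_law n (Phi : 'M[F]_(n, m)) (w : 'I_n -> galg F R) : galg 'rV[F]_m R :=
  \prod_i push (row i Phi) (w i).

Definition row_class n (Phi : 'M[F]_(n, m)) (v : 'rV[F]_m) := [set i | row i Phi == v].

Lemma column_law_split n (Phi : 'M[F]_(n, m)) w h (U : 'M[F]_(h, m)) : row_free U ->
  column_law Phi w = (\prod_l push (row l U) (\prod_(i in row_class Phi (row l U)) w i)) *
    \prod_(i | ~~ [exists l, row i Phi == row l U]) push (row i Phi) (w i).
Proof.
move=> U_free; rewrite /column_law (bigID (fun i => [exists l, row i Phi == row l U])) /=.
congr (_ * _); symmetry.
transitivity (\prod_l \prod_(i in row_class Phi (row l U)) push (row i Phi) (w i)).
  by apply: eq_bigr => l _; rewrite push_prod; apply: eq_bigr => i; rewrite inE => /eqP ->.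
rewrite (exchange_big_dep (fun i => [exists l, row i Phi == row l U])) /=; last first.
  by move=> l i _; rewrite inE => il; apply/existsP; exists l.
apply: eq_bigr => i /existsP[l /eqP il]; rewrite (big_pred1 l) // => l'; rewrite !inE il.
by apply/eqP/eqP => [/(row_free_row_inj U_free)|->].
Qed.

(** The rows of [U] are a maximal independent set among the values taken at least [t] times. A row
    outside their span has one of at most [#|F| ^ m] rarer values, each taken fewer than [t]
    times. *)
Lemma frequent_basis n (Phi : 'M[F]_(n, m)) t : exists h (U : 'M[F]_(h, m)),
  [/\ row_free U, (h <= m)%N, forall l, (t <= #|row_class Phi (row l U)|)%N &
      (#|[set i | ~~ (row i Phi <= U)%MS]| <= t * #|F| ^ m)%N].
Proof.
pose J := [set v | (t <= #|row_class Phi v|)%N].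
pose M := \matrix_(l < #|J|) (enum_val l : 'rV[F]_m).
pose U := rowsub (maxrankfun M) M.
exists (\rank M), U; split; first exact: maxrowsub_free.
- exact: rank_leq_col.
- move=> l; rewrite row_rowsub rowK.
  by have := enum_valP (maxrankfun M l); rewrite inE.
have sub : [set i | ~~ (row i Phi <= U)%MS] \subset [set i | row i Phi \notin J].
  apply/subsetP => i; rewrite !inE; apply: contra => iJ.
  have iJ' : row i Phi \in J by rewrite inE.
  rewrite eq_maxrowsub -(enum_rankK_in iJ' iJ')
    -[X in (X <= _)%MS](rowK (fun l : 'I_#|J| => enum_val l : 'rV[F]_m)).
  exact: row_sub.
apply: (leq_trans (subset_leq_card sub)).
rewrite -sum1_card (partition_big (fun i => row i Phi) (fun v => v \notin J)) /=; last by move=> i; rewrite inE.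
apply: (@leq_trans (\sum_(v : 'rV[F]_m) t)); last by rewrite sum_nat_const card_mx mul1n mulnC.
rewrite [leqRHS](bigID (fun v => v \notin J)) /=; apply: leq_trans (leq_addr _ _).
apply: leq_sum => v; rewrite inE -ltnNge => /ltnW; apply: leq_trans.
rewrite -sum1_card big_mkcond [leqRHS]big_mkcond; apply: leq_sum => i _.
by rewrite [i \in row_class _ _]inE; case: (row i Phi == v); rewrite ?andbF //; case: ifP.
Qed.

(* Exponential Markov inequality for the number of rows lying outside U. *)
Lemma card_near n s h (U : 'M[F]_(h, m)) (eps : R) : 0 < eps <= 1 ->
  #|[set Phi : 'M[F]_(n, m) | (#|[set i | ~~ (row i Phi <= U)%MS]| <= s)%N]|%:R <=
  (#|F|%:R ^+ m / eps) ^+ s * (#|F|%:R ^+ h * (1 + eps)) ^+ n.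
Proof.
(* With this [y], the weights y^-1 summed over all vectors total exactly [eps], which is at most
   [eps] times the [#|F| ^ h] bounding the weight of the span of [U]. *)
case/andP=> eps0 eps1; set y := _ / eps.
have q1 : 1 <= #|F|%:R :> R by rewrite ler1n; apply/card_gt0P; exists 0.
have q0 := lt_le_trans ltr01 q1.
have y1 : 1 <= y by rewrite ler_pdivlMr // mul1r (le_trans eps1) // exprn_ege1.
have y0 := lt_le_trans ltr01 y1; have [[q0' y0'] e0'] := ((ltW q0, ltW y0), ltW eps0).
have yi0 : 0 <= y^-1 by rewrite invr_ge0.
pose g (v : 'rV[F]_m) : R := if (v <= U)%MS then 1 else y^-1.
apply: (@le_trans _ _ (\sum_(Phi : 'M[F]_(n, m)) y ^+ s * \prod_i g (row i Phi))).
  rewrite -sum1_card natr_sum big_mkcond; apply: ler_sum => Phi _.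
  have -> : \prod_i g (row i Phi) = y^-1 ^+ #|[set i | ~~ (row i Phi <= U)%MS]|.
    rewrite -prodr_const [RHS]big_mkcond; apply: eq_bigr => i _.
    by rewrite inE /g; case: ifP.
  rewrite inE; case: ifP => [le|_]; last by rewrite mulr_ge0 ?exprn_ge0.
  by rewrite exprVn -(subnK le) exprD mulfK ?exprn_ege1 // expf_neq0 // gt_eqF.
rewrite -mulr_sumr (sum_prod_row (fun _ => g)) prodr_const card_ord ler_wpM2l ?exprn_ge0 //.
rewrite lerXn2r ?nnegrE ?mulr_ge0 ?exprn_ge0 ?addr_ge0 //; last first.
  apply: (@le_trans _ _ (#|[set v : 'rV[F]_m | (v <= U)%MS]|%:R + \sum_(v : 'rV[F]_m) y^-1)).
    rewrite -sum1_card natr_sum [X in _ <= X + _]big_mkcond -big_split; apply: ler_sum => v _ /=.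
    by rewrite inE /g; case: ifP; rewrite ?add0r // lerDl.
  rewrite sumr_const card_mx mul1n -[_ *+ (_ ^ _)]mulr_natl
    natrX invf_div mulrCA divff ?expf_neq0 ?gt_eqF // mulr1.
  rewrite mulrDr mulr1 lerD //; last by rewrite ler_peMl ?exprn_ege1.
  rewrite -natrX ler_nat -[X in (_ <= _ ^ X)%N]mul1n -card_mx -cardsT.
  apply: leq_trans (leq_imset_card (fun x : 'rV[F]_h => x *m U) _).
  apply/subset_leq_card/subsetP => v; rewrite inE => /submxP[x ->].
  by apply: imset_f; rewrite inE.
by apply: sumr_ge0 => v _; rewrite /g; case: ifP.
Qed.

End Basis.

(** * Bounds for the expected number of embeddings at fixed n *)

Section MomentBounds.
Variables (p : nat) (R : realFieldType) (eps : R) (m : nat).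
Hypotheses (p_prime : prime p) (eps_gt0 : 0 < eps) (eps_le : eps <= 1 - p%:R^-1).
Local Notation F := 'F_p.

Let cardF : #|F| = p. Proof. exact: card_Fp. Qed.
Let p_gt1 : (1 < p)%N. Proof. exact: prime_gt1. Qed.
Let p_gt0 : 0 < p%:R :> R. Proof. by rewrite ltr0n ltnW. Qed.
Let eps_le1 : eps <= 1.
Proof. by rewrite (le_trans eps_le) // gerBl invr_ge0 ltW. Qed.

Section Frequent.
Variables (n : nat) (Phi : 'M[F]_(n, m)) (w : 'I_n -> galg F R).
Hypothesis w_bal : forall i, balanced_law eps (w i).

Let w_ge0 i a : 0 <= w i a. Proof. by case: (w_bal i) => /(_ a)/andP[]. Qed.
Let rest_ge0 (P : pred 'I_n) b : 0 <= (\prod_(i | P i) push (row i Phi) (w i)) b.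
Proof. by apply: galg_prod_ge0 => i a _; apply: push_ge0. Qed.
Let rest_mass (P : pred 'I_n) : mass (\prod_(i | P i) push (row i Phi) (w i)) = 1.
Proof. by rewrite mass_prod big1 // => i _; rewrite mass_push; case: (w_bal i). Qed.

Lemma column_law_ge0 b : 0 <= column_law Phi w b.
Proof. exact: rest_ge0. Qed.

(** The rows that do not occur in [U] contribute a convolution factor of mass 1, which cannot raise
    a pointwise upper bound. *)
Lemma column_law_le_prod h (U : 'M[F]_(h, m)) (c : 'I_h -> R) : row_free U ->
  (forall l a, (\prod_(i in row_class Phi (row l U)) w i) a <= c l) ->
  forall b, column_law Phi w b <= \prod_l c l.
Proof.
move=> U_free le_c b; rewrite (column_law_split _ _ U_free) -[leRHS]mulr1.
rewrite -[X in _ <= _ * X](rest_mass (fun i => ~~ [exists l, row i Phi == row l U])).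
apply: galg_mul_bound => // {}b.
apply: prod_push_le => // l a; by rewrite galg_prod_ge0 ?le_c.
Qed.

Lemma class_law_mix k v a : (k * p.-1 <= #|row_class Phi v|)%N ->
  `|(\prod_(i in row_class Phi v) w i) a - p%:R^-1| <= mix_rate p eps ^+ k.
Proof.
move=> freq; rewrite -big_enum /= -(big_map w predT id).
apply: mixing => //; last by rewrite size_map -cardE.
by move=> u /mapP[i _ ->].
Qed.

Lemma column_law_le k h (U : 'M[F]_(h, m)) : row_free U ->
  (forall l, (k * p.-1 <= #|row_class Phi (row l U)|)%N) ->
  forall b, column_law Phi w b <= (p%:R^-1 + mix_rate p eps ^+ k) ^+ h.
Proof.
move=> U_free freq b; rewrite -[h in leRHS]card_ord -prodr_const.
apply: (column_law_le_prod U_free) => l a.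
by have := class_law_mix a (freq l); rewrite ler_norml => /andP[_]; rewrite lerBlDl.
Qed.

Lemma column_law_ge k (U : 'M[F]_m) : row_free U -> mix_rate p eps ^+ k <= p%:R^-1 ->
  (forall l, (k * p.-1 <= #|row_class Phi (row l U)|)%N) ->
  forall b, (p%:R^-1 - mix_rate p eps ^+ k) ^+ m <= column_law Phi w b.
Proof.
move=> U_free eta_le freq b; rewrite (column_law_split _ _ U_free) -[leLHS]mulr1.
rewrite -[X in _ * X <= _](rest_mass (fun i => ~~ [exists l, row i Phi == row l U])).
apply: galg_mul_lbound => // {}b.
apply: prod_push_ge; rewrite ?subr_ge0 // => l a.
by have := class_law_mix a (freq l); rewrite ler_norml => /andP[+ _]; rewrite lerBrDl addrC.
Qed.

(* A row of Phi outside the span of U gives one more independent coordinate, whose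
   law is only known to be balanced. *)
Lemma column_law_le_outside k h (U : 'M[F]_(h, m)) i0 : row_free U ->
  (forall l, (k * p.-1 <= #|row_class Phi (row l U)|)%N) -> ~~ (row i0 Phi <= U)%MS ->
  forall b, column_law Phi w b <= (1 - eps) * (p%:R^-1 + mix_rate p eps ^+ k) ^+ h.
Proof.
move=> U_free freq i0U b; pose U' := col_mx (row i0 Phi) U.
have U'_free : row_free U'.
  apply: inj_row_free => v; rewrite -[v]hsubmxK mul_row_col [lsubmx v]mx11_scalar mul_scalar_mx.
  set c := lsubmx v 0 0; set x := rsubmx v => eq0.
  have c0 : c = 0.
    apply: contraNeq i0U => c0; apply/submxP; exists (- c^-1 *: x).
    by rewrite -scalemxAl scaleNr -scalerN -(addr0_eq eq0) opprK scalerK.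
  move: eq0; rewrite c0 scale0r add0r => /eqP; rewrite -(mul0mx _ U) => /eqP/(row_free_inj U_free) ->.
  by rewrite raddf0 row_mx0.
pose c (l : 'I_(1 + h)) : R :=
  if split l is inl _ then 1 - eps else p%:R^-1 + mix_rate p eps ^+ k.
have -> : (1 - eps) * (p%:R^-1 + mix_rate p eps ^+ k) ^+ h = \prod_l c l.
  rewrite big_split_ord big_ord1 /c /=.
  rewrite (unsplitK (inl ord0)); congr (_ * _); rewrite -[h in LHS]card_ord -prodr_const.
  by apply: eq_bigr => l _; rewrite (unsplitK (inr l)).
apply: (column_law_le_prod U'_free) => l a; rewrite /c; case: splitP => j lj.
  have -> : row l U' = row i0 Phi.
    have -> : l = lshift h j by apply: val_inj.
    by rewrite rowKu row_id.
  rewrite (bigD1 i0) ?inE //= -[leRHS]mulr1.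
  have mass_eq1 : mass (\prod_(i in row_class Phi (row i0 Phi) | i != i0) w i) = 1.
    by rewrite mass_prod big1 // => i _; case: (w_bal i).
  rewrite -[X in _ <= _ * X]mass_eq1.
  apply: galg_mul_bound => x; first by case: (w_bal i0) => /(_ x)/andP[].
  by apply: galg_prod_ge0 => i y _.
have -> : row l U' = row j U.
  have -> : l = rshift 1 j by apply: val_inj.
  by rewrite rowKd.
by have := class_law_mix a (freq j); rewrite ler_norml => /andP[_]; rewrite lerBlDl.
Qed.

End Frequent.

Lemma sqr_eps_bounds : 0 <= 1 - eps ^+ 2 < 1.
Proof.
by rewrite subr_ge0 exprn_ile1 ?(ltW eps_gt0) //= gtrBl exprn_gt0.
Qed.

Definition spanning {n} k (Phi : 'M[F]_(n, m)) :=
  [exists U : 'M[F]_m, row_free U && [forall l, (k * p.-1 <= #|row_class Phi (row l U)|)%N]].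

Lemma spanning_row_full k n (Phi : 'M[F]_(n, m)) : (0 < k)%N -> spanning k Phi -> row_full Phi.
Proof.
move=> k_gt0 /existsP[U /andP[U_free /forallP freq]].
rewrite /row_full eqn_leq rank_leq_col -{1}(eqP U_free) mxrankS //.
apply/row_subP => l; have /card_gt0P[i] : (0 < #|row_class Phi (row l U)|)%N.
  by rewrite (leq_trans _ (freq l)) // muln_gt0 k_gt0 -subn1 subn_gt0.
by rewrite inE => /eqP <-; apply: row_sub.
Qed.

(* [near_cst] bounds the number of matrices U, and [near_rate ^+ k] is the factor
   [(p ^ m / eps) ^ s] of [card_near] for [s = k * (p - 1) * p ^ m]. *)
Definition near_cst : R := \sum_(h < m) p%:R ^+ (h * m).
Definition near_rate : R := (p%:R ^+ m / eps) ^+ (p.-1 * p ^ m).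

(** A union bound over the independent [U] supplied by [frequent_basis], with [card_near] counting
    the matrices close to each. It serves twice: with a constant summand it counts the matrices
    missing from the lower bound, and with the product of column laws it bounds their contribution
    from above. *)
Lemma sum_not_spanning k n (P : pred 'M[F]_(n, m)) (g : 'M[F]_(n, m) -> R) (G : nat -> R) (K : R) :
  (forall Phi h (U : 'M[F]_(h, m)), (h < m)%N -> row_free U -> P Phi ->
     (forall l, (k * p.-1 <= #|row_class Phi (row l U)|)%N) -> g Phi <= G h) ->
  (forall h, 0 <= G h) ->
  (forall h, (h < m)%N -> (p%:R ^+ h * (1 + eps)) ^+ n * G h <= K) ->
  \sum_(Phi | P Phi && ~~ spanning k Phi) g Phi <= near_cst * near_rate ^+ k * K.
Proof.
move=> gG G0 GK; pose s := (k * p.-1 * p ^ m)%N.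
pose near h (U : 'M[F]_(h, m)) (Phi : 'M[F]_(n, m)) := (#|[set i | ~~ (row i Phi <= U)%MS]| <= s)%N.
have t0 h (U : 'M[F]_(h, m)) Phi : 0 <= (near h U Phi)%:R * G h by rewrite mulr_ge0.
apply: (@le_trans _ _ (\sum_(Phi : 'M[F]_(n, m)) \sum_(h < m) \sum_(U : 'M[F]_(h, m)) (near h U Phi)%:R * G h)).
  rewrite big_mkcond; apply: ler_sum => Phi _; case: ifP => [/andP[PPhi nspan]|_]; last first.
    by apply: sumr_ge0 => h _; apply: sumr_ge0.
  have [h [U [U_free hm freq near_U]]] := frequent_basis Phi (k * p.-1).
  have {}hm : (h < m)%N.
    rewrite ltn_neqAle hm andbT; apply: contraNneq nspan => hm'; move: U U_free freq {near_U}.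
    rewrite hm' => U U_free freq; apply/existsP; exists U; rewrite U_free.
    by apply/forallP.
  rewrite (bigD1 (Ordinal hm)) //= (bigD1 U) //= {1}/near.
  rewrite cardF in near_U; rewrite near_U mul1r -addrA ler_wpDr //; last exact: gG freq.
  by rewrite addr_ge0 // ?sumr_ge0 // => h' _; apply: sumr_ge0.
rewrite exchange_big /near_cst /= !mulr_suml; apply: ler_sum => h _.
rewrite exchange_big /=; have hm := ltn_ord h.
apply: (@le_trans _ _ (\sum_(U : 'M[F]_(h, m)) near_rate ^+ k * K)); last first.
  by rewrite sumr_const card_mx cardF -[_ *+ _]mulr_natl natrX mulrA.
apply: ler_sum => U _; rewrite -mulr_suml.
have <- : #|[set Phi : 'M[F]_(n, m) | near h U Phi]|%:R = \sum_Phi (near h U Phi)%:R :> R.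
  by rewrite -sum1_card natr_sum big_mkcond; apply: eq_bigr => Phi _; rewrite inE; case: (near _ _ _).
have /(card_near n s U) : 0 < eps <= 1 by rewrite eps_gt0.
rewrite cardF => /(ler_wpM2r (G0 h))/le_trans; apply.
have -> : s = (p.-1 * p ^ m * k)%N by rewrite /s -mulnA mulnC.
rewrite -mulrA /near_rate -exprM.
by rewrite ler_wpM2l ?GK // exprn_ge0 // divr_ge0 ?exprn_ge0 // ltW.
Qed.

(** The base 1 - eps^2 is (1 + eps) (1 - eps): the first factor comes from the count in [card_near],
    the second from the gain available for each column when h < m. *)
Definition moment_error k n : R := near_cst * near_rate ^+ k * (1 - eps ^+ 2) ^+ n.

(** The targets [b] are arbitrary because every estimate on a column law is pointwise; this is what
    makes the limit independent of [B]. *)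
Lemma moment_bounds k n (w : 'I_n -> 'I_n -> galg F R) (b : 'M[F]_(n, m) -> 'I_n -> 'rV[F]_m)
    (eta := mix_rate p eps ^+ k) :
  (forall i j, balanced_law eps (w i j)) -> (0 < k)%N -> eta <= p%:R^-1 ->
  (1 - p%:R * eta) ^+ (m * n) - moment_error k n <=
  \sum_(Phi : 'M[F]_(n, m) | row_full Phi) \prod_j column_law Phi (w^~ j) (b Phi j) <=
  (1 + p%:R * eta) ^+ (m * n) * (1 + moment_error k n).
Proof.
move=> w_bal k_gt0 eta_le.
have eta0 : 0 <= eta by rewrite exprn_ge0 //; case/andP: (mix_rate_bounds p_prime eps_gt0 eps_le1).
have pne0 : p%:R != 0 :> R by rewrite gt_eqF.
have ip0 : 0 <= p%:R^-1 :> R by rewrite invr_ge0 ltW.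
have e2 : 1 - eps ^+ 2 = (1 + eps) * (1 - eps) by ring.
have [e2_0 _] := andP sqr_eps_bounds.
have cardM : #|{: 'M[F]_(n, m)}| = (p ^ (m * n))%N by rewrite card_mx cardF mulnC.
pose L Phi := \prod_j column_law Phi (w^~ j) (b Phi j).
rewrite -[X in _ <= X <= _]/(\sum_(Phi | row_full Phi) L Phi).
have w_bal' j i : balanced_law eps ((w^~ j) i) by apply: w_bal.
have L0 Phi : 0 <= L Phi by apply: prodr_ge0 => j _; apply: column_law_ge0.
rewrite (bigID (spanning k)) /=.
have -> : \sum_(Phi | row_full Phi && spanning k Phi) L Phi = \sum_(Phi | spanning k Phi) L Phi.
  apply: eq_bigl => Phi; apply: andb_idl; exact: spanning_row_full.
apply/andP; split.
  (* Lower bound: the non-spanning matrices are dropped, and each spanning one contributes at least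
     [c]. *)
  rewrite -[leLHS]addr0; apply: lerD; last by apply: sumr_ge0.
  pose c := (p%:R^-1 - eta) ^+ (m * n).
  have c0 : 0 <= c by rewrite exprn_ge0 // subr_ge0.
  apply: (@le_trans _ _ (\sum_(Phi : 'M[F]_(n, m) | spanning k Phi) c)); last first.
    apply: ler_sum => Phi /existsP[U /andP[U_free /forallP freq]].
    rewrite /c exprM -[n in leLHS]card_ord -prodr_const; apply: ler_prod => j _.
    by rewrite exprn_ge0 ?subr_ge0 //; apply: column_law_ge U_free _ freq _.
  rewrite lerBlDr.
  have -> : (1 - p%:R * eta) ^+ (m * n) = \sum_(Phi : 'M[F]_(n, m)) c.
    by rewrite sumr_const cardM -[c *+ _]mulr_natl natrX /c -exprMn mulrBr divff.
  rewrite (bigID (spanning k)) /= lerD2l.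
  apply: (@sum_not_spanning k n predT (fun=> c) (fun=> c)) => // h hm.
  have e1 : 0 <= 1 + eps by rewrite addr_ge0 // ltW.
  have d0 : 0 <= p%:R^-1 - eta by rewrite subr_ge0.
  have ph0 : 0 <= p%:R ^+ h :> R by rewrite exprn_ge0 // ltW.
  rewrite /c exprM -exprMn lerXn2r ?nnegrE ?mulr_ge0 ?exprn_ge0 //.
  rewrite e2 -mulrA mulrCA ler_wpM2l //.
  apply: (@le_trans _ _ (p%:R ^+ h * p%:R^-1 ^+ m)).
    by rewrite ler_wpM2l // lerXn2r ?nnegrE // gerBl.
  have ph : p%:R ^+ h * p%:R^-1 ^+ h = 1 :> R by rewrite -exprMn divff // expr1n.
  have -> : p%:R ^+ h * p%:R^-1 ^+ m = p%:R^-1 * p%:R^-1 ^+ (m - h.+1) :> R.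
    by rewrite -[X in _ ^+ h * _ ^+ X](subnK hm) exprD exprS mulrCA [_ ^+ h * _]mulrCA ph mulr1 mulrC.
  (* The gap h < m gains a factor 1/p, and 1/p <= 1 - eps by the upper bound assumed on [eps]. *)
  apply: (@le_trans _ _ p%:R^-1); last by rewrite lerBrDl -lerBrDr.
  by rewrite ler_piMr // exprn_ile1 // invf_le1 // ler1n ltnW.
have Kle : \sum_(Phi | row_full Phi && ~~ spanning k Phi) L Phi <=
    near_cst * near_rate ^+ k * ((1 - eps ^+ 2) ^+ n * (1 + p%:R * eta) ^+ (m * n)).
  have e1 : 0 <= 1 - eps by rewrite subr_ge0.
  have d0 : 0 <= p%:R^-1 + eta by rewrite addr_ge0.
  have pe0 : 0 <= p%:R * eta by rewrite mulr_ge0 // ltW.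
  have pe1 : 0 <= 1 + p%:R * eta by rewrite addr_ge0.
  have e3 : 0 <= 1 + eps by rewrite addr_ge0 // ltW.
  apply: (@sum_not_spanning k n _ L (fun h => ((1 - eps) * (p%:R^-1 + eta) ^+ h) ^+ n)).
  - move=> Phi h U hm U_free Phi_full freq.
    have [i0 i0U] : exists i0, ~~ (row i0 Phi <= U)%MS.
      apply/existsP; rewrite -negb_forall; apply/negP => /forallP sub.
      have : (Phi <= U)%MS by apply/row_subP.
      by move=> /mxrankS; rewrite (eqP Phi_full) (eqP U_free) leqNgt hm.
    rewrite -[n in leRHS]card_ord -prodr_const; apply: ler_prod => j _.
    by rewrite column_law_ge0 //=; apply: column_law_le_outside i0U _.
  - by move=> h; rewrite exprn_ge0 // mulr_ge0 // exprn_ge0.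
  move=> h hm; have ph0 : 0 <= p%:R ^+ h :> R by rewrite exprn_ge0 // ltW.
  rewrite exprM -!exprMn lerXn2r ?nnegrE ?mulr_ge0 ?exprn_ge0 //.
  have -> : p%:R ^+ h * (1 + eps) * ((1 - eps) * (p%:R^-1 + eta) ^+ h) =
      (1 - eps ^+ 2) * (p%:R * (p%:R^-1 + eta)) ^+ h by rewrite exprMn e2; ring.
  by rewrite mulrDr divff // ler_wpM2l // ler_weXn2l ?lerDl // ltnW.
rewrite mulrDr mulr1; apply: lerD; last by apply: le_trans Kle _; rewrite /moment_error; lra.
apply: (@le_trans _ _ (\sum_(Phi : 'M[F]_(n, m)) (p%:R^-1 + eta) ^+ (m * n))).
  rewrite big_mkcond; apply: ler_sum => Phi _; case: ifP => [|_]; last first.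
    by rewrite exprn_ge0 // addr_ge0.
  case/existsP=> U /andP[U_free /forallP freq].
  rewrite exprM -[n in leRHS]card_ord -prodr_const; apply: ler_prod => j _.
  by rewrite column_law_ge0 //=; apply: column_law_le U_free freq _.
by rewrite sumr_const cardM -[(_ ^+ _) *+ _]mulr_natl natrX -exprMn mulrDr divff.
Qed.

End MomentBounds.

(** The equation phi A = B phi splits into one condition for each column of A, and the columns are
    independent. Transposing puts each condition in the form treated by [prod_pushE]. *)
Lemma sum_card_embeddings (F : finFieldType) (R : realFieldType) n m (B : 'M[F]_m)
    (w : 'I_n -> 'I_n -> galg F R) :
  \sum_(A : 'M[F]_n) (\prod_i \prod_j w i j (A i j)) * #|embeddings B A|%:R =
  \sum_(Phi : 'M[F]_(n, m) | row_full Phi)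
    \prod_j column_law Phi (w^~ j) (row j (B *m Phi^T)^T).
Proof.
transitivity (\sum_(A : 'M[F]_n) \sum_(Phi : 'M[F]_(n, m) | row_full Phi)
    \prod_j ((\prod_i w i j (A i j)) *+ (row j A^T *m Phi == row j (B *m Phi^T)^T))).
  apply: eq_bigr => A _.
  have -> : #|embeddings B A|%:R = \sum_(Phi : 'M[F]_(n, m) | row_full Phi)
      (Phi^T *m A == B *m Phi^T)%:R :> R.
    rewrite -sum1_card natr_sum big_mkcond (reindex (fun Phi : 'M[F]_(n, m) => Phi^T)) /=; last first.
      by exists trmx => X _; rewrite trmxK.
    rewrite [RHS]big_mkcond.
    apply: eq_bigr => Phi _; rewrite inE /row_free mxrank_tr /row_full.
    by case: (\rank Phi == m) => //=; case: (_ == _).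
  rewrite mulr_sumr; apply: eq_bigr => Phi _; rewrite exchange_big /=.
  have -> : (Phi^T *m A == B *m Phi^T) = [forall j, row j A^T *m Phi == row j (B *m Phi^T)^T].
    apply/eqP/forallP => [<- j|eq_row]; first by rewrite trmx_mul trmxK row_mul.
    apply: trmx_inj; apply/row_matrixP => j; rewrite -(eqP (eq_row j)).
    by rewrite trmx_mul trmxK row_mul.
  have [/forallP eq_row|/forallPn[j neq_row]] :=
    boolP [forall j, row j A^T *m Phi == row j (B *m Phi^T)^T].
    by rewrite mulr1; apply: eq_bigr => j _; rewrite eq_row.
  by rewrite mulr0 (bigD1 j) //= (negPf neq_row) mulr0n mul0r.
rewrite exchange_big; apply: eq_bigr => Phi _ /=.
pose g j (x : 'rV[F]_n) : R := (\prod_i w i j (x 0 i)) *+ (x *m Phi == row j (B *m Phi^T)^T).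
rewrite (reindex_inj (@trmx_inj F n n)) /=.
transitivity (\sum_(M : 'M[F]_n) \prod_j g j (row j M)).
  apply: eq_bigr => M _; apply: eq_bigr => j _; rewrite /g trmxK; congr (_ *+ _).
  by apply: eq_bigr => i _; rewrite !mxE.
by rewrite sum_prod_row; apply: eq_bigr => j _; rewrite /column_law prod_pushE.
Qed.

From mathcomp Require Import classical_sets.

(** * The rational canonical form *)

Section CanonicalForm.
Variable F : fieldType.
Implicit Types (f g h : {poly F}) (lam : intpartn).

Lemma rank_ker_primary_block f h lam k : f \is monic -> irreducible_poly f ->
  h \is monic -> irreducible_poly h ->
  \rank (kermx (pmx (primary_block f lam) (h ^+ k))) =
    if f == h then ((size h).-1 * \sum_(x <- lam) minn k x)%N else 0%N.
Proof.
move=> f_mon f_irr h_mon h_irr; rewrite (mxdecomp_rank_ker (mxdecomp_mxdiag _)).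
have [->|fh] := eqVneq f h.
  rewrite (big_nth 0%N) big_mkord big_distrr /=; apply: eq_bigr => j _.
  by rewrite rank_ker_companion_exp.
rewrite big1 // => j _; rewrite rank_ker_companion_coprime ?monic_exp //.
by rewrite coprimep_expl // coprimep_expr // monic_irreducible_coprime // eq_sym.
Qed.

Lemma canonical_data_mxdecomp n (A : 'M[F]_n) L : is_canonical_data A L ->
  exists k (g : 'I_k -> {poly F}), [/\ injective g,
    forall i, g i \is monic /\ irreducible_poly (g i),
    forall f, (forall i, g i != f) -> L f = zero_partn &
    exists P Q, mxdecomp A (fun i => primary_block (g i) (L (g i))) P Q].
Proof.
move=> [k [g [e [g_inj gP _ _ [[eq_dim simA] L0]]]]]; exists k, g; split=> //.
  by move=> i; case: (gP i).
subst n; rewrite castmx_id in simA; case: simA => X X_unit /(simmxP X_unit) XA.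
eexists; eexists; apply: mxdecomp_conj XA (mxdecomp_mxdiag _); last exact: mulVmx X_unit.
exact: mulmxV.
Qed.

Lemma rank_ker_canonical n (A : 'M[F]_n) L f k : is_canonical_data A L ->
  f \is monic -> irreducible_poly f ->
  \rank (kermx (pmx A (f ^+ k))) = ((size f).-1 * \sum_(x <- L f) minn k x)%N.
Proof.
move=> /canonical_data_mxdecomp[l [g [g_inj gP L0 [P [Q dec]]]]] f_mon f_irr.
rewrite (mxdecomp_rank_ker dec); case: (pickP (fun i => g i == f)) => [i /eqP gi|gf].
  rewrite (bigD1 i) //= rank_ker_primary_block //; try by case: (gP i).
  rewrite gi eqxx [X in (_ + X)%N]big1 ?addn0 // => j ji; rewrite rank_ker_primary_block //; try by case: (gP j).
  by rewrite -gi (inj_eq g_inj) (negPf ji).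
rewrite L0; last by move=> i; rewrite gf.
rewrite big_nil muln0 big1 // => i _; rewrite rank_ker_primary_block ?gf //; by case: (gP i).
Qed.

Lemma intpartn_eq (lam lam' : intpartn) :
  (forall k, \sum_(x <- lam) minn k x = \sum_(x <- lam') minn k x)%N -> lam = lam'.
Proof.
by move=> E; apply: val_inj; apply: eq_sorted_geq E; [case: lam|case: lam'].
Qed.

Lemma canonical_data_unique n (A : 'M[F]_n) L (lam : intpartn) f :
  is_canonical_data A L -> f \is monic -> irreducible_poly f ->
  (forall k, \rank (kermx (pmx A (f ^+ k))) = (size f).-1 * \sum_(x <- lam) minn k x)%N ->
  L f = lam.
Proof.
move=> LA f_mon f_irr E; apply: intpartn_eq => k.
have := E k; rewrite (rank_ker_canonical _ LA) // => /eqP.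
rewrite eqn_pmul2l; first by move/eqP.
by case: f_irr => f1 _; rewrite -ltnS prednK // ltnW.
Qed.

Lemma canonical_partnE n (A : 'M[F]_n) L f : is_canonical_data A L ->
  f \is monic -> irreducible_poly f -> canonical_partn f A = L f.
Proof.
move=> LA f_mon f_irr; apply: xget_unique; first by exists L.
move=> _ [L' L'A <-]; apply: (canonical_data_unique L'A) => // k.
exact: rank_ker_canonical.
Qed.

Lemma char_poly_castmx m n (e : m = n) (M : 'M[F]_m) :
  char_poly (castmx (e, e) M) = char_poly M.
Proof. by case: _ / e; rewrite castmx_id. Qed.

Lemma char_poly_mxdiag k (p_ : 'I_k -> nat) (C : forall i, 'M[F]_(p_ i)) :
  char_poly (mxdiag C) = \prod_i char_poly (C i).
Proof.
elim: k p_ C => [|k IHk] p_ C.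
  rewrite [RHS]big_ord0; have := char_poly_monic (mxdiag C).
  have : size (char_poly (mxdiag C)) = 1%N by rewrite size_char_poly big_ord0.
  move=> /eqP/size_poly1P[c c0 ->]; rewrite monicE lead_coefC => /eqP ->.
  by [].
rewrite mxdiag_recl char_poly_castmx [RHS]big_ord_recl -IHk.
by rewrite /char_poly char_block_diag_mx det_ublock.
Qed.

Lemma char_poly_primary_block g lam : g \is monic -> char_poly (primary_block g lam) = g ^+ sumn lam.
Proof.
move=> g_mon; rewrite char_poly_mxdiag sumnE (big_nth 0%N) big_mkord expr_sum.
by apply: eq_bigr => j _; rewrite companionmxK // monic_exp.
Qed.

Lemma similar_castmx m n (A : 'M[F]_n) (D : 'M[F]_m) X Y :
  X *m Y = 1%:M -> Y *m X = 1%:M -> X *m A = D *m X ->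
  exists e : m = n, A ~_{in unitmx} castmx (e, e) D.
Proof.
move=> XY YX XA; have e : m = n.
  apply/eqP; rewrite eqn_leq; apply/andP; split.
    by rewrite -{1}(mxrank1 F m) -XY (leq_trans (mxrankM_maxr _ _)) ?rank_leq_row.
  by rewrite -{1}(mxrank1 F n) -YX (leq_trans (mxrankM_maxr _ _)) ?rank_leq_row.
exists e; subst m; rewrite castmx_id; have X_unit : X \in unitmx by case: (mulmx1_unit XY).
by exists X => //; apply/(simmxP X_unit).
Qed.

(** The cyclic summands of [A] are grouped by irreducible polynomial and sorted by decreasing
    exponent; the bijection [t] sends a polynomial and a position in its partition to the summand
    found there. *)
Lemma exists_canonical_data n (A : 'M[F]_n) : exists L, is_canonical_data A L.
Proof.
have [I [f [a [faP [P [Q dec]]]]]] := exists_mxdecomp A.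
pose idx h := sort (fun x y => a y <= a x)%N [seq i <- enum I | f i == h].
have idx_part h : sorted geq [seq a i | i <- idx h] && (0%N \notin [seq a i | i <- idx h]).
  apply/andP; split.
    by rewrite sorted_map; apply: sort_sorted => x y; apply: leq_total.
  by apply/mapP => -[i _ a0]; case: (faP i); rewrite -a0.
pose L h := IntPartn (idx_part h).
pose s := undup [seq f i | i <- enum I].
pose g (i : 'I_(size s)) := tnth (in_tuple s) i.
have g_inj : injective g by apply/tuple_uniqP; rewrite undup_uniq.
have gf i : exists x, f x = g i.
  by have := mem_tnth i (in_tuple s); rewrite mem_undup => /mapP[x _ E]; exists x; rewrite -E.
have gP i : g i \is monic /\ irreducible_poly (g i).
  by have [x <-] := gf i; case: (faP x).
pose t (x : {i : 'I_(size s) & 'I_(size (L (g i)))}) : I :=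
  tnth (in_tuple (idx (g (tag x)))) (cast_ord (size_map _ _) (tagged x)).
have ft x : f (t x) = g (tag x).
  have := mem_tnth (cast_ord (size_map _ _) (tagged x)) (in_tuple (idx (g (tag x)))).
  by rewrite mem_sort mem_filter => /andP[/eqP].
have at_ x : a (t x) = part (L (g (tag x))) (tagged x).
  rewrite /t (tnth_nth (t x)) /= (nth_map (t x)) //.
  by rewrite -(size_map a) ltn_ord.
have idx_uniq h : uniq (idx h) by rewrite sort_uniq filter_uniq // enum_uniq.
have t_inj : injective t.
  move=> [i j] [i' j'] E; have /g_inj /= ii' : g i = g i'.
    by have := congr1 f E; rewrite !ft.
  case: _ / ii' in j' E *; congr Tagged.
  have /tuple_uniqP idx_inj : uniq (in_tuple (idx (g i))) := idx_uniq _.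
  by move/idx_inj: E; apply: cast_ord_inj.
have t_surj i : exists x, t x = i.
  have : f i \in s by rewrite mem_undup map_f // mem_enum.
  case/(tnthP (in_tuple _)) => k gk.
  have : i \in idx (g k) by rewrite mem_sort mem_filter mem_enum gk eqxx.
  case/(tnthP (in_tuple _)) => j ij.
  exists (Tagged (fun i => 'I_(size (L (g i)))) (cast_ord (esym (size_map a (idx (g k)))) j)).
  by rewrite /t /= ij; congr tnth; apply: val_inj.
have [t' t'K] := choice t_surj.
have t_bij : bijective t by exists t' => // x; apply: t_inj.
exists L, (size s), g, (fun i => sumn (L (g i))).
have decJ := mxdecomp_reindex t_bij dec.
have {}decJ : exists P Q, mxdecomp A (fun x : {i : 'I_(size s) & 'I_(size (L (g i)))} =>
    companionmx (g (tag x) ^+ part (L (g (tag x))) (tagged x))) P Q.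
  apply: (mxdecomp_eq_companion (c := fun x => f (t x) ^+ a (t x))); last by eexists; eexists; apply: decJ.
  by move=> x; rewrite ft at_.
have {decJ}[P' [Q' decJ]] := decJ.
have [XY YX XA] := mxdecomp_similar (mxdecomp_group (C := fun i j =>
   companionmx (g i ^+ part (L (g i)) j)) decJ).
split=> //.
- move=> i; have [g_mon g_irr] := gP i; split=> //.
  have [x xi] := gf i.
  have : a x \in parts (L (g i)) by apply/map_f; rewrite mem_sort mem_filter xi eqxx mem_enum.
  case: (faP x) => _ _; rewrite sumnE => ax0 axL.
  by rewrite (big_rem _ axL) /= addn_gt0 ax0.
- rewrite (char_poly_intertwine XY YX XA) char_poly_mxdiag; apply: eq_bigr => i _.
  by have [g_mon _] := gP i; rewrite char_poly_primary_block.
- split; first exact: similar_castmx XY YX XA.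
  move=> h gh; apply: val_inj; apply/eqP; rewrite -size_eq0 /= size_map size_sort size_filter.
  rewrite -leqn0 leqNgt -has_count; apply/hasP => -[i _ /eqP fi].
  have : f i \in s by rewrite mem_undup map_f // mem_enum.
  by case/(tnthP (in_tuple _)) => k gk; have := gh k; rewrite -fi gk eqxx.
Qed.

End CanonicalForm.

(** * Embeddings onto primary components *)

Section PrimarySummands.
Variables (F : finFieldType) (r : nat) (f : 'I_r -> {poly F}) (lam : 'I_r -> intpartn).
Hypotheses (f_inj : injective f) (f_mon : forall i, f i \is monic).
Hypothesis f_irr : forall i, irreducible_poly (f i).
Let B := \mxdiag_(i < r) primary_block (f i) (lam i).

Lemma pmx_mxdiag_primary : pmx B (\prod_i f i ^+ sumn (lam i)) = 0.
Proof.
rewrite -[RHS](pmx_char_poly B); congr (pmx B _).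
rewrite char_poly_mxdiag; apply: eq_bigr => i _.
by rewrite char_poly_primary_block.
Qed.

Lemma rank_ker_mxdiag_primary i k :
  \rank (kermx (pmx B (f i ^+ k))) = ((size (f i)).-1 * \sum_(x <- lam i) minn k x)%N.
Proof.
rewrite (mxdecomp_rank_ker (mxdecomp_mxdiag _)) (bigD1 i) //=.
rewrite rank_ker_primary_block // eqxx [X in (_ + X)%N]big1 ?addn0 // => j ji.
by rewrite rank_ker_primary_block // (inj_eq f_inj) (negPf ji).
Qed.

(** The embedding stacks the inclusions of the f i-primary components of [A]. If [f i] does not
    occur in [A], then [lam i] is the zero partition and its block has size 0. *)
Lemma exists_primary_embedding n (A : 'M[F]_n) L : is_canonical_data A L ->
  (forall i, L (f i) = lam i) ->
  exists2 phi, phi \in embeddings B A & forall i, torsion_free (f i) A phi.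
Proof.
move=> /canonical_data_mxdecomp[k [g [g_inj gP L0 [P [Q dec]]]]] Lf.
have [PQ1 PQ0 QP PA] := dec.
have : forall i, exists PQ' : 'M_(primary_dim (f i) (lam i), n) * 'M_(n, primary_dim (f i) (lam i)),
    [/\ PQ'.1 *m PQ'.2 = 1%:M, PQ'.1 *m A = primary_block (f i) (lam i) *m PQ'.1 &
        PQ'.2 *m PQ'.1 = \sum_(a | g a == f i) Q a *m P a].
  move=> i; case: (pickP (fun a => g a == f i)) => [a /eqP ga|gf].
    rewrite -(Lf i) -ga; exists (P a, Q a); split=> //=.
    rewrite (bigD1 a) //= big1 ?addr0 // => b /andP[/eqP/g_inj -> ]; by rewrite eqxx.
  have lam0 : lam i = zero_partn by rewrite -Lf L0 // => a; rewrite gf.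
  have d0 : primary_dim (f i) (lam i) = 0%N by rewrite lam0 /primary_dim big_ord0.
  exists (0, 0); split=> /=.
  - by move: (1%:M); rewrite mulmx0; move: (primary_dim _ _) d0 => d -> M; rewrite [RHS]flatmx0.
  - by rewrite mul0mx mulmx0.
  - by rewrite mulmx0 big_pred0.
move=> PQ'_ex; pose P' i := (projT1 (cid (PQ'_ex i))).1; pose Q' i := (projT1 (cid (PQ'_ex i))).2.
have PQ'P i := projT2 (cid (PQ'_ex i)).
have PQ'1 i : P' i *m Q' i = 1%:M by case: (PQ'P i).
have P'A i : P' i *m A = primary_block (f i) (lam i) *m P' i by case: (PQ'P i).
have Q'P' i : Q' i *m P' i = \sum_(a | g a == f i) Q a *m P a by case: (PQ'P i).
have P'Q i a : g a != f i -> P' i *m Q a = 0.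
  move=> ga; rewrite -[P' i]mul1mx -(PQ'1 i) -(mulmxA (P' i)) Q'P' -mulmxA mulmx_suml.
  rewrite big1 ?mulmx0 // => b /eqP gb; rewrite -mulmxA PQ0 ?mulmx0 //.
  by apply: contraNneq ga => <-; rewrite gb.
have P'Q'0 i j : i != j -> P' i *m Q' j = 0.
  move=> ij; rewrite -[Q' j]mulmx1 -(PQ'1 j) (mulmxA (Q' j)) Q'P' mulmxA mulmx_sumr.
  rewrite mulmx_suml big1 // => a /eqP ga; rewrite mulmxA P'Q ?mul0mx //.
  by rewrite ga (inj_eq f_inj) eq_sym.
pose phi := \mxcol_i P' i.
have phi_free : row_free phi.
  apply/row_freeP; exists (\mxrow_i Q' i); rewrite mul_mxcol_mxrow -mxdiagZ.
  apply/eq_mxblock => i j; have [->|ij] := eqVneq i j; last by rewrite P'Q'0.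
  by rewrite conform_mx_id PQ'1.
have P'phi i : (P' i <= phi)%MS.
  have -> : P' i = submxcol 1%:M i *m phi by rewrite submxcol_mul mul1mx mxcolK.
  exact: submxMl.
exists phi => [|i].
  rewrite inE phi_free /=; apply/eqP; rewrite /B mul_mxdiag_mxcol mxcol_mul.
  by apply: eq_mxcol => i; apply: P'A.
apply/torsion_freeP => l x /submxP[y xf].
rewrite [x](mxdecomp_row_sum dec); apply: summx_sub => a _.
case: (pickP (fun j => g a == f j)) => [j /eqP ga|gf].
  have -> : x *m Q a *m P a = x *m Q a *m P a *m (Q' j *m P' j).
    rewrite Q'P' (bigD1 a) ?ga //= mulmxDr mulmx_sumr [X in _ + X]big1 ?addr0.
      by rewrite -!mulmxA (mulmxA (P a)) PQ1 mul1mx.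
    move=> b /andP[_ ba]; rewrite -!mulmxA (mulmxA (P a)) PQ0 ?mul0mx ?mulmx0 //.
    by rewrite eq_sym.
  by rewrite mulmxA (submx_trans (submxMl _ _)).
(* On a primary component belonging to none of the f j, the image of [phi] has no part and f i acts
   invertibly. *)
suff -> : x *m Q a = 0 by rewrite mul0mx sub0mx.
have xQ : x *m Q a *m pmx (primary_block (g a) (L (g a))) (f i) = 0.
  rewrite -mulmxA -(mxdecompQ_pmx dec) mulmxA xf -mulmxA /phi mxcol_mul.
  by under eq_mxcol => j do rewrite P'Q ?gf //; rewrite mxcol0 mulmx0.
have [ga_mon ga_irr] := gP a.
have := rank_ker_primary_block (L (g a)) 1 ga_mon ga_irr (f_mon i) (f_irr i).
rewrite gf expr1 => /eqP; rewrite mxrank_eq0 kermx_eq0 => free.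
by apply: (row_free_inj free); rewrite xQ mul0mx.
Qed.

(* An embedding whose cokernel has no f i-torsion is onto the sum of the f i-primary
   components of A, so it exists only if these have the types lam i, and then the
   automorphisms of the source act simply transitively on such embeddings. *)
Lemma card_primary_embeddings n (A : 'M[F]_n) :
  #|[set phi in embeddings B A | [forall i, torsion_free (f i) A phi]]| =
  if [forall i, canonical_partn (f i) A == lam i] then #|unit_centralizer B| else 0%N.
Proof.
have [L LA] := exists_canonical_data A.
have partE i : canonical_partn (f i) A = L (f i) by apply: canonical_partnE.
case: forallP => [Lf|nLf].
  have [i|phi phi_emb phi_tf] := exists_primary_embedding LA.
    by rewrite -partE; apply/eqP.
  apply: (card_torsion_free_embeddings _ _ pmx_mxdiag_primary phi_emb).
  - move=> U V UV /forallP U_tf; apply/forallP => i.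
    by rewrite -(torsion_free_eqmx _ _ UV).
  - move=> U /forallP U_tf; apply: (big_ind (fun g => torsion_free g A U)).
    + exact: torsion_free1.
    + by move=> g h; apply: torsion_freeM.
    + by move=> i _; apply: torsion_freeX.
  - exact/forallP.
apply/eqP; rewrite cards_eq0; apply/eqP/setP => phi; rewrite !inE.
apply/negbTE/negP => /andP[phi_emb /forallP tf]; apply: nLf => i.
rewrite partE; apply/eqP; apply: (canonical_data_unique LA) => // k.
rewrite -rank_ker_mxdiag_primary; apply: (rank_ker_embedding (phi := phi)); last exact: torsion_freeX.
by rewrite inE.
Qed.

End PrimarySummands.

(** * Automorphisms *)

Section CentralizerProduct.
Variables (F : finFieldType) (r : nat) (p_ : 'I_r -> nat).
Variable (B : forall i, 'M[F]_(p_ i)).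

Lemma mxdiag_unit (X : forall i, 'M[F]_(p_ i)) :
  (mxdiag X \in unitmx) = [forall i, X i \in unitmx].
Proof.
have dec := mxdecomp_mxdiag X; have [PQ1 PQ0 QP PA] := dec.
rewrite -row_free_unit; apply/idP/forallP => [X_free i|X_unit].
  rewrite -row_free_unit; apply: inj_row_free => v vX.
  have /(row_free_inj X_free) : v *m mxincl F _ i *m mxdiag X = 0 *m mxdiag X.
    by rewrite -mulmxA PA mulmxA vX !mul0mx.
  by move=> /(congr1 (mulmx^~ (mxproj F _ i))); rewrite -mulmxA PQ1 mulmx1 mul0mx.
apply: inj_row_free => v vX; rewrite (mxdecomp_row_sum dec v); apply: big1 => i _.
have Xi_free : row_free (X i) by rewrite row_free_unit.
have -> : v *m mxproj F _ i = 0; last by rewrite mul0mx.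
apply: (row_free_inj Xi_free); rewrite mul0mx -mulmxA -(mxdecompQ dec).
by rewrite mulmxA vX mul0mx.
Qed.

(** Blocks with coprime annihilators admit only the zero intertwiner: [G j] kills the block [B j]
    but acts invertibly on [B i]. So every matrix in the centralizer is block diagonal. *)
Lemma card_unit_centralizer_mxdiag (G : 'I_r -> {poly F}) :
  (forall i, pmx (B i) (G i) = 0) -> (forall i j, i != j -> coprimep (G i) (G j)) ->
  #|unit_centralizer (mxdiag B)| = (\prod_i #|unit_centralizer (B i)|)%N.
Proof.
move=> BG coG; rewrite -cardsXn.
pose D (X : {dffun forall i : 'I_r, 'M[F]_(p_ i)}) := mxdiag (fun i => X i).
have D_inj : injective D.
  by move=> X Y /eq_mxdiagP XY; apply/ffunP => i; apply: XY.
rewrite -(card_imset _ D_inj); apply: eq_card => X.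
have dec := mxdecomp_mxdiag B; have [PQ1 PQ0 QP PA] := dec.
apply/idP/imsetP => [|[Y /setXnP Ycent ->]].
  rewrite inE => /andP[X_unit /eqP XB].
  pose Y i j := mxincl F _ i *m X *m mxproj F _ j.
  have YB i j : B i *m Y i j = Y i j *m B j.
    by rewrite /Y !mulmxA -PA -(mulmxA _ (mxdiag B)) -XB -!mulmxA (mxdecompQ dec).
  have Y0 i j : i != j -> Y i j = 0.
    move=> ij; have Bi_unit := pmx_unit (coG j i _) (BG i).
    have := pmx_intertwine (G j) (esym (YB i j)); rewrite BG mulmx0 => /esym E.
    apply: (can_inj (mulKmx (Bi_unit _))); rewrite ?E ?mulmx0 //; by rewrite eq_sym.
  have XE : X = D [ffun i => Y i i].
    rewrite -[LHS]submxblockK; apply/eq_mxblock => i j; rewrite ffunE.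
    have -> : submxblock X i j = Y i j.
      by rewrite /Y submxcol_mul mul1mx mul_submxrow mulmx1 submxblockEv.
    by have [->|ij] := eqVneq i j; [rewrite conform_mx_id|rewrite Y0].
  exists [ffun i => Y i i] => //; apply/setXnP => i; rewrite ffunE inE YB eqxx andbT.
  by move: X_unit; rewrite XE mxdiag_unit => /forallP/(_ i); rewrite ffunE.
rewrite inE mxdiag_unit; apply/andP; split.
  by apply/forallP => i; have := Ycent i; rewrite inE => /andP[].
apply/eqP; rewrite /D; rewrite [in LHS]/mxdiag [in RHS]/mxdiag.
rewrite -/(mxdiag B) -/(mxdiag (fun i => Y i)) [X in _ *m X]/mxdiag.
rewrite mul_mxdiag_mxblock -/(mxdiag _) [X in _ = _ *m X]/mxdiag mul_mxdiag_mxblock.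
apply/eq_mxblock => i j; have [<-|ij] := eqVneq i j; rewrite ?mulmx0 //.
by rewrite !conform_mx_id; have := Ycent i; rewrite inE => /andP[_ /eqP].
Qed.

End CentralizerProduct.

Section QuotientCoordinates.
Variables (F : finFieldType) (h : {poly F}).
Hypotheses (h_mon : h \is monic) (h_gt1 : (1 < size h)%N).

(** The type [{poly %/ h}] is the quotient by [mk_monic h], which is [h] itself for monic
    nonconstant [h]. *)
Let mk_h : mk_monic h = h.
Proof. by rewrite /mk_monic h_gt1 h_mon. Qed.

Let sz_h : size (mk_monic h) = size h.
Proof. by rewrite mk_h. Qed.

Let szE k : (k < size h)%N = (k <= (size h).-1)%N.
Proof. by rewrite -[in RHS]ltnS prednK // ltnW. Qed.

Lemma qpoly_rVK : cancel (fun u : {poly %/ h} => poly_rV (u : {poly F}))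
                         (fun v : 'rV_(size h).-1 => in_qpoly h (rVpoly v)).
Proof.
move=> u; have u_sz : (size (u : {poly F}) < size h)%N.
  by rewrite -[X in (_ < X)%N]sz_h size_mk_monic.
by apply: val_inj; rewrite /= poly_rV_K -?szE // Pdiv.Ring.rmodp_small // size_mk_monic.
Qed.

Lemma rV_qpolyK : cancel (fun v : 'rV_(size h).-1 => in_qpoly h (rVpoly v))
                         (fun u : {poly %/ h} => poly_rV (u : {poly F})).
Proof.
by move=> v; rewrite in_qpoly_small ?rVpolyK // mk_h szE size_poly.
Qed.

Lemma qpoly_rV_scale q (u : {poly %/ h}) :
  poly_rV (in_qpoly h q * u : {poly F}) =
    poly_rV (u : {poly F}) *m pmx (companionmx h) q :> 'rV_(size h).-1.
Proof.
rewrite mulmx_pmx_companion // poly_rV_K; last first.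
  by rewrite -szE -[X in (_ < X)%N]sz_h size_mk_monic.
congr poly_rV; rewrite Pdiv.IdomainMonic.modpE // mulrC poly_of_qpolyM.
by rewrite -[X in _ = Pdiv.Ring.rmodp _ X]mk_h Pdiv.RingMonic.rmodp_mulmr ?monic_mk_monic.
Qed.

End QuotientCoordinates.

Section AutomorphismCount.
Variables (F : finFieldType) (f : {poly F}) (lam : intpartn).
Hypotheses (f_mon : f \is monic) (f_gt1 : (1 < size f)%N).
Let M := torsion_module f lam.
Let B := primary_block f lam.

Let part_gt0 (j : 'I_(size lam)) : (0 < part lam j)%N.
Proof.
case: lam j => s /= /andP[_ s0] j; rewrite lt0n; apply: contraNneq s0 => <-.
exact: mem_nth.
Qed.

Let h_mon (j : 'I_(size lam)) : f ^+ part lam j \is monic.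
Proof. exact: monic_exp. Qed.

Let h_gt1 (j : 'I_(size lam)) : (1 < size (f ^+ part lam j)%R)%N.
Proof.
have f1 : (0 < (size f).-1)%N by rewrite -ltnS prednK // ltnW.
by rewrite -[size _]prednK ?size_poly_gt0 ?monic_neq0 // ltnS size_exp muln_gt0 f1 part_gt0.
Qed.

Definition tm_row (u : torsion_module f lam) : 'rV[F]_(primary_dim f lam) :=
  \mxrow_j poly_rV (u j : {poly F}).

Definition row_tm (v : 'rV[F]_(primary_dim f lam)) : torsion_module f lam :=
  [ffun j : 'I_(size lam) => in_qpoly (f ^+ part lam j) (rVpoly (submxrow v j))].

Lemma tm_rowK : cancel tm_row row_tm.
Proof. by move=> u; apply/ffunP => j; rewrite ffunE mxrowK qpoly_rVK. Qed.

Lemma row_tmK : cancel row_tm tm_row.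
Proof.
move=> v; rewrite -[RHS]submxrowK; apply: eq_mxrow => j.
by rewrite ffunE rV_qpolyK.
Qed.

Lemma tm_rowD : {morph tm_row : u v / u + v}.
Proof.
by move=> u v; rewrite /tm_row -mxrowD; apply: eq_mxrow => j; rewrite ffunE -linearD.
Qed.

Lemma tm_row_scale q u : tm_row (q *: u) = tm_row u *m pmx B q.
Proof.
rewrite -[RHS]submxrowK; apply: eq_mxrow => j; rewrite ffunE qpoly_rV_scale //.
have dec := mxdecomp_mxdiag (fun j : 'I_(size lam) => companionmx (f ^+ part lam j)).
rewrite -[_ *m _ in RHS]mulmx1 -mul_submxrow -mulmxA.
by rewrite (mxdecompQ_pmx dec) mulmxA mul_submxrow mulmx1 mxrowK.
Qed.

Definition aut_mx (s : {perm torsion_module f lam}) : 'M[F]_(primary_dim f lam) :=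
  lin1_mx (tm_row \o s \o row_tm).

Lemma aut_mxE (s : {perm torsion_module f lam}) v :
  s \in module_Aut f lam -> v *m aut_mx s = tm_row (s (row_tm v)).
Proof.
rewrite inE => /asboolP s_lin.
have row_tmD c u w : row_tm (c *: u + w) = c%:P *: row_tm u + row_tm w.
  apply: (can_inj tm_rowK).
  by rewrite tm_rowD tm_row_scale !row_tmK pmxC mul_mx_scalar.
have lin : linear (tm_row \o s \o row_tm).
  by move=> c u w /=; rewrite row_tmD s_lin tm_rowD tm_row_scale pmxC mul_mx_scalar.
pose g : {linear 'rV[F]_(primary_dim f lam) -> 'rV[F]_(primary_dim f lam)} :=
  HB.pack (tm_row \o s \o row_tm) (GRing.isLinear.Build _ _ _ _ _ lin).
exact: (mul_rV_lin1 g).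
Qed.

(** In the coordinates [tm_row] a scalar [q] acts as [pmx B q], so F[t]-linear bijections correspond
    to invertible matrices commuting with [B]. *)
Lemma card_module_Aut : #|module_Aut f lam| = #|unit_centralizer B|.
Proof.
have aut_inj : {in module_Aut f lam &, injective aut_mx}.
  move=> s t s_aut t_aut st; apply/permP => u; apply: (can_inj tm_rowK).
  by rewrite -(tm_rowK u) -!aut_mxE // st.
rewrite -(card_in_imset aut_inj); apply: eq_card => X.
apply/imsetP/idP => [[s s_aut ->]|].
  have mxP (Y Z : 'M[F]_(primary_dim f lam)) : (forall v : 'rV_(primary_dim f lam), v *m Y = v *m Z) -> Y = Z.
    by move=> YZ; apply/row_matrixP => i; rewrite !rowE YZ.
  rewrite inE -row_free_unit; apply/andP; split.
    apply: inj_row_free => v; rewrite aut_mxE // => sv.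
    apply: (can_inj row_tmK); apply: (@perm_inj _ s); apply: (can_inj tm_rowK).
    by rewrite sv -aut_mxE // mul0mx.
  apply/eqP/mxP => v; rewrite !mulmxA aut_mxE // [in RHS]aut_mxE //.
  have s_lin : linear s by apply/asboolP; move: s_aut; rewrite inE.
  have -> : row_tm (v *m B) = 'X *: row_tm v.
    by apply: (can_inj tm_rowK); rewrite tm_row_scale !row_tmK pmxX.
  have s0 : s 0 = 0 by apply: (addrI (s 0)); rewrite -{1}[s 0]scale1r -s_lin scale1r !addr0.
  by rewrite -['X *: row_tm v]addr0 s_lin s0 addr0 tm_row_scale pmxX.
rewrite inE => /andP[X_unit /eqP XB].
have sX_inj : injective (fun u => row_tm (tm_row u *m X)).
  move=> u w /(can_inj row_tmK) E; apply: (can_inj tm_rowK).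
  by apply: (can_inj (mulmxK X_unit)).
have sX_aut : perm sX_inj \in module_Aut f lam.
  rewrite inE; apply/asboolP => q u w; rewrite !permE; apply: (can_inj tm_rowK).
  rewrite tm_rowD tm_row_scale !row_tmK tm_rowD tm_row_scale mulmxDl -!mulmxA.
  by rewrite !row_tmK -!mulmxA (pmx_intertwine q XB).
exists (perm sX_inj) => //; apply/row_matrixP => i; rewrite !rowE aut_mxE //.
by rewrite permE !row_tmK.
Qed.

End AutomorphismCount.

From mathcomp Require Import all_classical all_reals all_analysis.
Import numFieldNormedType.Exports.
Local Open Scope classical_set_scope.
Local Open Scope ring_scope.

(** * Euler's expansion *)

Lemma cvg_bigsum (R : realType) (I : Type) (r : seq I) (P : pred I)
    (u : I -> nat -> R) (l : I -> R) : (forall i, P i -> u i n @[n --> \oo] --> l i) ->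
  \sum_(i <- r | P i) u i n @[n --> \oo] --> \sum_(i <- r | P i) l i.
Proof.
move=> ul; elim: r => [|i r IHr].
  by rewrite big_nil; apply: cvg_near_cst; apply: nearW => n; rewrite big_nil.
rewrite big_cons; case: ifP => Pi.
  by under eq_cvg do rewrite big_cons Pi; apply: cvgD => //; apply: ul.
by under eq_cvg do rewrite big_cons Pi.
Qed.

Section EulerSeries.
Variables (R : realType) (Q : R).
Hypothesis Q_ge2 : 2 <= Q.
Let x := Q^-1.

(** Multiplied by the number of independent k-tuples in dimension e, this gives Q^(k(k-1)/2) times
    the Gaussian binomial of e and k, the coefficient in the q-binomial theorem. *)
Definition euler_coef (k : nat) : R := \prod_(i < k) (Q ^+ i.+1 - 1)^-1.

Definition euler_prod (m : nat) : R := \prod_(i < m) (1 - x ^+ i.+1).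

Let Q_gt0 : 0 < Q. Proof. by apply: lt_le_trans Q_ge2. Qed.
Let Q_ge1 : 1 <= Q. Proof. by apply: le_trans Q_ge2; lra. Qed.
Let x_ge0 : 0 <= x. Proof. by rewrite invr_ge0 ltW. Qed.
Let x_le : x <= 2^-1. Proof. by rewrite lef_pV2 // posrE. Qed.
Let x_lt1 : x < 1. Proof. by apply: le_lt_trans x_le _; lra. Qed.

Lemma expr_sub1_ge k : k%:R <= Q ^+ k - 1.
Proof.
elim: k => [|k IHk]; first by rewrite expr0 subrr.
rewrite exprS -natr1; have Qk1 : 1 <= Q ^+ k by rewrite exprn_ege1.
have : 2 * Q ^+ k <= Q * Q ^+ k by rewrite ler_wpM2r // (le_trans ler01).
lra.
Qed.

Lemma expr_sub1_gt0 k : 0 < Q ^+ k.+1 - 1.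
Proof. by apply: lt_le_trans (expr_sub1_ge _); rewrite ltr0n. Qed.

Lemma euler_coef0 : euler_coef 0 = 1.
Proof. by rewrite /euler_coef big_ord0. Qed.

Lemma euler_coefS k : euler_coef k.+1 = euler_coef k / (Q ^+ k.+1 - 1).
Proof. by rewrite /euler_coef big_ord_recr. Qed.

Lemma euler_coef_ge0 k : 0 <= euler_coef k.
Proof. by apply: prodr_ge0 => i _; rewrite invr_ge0 ltW // expr_sub1_gt0. Qed.

Lemma euler_coef_le k : euler_coef k.+1 <= k.+1%:R^-1.
Proof.
have le1 j : euler_coef j <= 1.
  elim: j => [|j IHj]; first by rewrite euler_coef0.
  rewrite euler_coefS ler_pdivrMr ?expr_sub1_gt0 // mul1r (le_trans IHj) //.
  by rewrite (le_trans _ (expr_sub1_ge _)) // ler1n.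
rewrite euler_coefS -[leRHS]mul1r ler_pM ?euler_coef_ge0 ?le1 //.
  by rewrite invr_ge0 ltW // expr_sub1_gt0.
by rewrite lef_pV2 ?expr_sub1_ge // posrE ?expr_sub1_gt0.
Qed.

Lemma cvg_euler_coef : euler_coef n @[n --> \oo] --> (0 : R).
Proof.
rewrite -(cvg_shiftS euler_coef); apply: (squeeze_cvgr _ (cvg_cst 0) cvg_harmonic).
by apply: nearW => n; rewrite euler_coef_ge0 euler_coef_le.
Qed.

Section Bonferroni.
Variable e : nat.

(** For e > 0 this is Q^(N(N+1)/2) times the Gaussian binomial of e - 1 and N: the q-analogue of the
    identity by which the alternating sum of binomials of e up to N is, up to sign, the binomial of
    e - 1 and N. *)
Let tail (N : nat) : R := euler_coef N * \prod_(j < N) (Q ^+ e - Q ^+ j.+1).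

Let prod_recl N : \prod_(j < N.+1) (Q ^+ e - Q ^+ j) =
  (Q ^+ e - 1) * \prod_(j < N) (Q ^+ e - Q ^+ j.+1).
Proof. by rewrite big_ord_recl. Qed.

Let partial_sum N : (0 < e)%N ->
  \sum_(k < N.+1) (-1) ^+ k * (euler_coef k * \prod_(j < k) (Q ^+ e - Q ^+ j)) =
  (-1) ^+ N * tail N.
Proof.
move=> e_gt0; elim: N => [|N IHN].
  by rewrite big_ord1 /tail !big_ord0.
rewrite big_ord_recr [val _]/= IHN prod_recl /tail [in RHS]big_ord_recr /=.
have : euler_coef N = euler_coef N.+1 * (Q ^+ N.+1 - 1).
  by rewrite euler_coefS divfK // gt_eqF // expr_sub1_gt0.
move=> ->; rewrite [(-1) ^+ N.+1]exprS; ring.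
Qed.

Let tail_bound N : (0 < e)%N ->
  0 <= tail N <= euler_coef N.+1 * \prod_(j < N.+1) (Q ^+ e - Q ^+ j).
Proof.
move=> e_gt0; rewrite prod_recl /tail; have [eN|Ne] := leqP e N.
  have e1_lt : (e.-1 < N)%N by rewrite prednK.
  rewrite (bigD1 (Ordinal e1_lt)) //= prednK // subrr mul0r !mulr0 lexx.
  by [].
have pos : 0 <= \prod_(i < N) (Q ^+ e - Q ^+ i.+1).
  by apply: prodr_ge0 => i _; rewrite subr_ge0 ler_weXn2l // (leq_trans (ltn_ord i)) // ltnW.
rewrite mulr_ge0 ?euler_coef_ge0 //= mulrA ler_wpM2r // euler_coefS -mulrA.
rewrite ler_peMr ?euler_coef_ge0 // mulrC ler_pdivlMr ?expr_sub1_gt0 // mul1r.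
by rewrite lerB // ler_weXn2l.
Qed.

(* [\prod_(j < k) (Q ^+ e - Q ^+ j)] counts the linearly independent k-tuples in a space
   of dimension e over a field with Q elements: a truncated Moebius inversion. *)
Lemma bonferroni N :
  `|(e == 0%N)%:R -
    \sum_(k < N.+1) (-1) ^+ k * (euler_coef k * \prod_(j < k) (Q ^+ e - Q ^+ j))| <=
  euler_coef N.+1 * \prod_(j < N.+1) (Q ^+ e - Q ^+ j).
Proof.
have [e0|e_gt0] := posnP e.
  have z M : \prod_(j < M.+1) (Q ^+ e - Q ^+ j) = 0.
    by rewrite prod_recl e0 expr0 subrr mul0r.
  rewrite z mulr0 (eq_bigr (fun k : 'I_N.+1 => (k == 0 :> nat)%:R)).
    by rewrite big_ord_recl big1 // addr0 subrr normr0.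
  move=> [[|k] k_lt] _ /=; last by rewrite z !mulr0.
  by rewrite big_ord0 euler_coef0 expr0 !mulr1.
have /andP[t0 tN] := tail_bound N e_gt0.
by rewrite partial_sum // sub0r normrN normrM normrX normrN1 expr1n mul1r ger0_norm.
Qed.

End Bonferroni.

(** The truncation of Euler's series for the product of the 1 - z x^j over j >= 1, at z = x^i.
    Replacing i by i + 1 removes the first factor, up to the truncation error in [G_step]. *)
Let G N i : R := \sum_(k < N.+1) (-1) ^+ k * (euler_coef k * x ^+ (i * k)).

Let G_step N i : G N i = (1 - x ^+ i.+1) * G N i.+1 + (-1) ^+ N * (x ^+ i.+1 * (euler_coef N * x ^+ (i.+1 * N))).
Proof.
elim: N => [|N IHN].
  by rewrite /G !big_ord_recr !big_ord0 /= !muln0 euler_coef0 expr0; ring.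
rewrite /G big_ord_recr [in RHS]big_ord_recr /= -/(G N i) -/(G N i.+1) IHN.
have Qx : Q * x = 1 by rewrite divff // gt_eqF.
have -> : euler_coef N = euler_coef N.+1 * (Q ^+ N.+1 - 1).
  by rewrite euler_coefS divfK // gt_eqF // expr_sub1_gt0.
have -> : x ^+ (i.+1 * N.+1) = x ^+ (i * N.+1) * x ^+ N.+1 by rewrite -exprD mulSn addnC.
have -> : x ^+ i.+1 * (euler_coef N.+1 * (Q ^+ N.+1 - 1) * x ^+ (i.+1 * N)) =
   euler_coef N.+1 * x ^+ (i * N.+1) * (1 - x ^+ N.+1).
  have E1 : x ^+ i.+1 * x ^+ (i.+1 * N) = x ^+ (i * N.+1) * x ^+ N.+1.
    by rewrite -!exprD; congr (x ^+ _); lia.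
  have E2 : Q ^+ N.+1 * x ^+ N.+1 = 1 by rewrite -exprMn Qx expr1n.
  transitivity (euler_coef N.+1 * (Q ^+ N.+1 - 1) * (x ^+ i.+1 * x ^+ (i.+1 * N))); first by ring.
  by rewrite E1; transitivity (euler_coef N.+1 * x ^+ (i * N.+1) *
    (Q ^+ N.+1 * x ^+ N.+1 - x ^+ N.+1)); [ring|rewrite E2].
rewrite [in (-1) ^+ N.+1]exprS; ring.
Qed.

(** Iterating [G_step] adds errors of at most c_N x^(M+1), with c_N = [euler_coef N]; since x <= 1/2
    this is at most c_N (x^M - x^(M+1)), and the bounds telescope. *)
Let G_prod N M : `|G N 0 - euler_prod M * G N M| <= euler_coef N * (1 - x ^+ M).
Proof.
elim: M => [|M IHM].
  by rewrite /euler_prod big_ord0 mul1r subrr normr0 expr0 subrr mulr0.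
have P01 : 0 <= euler_prod M <= 1.
  apply/andP; split.
    by apply: prodr_ge0 => i _; rewrite subr_ge0 exprn_ile1 // ltW.
  by apply: prodr_ile1 => i _; rewrite subr_ge0 gerBl exprn_ge0 // exprn_ile1 // ltW.
have -> : G N 0 - euler_prod M.+1 * G N M.+1 = (G N 0 - euler_prod M * G N M) +
   (-1) ^+ N * (euler_prod M * (x ^+ M.+1 * (euler_coef N * x ^+ (M.+1 * N)))).
  by rewrite (G_step N M) /euler_prod [\prod_(i < M.+1) _]big_ord_recr /=; ring.
apply: le_trans (ler_normD _ _) _.
apply: le_trans (lerD IHM (_ : _ <= euler_coef N * x ^+ M.+1)) _.
  rewrite normrM normrX normrN1 expr1n mul1r ger0_norm; last first.
    by case/andP: P01 => P0 _; rewrite !mulr_ge0 ?exprn_ge0 ?euler_coef_ge0.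
  case/andP: P01 => P0 P1; rewrite -[leRHS]mul1r ler_pM //.
    by rewrite !mulr_ge0 ?exprn_ge0 ?euler_coef_ge0.
  rewrite mulrC -mulrA ler_wpM2l ?euler_coef_ge0 // -[leRHS]mul1r ler_wpM2r ?exprn_ge0 //.
  by rewrite exprn_ile1 // ltW.
rewrite -mulrDr ler_wpM2l ?euler_coef_ge0 // exprS.
have xM0 : 0 <= x ^+ M by rewrite exprn_ge0.
have : x * x ^+ M <= 2^-1 * x ^+ M by rewrite ler_wpM2r.
lra.
Qed.

Lemma is_cvg_euler_prod : cvgn euler_prod.
Proof.
apply: nonincreasing_is_cvgn.
  apply/nonincreasing_seqP => n; rewrite /euler_prod big_ord_recr /=.
  rewrite ler_piMr //; last by rewrite gerBl exprn_ge0.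
  by apply: prodr_ge0 => i _; rewrite subr_ge0 exprn_ile1 // ltW.
exists 0 => _ [n _ <-]; apply: prodr_ge0 => i _.
by rewrite subr_ge0 exprn_ile1 // ltW.
Qed.

Lemma euler_series_bound N :
  `|\sum_(k < N.+1) (-1) ^+ k * euler_coef k - limn euler_prod| <= euler_coef N.
Proof.
have SE : \sum_(k < N.+1) (-1) ^+ k * euler_coef k = G N 0.
  by apply: eq_bigr => k _; rewrite mul0n expr0 mulr1.
rewrite SE.
have G_cvg : G N M @[M --> \oo] --> (1 : R).
  have xM_cvg : x ^+ M @[M --> \oo] --> (0 : R) by apply: cvg_expr; rewrite ger0_norm.
  have -> : (1 : R) = \sum_(k < N.+1) (k == 0 :> nat)%:R.
    by rewrite big_ord_recl big1 ?addr0.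
  rewrite /G; apply: cvg_bigsum => k _.
  case: (posnP k) => [->|k_gt0].
    apply: cvg_near_cst; apply: nearW => M.
    by rewrite muln0 !expr0 euler_coef0 !mulr1.
  rewrite -[false%:R](mulr0 ((-1) ^+ k)); apply: cvgM; first exact: cvg_cst.
  rewrite -[0](mulr0 (euler_coef k)); apply: cvgM; first exact: cvg_cst.
  under eq_cvg do rewrite mulnC exprM.
  apply: cvg_expr; rewrite ger0_norm ?exprn_ge0 // exprn_ilt1 // -lt0n.
  by [].
have lim : `|G N 0 - euler_prod M * G N M| @[M --> \oo] --> `|G N 0 - limn euler_prod * 1|.
  apply: cvg_norm; apply: cvgB; first exact: cvg_cst.
  by apply: cvgM => //; apply: is_cvg_euler_prod.
rewrite -[limn _]mulr1 -(cvg_lim (@Rhausdorff R) lim); apply: limr_le.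
  by apply/cvg_ex; eexists; apply: lim.
apply: nearW => M; apply: le_trans (G_prod N M) _.
by rewrite -[leRHS]mulr1 ler_wpM2l ?euler_coef_ge0 // gerBl exprn_ge0.
Qed.

Lemma cvg_euler_series :
  \sum_(k < N.+1) (-1) ^+ k * euler_coef k @[N --> \oo] --> limn euler_prod.
Proof.
apply/cvgrPdist_le => eps eps_gt0.
have /cvgr0Pnorm_le/(_ _ eps_gt0) := cvg_euler_coef; apply: filterS => N.
rewrite ger0_norm ?euler_coef_ge0 // => /(le_trans (euler_series_bound N)).
by rewrite distrC.
Qed.

End EulerSeries.

(** * The sieve *)

Lemma cvg_approx (R : realType) (x : nat -> R) (y z : nat -> nat -> R) (s t : nat -> R) (l : R) :
  (forall N n, `|x n - y N n| <= z N n) ->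
  (forall N, y N n @[n --> \oo] --> s N) -> (forall N, z N n @[n --> \oo] --> t N) ->
  s N @[N --> \oo] --> l -> t N @[N --> \oo] --> (0 : R) -> x n @[n --> \oo] --> l.
Proof.
move=> xyz ys zt sl t0; apply/cvgrPdist_le => eps eps_gt0.
have e4 : 0 < eps / 4 by rewrite divr_gt0.
have /cvgrPdist_le/(_ _ e4) sl' := sl.
have /cvgr0Pnorm_le/(_ _ e4) t0' := t0.
have [N [slN tN]] := filter_ex (filterI sl' t0').
have /cvgrPdist_le/(_ _ e4) ysN := ys N.
have /cvgrPdist_le/(_ _ e4) ztN := zt N.
apply: filterS2 ysN ztN => n yn zn; have xn := xyz N n.
have : `|l - x n| <= `|l - s N| + `|s N - y N n| + `|x n - y N n|.
  have -> : l - x n = (l - s N) + (s N - y N n) - (x n - y N n) by ring.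
  by apply: le_trans (ler_normB _ _) _; rewrite lerD2r ler_normD.
have : z N n <= `|t N| + `|t N - z N n|.
  have := ler_norm (t N); have := ler_norm (- (t N - z N n)); rewrite normrN; lra.
lra.
Qed.

Section TorsionFreeMoments.
Variables (R : realType) (F : finFieldType).
Let q : R := #|F|%:R.
Let q_ge2 : 2 <= q. Proof. by rewrite ler_nat card_finNzRing_gt1. Qed.
Let q_gt0 : 0 < q. Proof. by apply: lt_le_trans q_ge2. Qed.

Definition torsion_free_count m n (fs : seq {poly F}) (B : 'M[F]_m) (A : 'M[F]_n) : nat :=
  #|[set phi in embeddings B A | all (fun f => torsion_free f A phi) fs]|.

Lemma torsion_free_countE m n fs (B : 'M[F]_m) (A : 'M[F]_n) :
  (torsion_free_count fs B A)%:R =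
  \sum_(phi in embeddings B A) (all (fun f => torsion_free f A phi) fs)%:R :> R.
Proof.
rewrite /torsion_free_count -sum1_card natr_sum [RHS]big_mkcond [LHS]big_mkcond /=.
by apply: eq_bigr => phi _; rewrite inE; case: (_ \in _); case: all.
Qed.

Section OnePrime.
Variables (d : nat) (f : {poly F}) (fs : seq {poly F}).
Hypotheses (f_mon : f \is monic) (f_irr : irreducible_poly f) (f_sz : size f = d.+2).
Hypothesis f_co : forall g, g \in fs -> coprimep g f.

Let c := euler_coef (q ^+ d.+1).

Let Q_ge2 : 2 <= q ^+ d.+1.
Proof. by rewrite exprS -[2]mulr1 ler_pM // exprn_ege1 // (le_trans _ q_ge2) // ler1n. Qed.

Lemma sum_torsion_free_count m n k (B : 'M[F]_m) (A : 'M[F]_n) :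
  \sum_(Y : 'M[F]_(k, m)) (torsion_free_count fs (ext_mx d f B Y) A)%:R =
  \sum_(phi in embeddings B A) (all (fun g => torsion_free g A phi) fs)%:R *
    #|torsion_tuples d f A phi k|%:R :> R.
Proof.
under [RHS]eq_bigr do rewrite mulr_natr.
rewrite (sum_torsion_tuples f_mon f_sz); apply: eq_bigr => Y _.
rewrite torsion_free_countE; apply: eq_bigr => phi phi_emb.
congr (nat_of_bool _)%:R; apply: eq_in_all => g /f_co co.
exact: (torsion_free_usubmx f_mon f_sz co phi_emb).
Qed.

(** [bonferroni] is applied to each embedding separately, with e the dimension of the f-torsion of
    its cokernel; dividing by [q ^+ (m * k)] removes the lifts from the tuple count. *)
Lemma torsion_free_count_approx m n N (B : 'M[F]_m) (A : 'M[F]_n) :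
  `|(torsion_free_count (f :: fs) B A)%:R - \sum_(k < N.+1) (-1) ^+ k * (c k / q ^+ (m * k) *
      \sum_(Y : 'M[F]_(k, m)) (torsion_free_count fs (ext_mx d f B Y) A)%:R)| <=
  c N.+1 / q ^+ (m * N.+1) *
    \sum_(Y : 'M[F]_(N.+1, m)) (torsion_free_count fs (ext_mx d f B Y) A)%:R.
Proof.
under eq_bigr do rewrite sum_torsion_free_count mulr_sumr mulr_sumr.
rewrite sum_torsion_free_count mulr_sumr torsion_free_countE exchange_big /= -sumrB.
apply: le_trans (ler_norm_sum _ _ _) _; apply: ler_sum => phi.
rewrite inE => /andP[phi_free /eqP phiA].
have phi_stable : (phi *m A <= phi)%MS by rewrite phiA submxMl.
have [e [tf_e TE]] := card_torsion_tuples f_mon f_irr f_sz phi_free phi_stable R.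
pose b := all (fun g => torsion_free g A phi) fs; rewrite /= -/b.
have {}TE k : c k / q ^+ (m * k) * (b%:R * #|torsion_tuples d f A phi k|%:R) =
    b%:R * (c k * \prod_(j < k) ((q ^+ d.+1) ^+ e - (q ^+ d.+1) ^+ j)).
  rewrite TE !natrX -/q; set P := \prod_(j < k) _.
  have : q ^+ (m * k) != 0 by rewrite expf_neq0 // gt_eqF.
  by move=> qk; field.
under eq_bigr do rewrite TE.
rewrite TE tf_e.
have -> : ((e == 0%N) && b)%:R = b%:R * (e == 0%N)%:R :> R by rewrite mulrC -natrM mulnb.
under eq_bigr do rewrite mulrCA.
rewrite -mulr_sumr -mulrBr normrM ger0_norm ?ler0n // ler_wpM2l ?ler0n //.
exact: bonferroni.
Qed.

Variables (W : forall n, 'M[F]_n -> R) (L : R).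
Hypothesis W_ge0 : forall n A, 0 <= W (n := n) A.
Hypothesis cvg_fs : forall m (B : 'M[F]_m),
  \sum_(A : 'M[F]_n) W A * (torsion_free_count fs B A)%:R @[n --> \oo] --> L.

(* The truncation error of the sieve over torsion tuples is itself a multiple of a moment,
   hence small uniformly in n; this allows to exchange the limit with the series. *)
Lemma cvg_torsion_free_count_cons m (B : 'M[F]_m) :
  \sum_(A : 'M[F]_n) W A * (torsion_free_count (f :: fs) B A)%:R @[n --> \oo] -->
  limn (euler_prod (q ^+ d.+1)) * L.
Proof.
pose mom n k : R := \sum_(Y : 'M[F]_(k, m)) \sum_(A : 'M[F]_n) W A *
   (torsion_free_count fs (ext_mx d f B Y) A)%:R.
have mom_cvg k : c k / q ^+ (m * k) * mom n k @[n --> \oo] --> c k * L.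
  (* There are [q ^+ (m * k)] matrices [Y], each contributing [L] in the limit, which cancels the
     division by the number of lifts. *)
  have -> : c k * L = c k / q ^+ (m * k) * \sum_(Y : 'M[F]_(k, m)) L.
    rewrite sumr_const card_mx -mulr_natr natrX mulnC -/q mulrAC -mulrA.
    by rewrite mulfK // expf_neq0 // gt_eqF.
  by apply: cvgM; [apply: cvg_cst|apply: cvg_bigsum => Y _; apply: cvg_fs].
have momE n k : \sum_(A : 'M[F]_n) W A * (c k / q ^+ (m * k) *
    \sum_(Y : 'M[F]_(k, m)) (torsion_free_count fs (ext_mx d f B Y) A)%:R) =
    c k / q ^+ (m * k) * mom n k.
  rewrite /mom exchange_big mulr_sumr; apply: eq_bigr => A _.
  by rewrite mulrCA; congr (_ * _); rewrite mulr_sumr.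
apply: (cvg_approx (y := fun N n => \sum_(k < N.+1) (-1) ^+ k * (c k / q ^+ (m * k) * mom n k))
  (z := fun N n => c N.+1 / q ^+ (m * N.+1) * mom n N.+1)
  (s := fun N => (\sum_(k < N.+1) (-1) ^+ k * c k) * L)
  (t := fun N => c N.+1 * L)).
- move=> N n; rewrite -momE.
  under [X in _ - X]eq_bigr do rewrite -momE mulr_sumr.
  rewrite exchange_big -sumrB; apply: le_trans (ler_norm_sum _ _ _) _.
  apply: ler_sum => A _; under eq_bigr do rewrite mulrCA.
  rewrite -mulr_sumr -mulrBr normrM ger0_norm // ler_wpM2l //.
  exact: torsion_free_count_approx.
- move=> N; rewrite mulr_suml; apply: cvg_bigsum => k _.
  by rewrite -mulrA; apply: cvgM; [apply: cvg_cst|apply: mom_cvg].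
- by move=> N; apply: mom_cvg.
- by apply: cvgM; [apply: cvg_euler_series|apply: cvg_cst].
- rewrite -[0](mul0r L); apply: cvgM; last exact: cvg_cst.
  by rewrite (cvg_shiftS c); apply: cvg_euler_coef.
Qed.

End OnePrime.

Variable W : forall n, 'M[F]_n -> R.
Hypothesis W_ge0 : forall n A, 0 <= W (n := n) A.
Hypothesis W_moments : forall m (B : 'M[F]_m),
  \sum_(A : 'M[F]_n) W A * #|embeddings B A|%:R @[n --> \oo] --> (1 : R).

(** The induction on [fs] needs every size and every matrix at once, with a common limit, because
    removing one polynomial replaces [B] by all its extensions. *)
Lemma cvg_torsion_free_count (fs : seq {poly F}) m (B : 'M[F]_m) :
  (forall f, f \in fs -> f \is monic /\ irreducible_poly f) -> uniq fs ->
  \sum_(A : 'M[F]_n) W A * (torsion_free_count fs B A)%:R @[n --> \oo] -->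
  \prod_(f <- fs) limn (euler_prod (q ^+ (size f).-1)).
Proof.
elim: fs m B => [|f fs IHfs] m B fsP.
  have E n (A : 'M[F]_n) : torsion_free_count [::] B A = #|embeddings B A|.
    by apply: eq_card => phi; rewrite [LHS]inE andbT.
  move=> _; rewrite big_nil; under eq_cvg => n do under eq_bigr => A _ do rewrite E.
  exact: W_moments.
rewrite cons_uniq => /andP[f_fs fs_uniq]; rewrite big_cons.
have [f_mon f_irr] := fsP f (mem_head _ _).
have f_sz : size f = (size f).-2.+2 by case: f_irr; case: (size f) => [|[|]].
rewrite f_sz /=; apply: cvg_torsion_free_count_cons => //.
  move=> g g_fs; have [|g_mon g_irr] := fsP g; first by rewrite inE g_fs orbT.
  by apply: monic_irreducible_coprime => //; apply: contraNneq f_fs => <-.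
by move=> m' B'; apply: IHfs => // g g_fs; apply: fsP; rewrite inE g_fs orbT.
Qed.

End TorsionFreeMoments.

(** * Limits of the moments *)

(** With t the square root of z, Bernoulli's inequality gives n t^n <= 1 / (1 - t), and a second
    factor t^n remains to force convergence. *)
Lemma cvg_natmul_expr (R : realType) (z : R) : 0 <= z < 1 -> n%:R * z ^+ n @[n --> \oo] --> (0 : R).
Proof.
move=> /andP[z0 z1]; pose t := Num.sqrt z.
have t0 : 0 <= t by apply: sqrtr_ge0.
have tz : t ^+ 2 = z by rewrite sqr_sqrtr.
have t1 : t < 1 by rewrite ltNge; apply/negP => le; move: z1; rewrite -tz ltNge exprn_ege1.
have bound n : t ^+ n * (1 + n%:R * (1 - t)) <= 1.
  elim: n => [|n IHn]; first by rewrite expr0 mul0r addr0 mulr1.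
  apply: le_trans IHn; rewrite exprSr -mulrA ler_wpM2l ?exprn_ge0 //.
  have n0 : 0 <= n%:R :> R by [].
  have sq : 0 <= (1 - t) ^+ 2 by apply: sqr_ge0.
  rewrite -[n.+1]addn1 natrD; nra.
have cvg_t : (1 - t)^-1 * t ^+ n @[n --> \oo] --> (0 : R).
  rewrite -[0](mulr0 (1 - t)^-1); apply: cvgM; first exact: cvg_cst.
  by apply: cvg_expr; rewrite ger0_norm.
apply: (squeeze_cvgr _ (cvg_cst 0) cvg_t); apply: nearW => n.
rewrite mulr_ge0 ?exprn_ge0 //= -tz -exprM mulnC exprM expr2 mulrA.
rewrite ler_wpM2r ?exprn_ge0 // -[leRHS]mul1r ler_pdivlMr ?subr_gt0 //.
have := bound n; have : 0 <= t ^+ n by rewrite exprn_ge0.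
rewrite mulrDr mulr1; lra.
Qed.

Lemma bernoulli_ge (R : realFieldType) (x : R) N : 0 <= x <= 1 -> 1 - N%:R * x <= (1 - x) ^+ N.
Proof.
case/andP=> x0 x1; elim: N => [|N IHN]; first by rewrite mul0r subr0.
apply: (@le_trans _ _ ((1 - x) * (1 - N%:R * x))); last by rewrite exprS ler_wpM2l // subr_ge0.
have : 0 <= N%:R * x ^+ 2 by rewrite mulr_ge0 ?exprn_ge0.
rewrite -[N.+1]addn1 natrD; nra.
Qed.

Lemma bernoulli_le (R : realFieldType) (x : R) N : 0 <= x <= 1 -> N%:R * x < 1 ->
  (1 + x) ^+ N <= (1 - N%:R * x)^-1.
Proof.
move=> x01 Nx; rewrite -[leRHS]mul1r ler_pdivlMr ?subr_gt0 //.
case/andP: (x01) => x0 x1.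
have /le_trans : (1 + x) ^+ N * (1 - N%:R * x) <= (1 + x) ^+ N * (1 - x) ^+ N.
  by rewrite ler_wpM2l ?exprn_ge0 ?addr_ge0 // bernoulli_ge.
apply; rewrite -exprMn exprn_ile1 //; have : 0 <= x ^+ 2 by apply: sqr_ge0.
  nra.
nra.
Qed.

Lemma cvg_divn D : (0 < D)%N -> (n %/ D)%N @[n --> \oo] --> \oo.
Proof.
move=> D_gt0; apply/cvgnyPge => K; near=> n; rewrite leq_divRL //.
by near: n; apply: nbhs_infty_ge.
Unshelve. all: by end_near. Qed.

Lemma cvg_embedding_moments (R : realType) (p : nat) (eps : R) (p_prime : prime p)
    (eps_gt0 : 0 < eps) (eps_le : eps <= 1 - p%:R^-1)
    (w : forall n, 'I_n -> 'I_n -> galg 'F_p R)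
    (w_bal : forall n i j, balanced_law eps (w n i j)) m (B : 'M['F_p]_m) :
  \sum_(A : 'M['F_p]_n) (\prod_i \prod_j w n i j (A i j)) * #|embeddings B A|%:R
    @[n --> \oo] --> (1 : R).
Proof.
have p_gt0 : 0 < p%:R :> R by rewrite ltr0n prime_gt0.
have eps_le1 : eps <= 1 by rewrite (le_trans eps_le) // gerBl invr_ge0 ltW.
have [e0 e1] := andP (sqr_eps_bounds p_prime eps_gt0 eps_le).
have [r0 r1] := andP (mix_rate_bounds p_prime eps_gt0 eps_le1).
set z := 1 - eps ^+ 2 in e0 e1; set rho := mix_rate p eps in r0 r1.
set Y := near_rate p eps m.
have Y0 : 0 <= Y by rewrite exprn_ge0 // divr_ge0 ?exprn_ge0 ?ltW.
have cst0 : 0 <= near_cst p R m by apply: sumr_ge0 => h _; rewrite exprn_ge0 // ltW.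
(* With k = n / D rounded down, the factor Y^k is absorbed by z^n <= (z^D)^k. *)
have [D D_gt0 YD] : exists2 D, (0 < D)%N & Y * z ^+ D < 1.
  have : Y * z ^+ n @[n --> \oo] --> (0 : R).
    rewrite -[0](mulr0 Y); apply: cvgM; first exact: cvg_cst.
    by apply: cvg_expr; rewrite ger0_norm.
  move=> /cvgr_lt/(_ 1 ltr01)[N _ lt]; exists N.+1 => //.
  by apply: lt => /=.
(* Since D k <= n <= D (k + 1), [g k] bounds the accumulated mixing error m n p rho^k, and [E k]
   bounds [moment_error]. *)
pose g k : R := (m * D)%:R * p%:R * (k.+1%:R * rho ^+ k).
pose E k : R := near_cst p R m * (Y * z ^+ D) ^+ k.
have g_cvg : g k @[k --> \oo] --> (0 : R).
  rewrite -[0](mulr0 ((m * D)%:R * p%:R)); apply: cvgM; first exact: cvg_cst.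
  have -> : (fun k => k.+1%:R * rho ^+ k) = (fun k => k%:R * rho ^+ k + rho ^+ k) :> (nat -> R).
    by apply/funext => k; rewrite -[k.+1]addn1 natrD mulrDl mul1r.
  rewrite -[0]addr0; apply: cvgD; first by apply: cvg_natmul_expr; rewrite r0.
  by apply: cvg_expr; rewrite ger0_norm.
have E_cvg : E k @[k --> \oo] --> (0 : R).
  rewrite -[0](mulr0 (near_cst p R m)); apply: cvgM; first exact: cvg_cst.
  have q0 : 0 <= Y * z ^+ D by rewrite mulr_ge0 // exprn_ge0.
  by apply: cvg_expr; rewrite ger0_norm.
have rho_cvg : rho ^+ k @[k --> \oo] --> (0 : R) by apply: cvg_expr; rewrite ger0_norm.
have lo_cvg : 1 - g k - E k @[k --> \oo] --> (1 : R).
  rewrite -[X in _ --> X]subr0 -[X in _ --> X - 0]subr0.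
  by apply: cvgB => //; apply: cvgB => //; apply: cvg_cst.
have hi_cvg : (1 - g k)^-1 * (1 + E k) @[k --> \oo] --> (1 : R).
  rewrite -[X in _ --> X]mulr1; apply: cvgM.
    rewrite -[X in _ --> X]invr1; apply: cvgV; first exact: oner_neq0.
    by rewrite -[X in _ --> X]subr0; apply: cvgB => //; apply: cvg_cst.
  by rewrite -[X in _ --> X]addr0; apply: cvgD => //; apply: cvg_cst.
have kD := cvg_divn D_gt0.
apply: (squeeze_cvgr _ (cvg_comp _ _ kD lo_cvg) (cvg_comp _ _ kD hi_cvg)).
have good : \forall k \near \oo, (0 < k)%N /\ rho ^+ k <= p%:R^-1 /\ g k < 1.
  near=> k; split; first by near: k; apply: nbhs_infty_gt.
  split; near: k; last exact: (cvgr_lt 0).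
  by apply: (cvgr_le 0) => //; rewrite invr_gt0.
near=> n; rewrite /=; set k := (n %/ D)%N.
have [k_gt0 [rho_le g1]] : (0 < k)%N /\ rho ^+ k <= p%:R^-1 /\ g k < 1.
  by rewrite /k; near: n; apply: (kD _ good).
rewrite sum_card_embeddings.
have /andP[lo hi] := moment_bounds p_prime eps_gt0 eps_le (fun Phi j => row j (B *m Phi^T)^T)
  (w_bal n) k_gt0 rho_le.
have n_le : (n <= D * k.+1)%N by rewrite mulnC ltnW // ltn_ceil.
have x01 : 0 <= p%:R * rho ^+ k <= 1.
  apply/andP; split; first by rewrite mulr_ge0 ?exprn_ge0 // ltW.
  by have := ler_wpM2l (ltW p_gt0) rho_le; rewrite divff ?gt_eqF.
have Nx : (m * n)%:R * (p%:R * rho ^+ k) <= g k.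
  have -> : g k = (m * (D * k.+1))%:R * (p%:R * rho ^+ k) by rewrite /g !natrM; ring.
  by case/andP: x01 => x0 _; rewrite ler_wpM2r // ler_nat leq_mul2l n_le orbT.
have err : moment_error p eps m k n <= E k.
  have -> : E k = near_cst p R m * Y ^+ k * z ^+ (D * k) by rewrite /E exprMn -(exprM z) mulrA.
  apply: ler_wpM2l; first by apply: mulr_ge0 => //; apply: exprn_ge0.
  by apply: ler_wiXn2l => //; [apply: ltW|rewrite mulnC leq_divM].
have err0 : 0 <= moment_error p eps m k n
  by apply: mulr_ge0; [apply: mulr_ge0 => //; apply: exprn_ge0|apply: exprn_ge0].
apply/andP; split.
  apply: le_trans lo; rewrite lerB //; apply: le_trans (bernoulli_ge _ x01).
  by rewrite lerD2l lerN2.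
apply: le_trans hi _; apply: ler_pM; rewrite ?lerD2l ?addr_ge0 ?exprn_ge0 ?addr_ge0 //.
  by case/andP: x01.
apply: le_trans (bernoulli_le x01 (le_lt_trans Nx g1)) _.
by rewrite lef_pV2 ?posrE ?subr_gt0 ?(le_lt_trans Nx) // lerD2l lerN2.
Unshelve. all: by end_near. Qed.

(** * The matrix entries *)

Section EntryLaws.
Variables (R : realType) (d : measure_display) (T : measurableType d) (P : probability T R).

Lemma probability_finType (S : finType) (X : T -> S) (Q : pred S) :
  (forall a, measurable (X @^-1` [set a])) ->
  P [set w | Q (X w)] = (\sum_(a | Q a) P (X @^-1` [set a]))%E.
Proof.
move=> mX.
have -> : [set w | Q (X w)] = \bigcup_(a in [set` Q]) (X @^-1` [set a]).
  by apply/seteqP; split=> [w Qw|w [a Qa /= ->]] //=; exists (X w).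
rewrite measure_fin_bigcup //.
- by rewrite [RHS]bigfs ?index_enum_uniq // => a _; rewrite mem_index_enum.
- by move=> a b _ _ [w [/= <- <-]].
Qed.

Lemma probability_fineK (B : set T) : measurable B -> P B = (fine (P B))%:E.
Proof. by move=> mB; rewrite fineK ?fin_num_measure. Qed.

Lemma balanced_law_entry (p : nat) (eps : R) (X : T -> 'F_p) :
  discrete_rv X -> balanced P eps X ->
  balanced_law eps ([ffun a => fine (P (X @^-1` [set a]))] : galg 'F_p R).
Proof.
move=> X_rv X_bal; split=> [a|].
  rewrite ffunE fine_ge0 ?measure_ge0 //= -lee_fin -probability_fineK; last exact: X_rv.
  exact: X_bal.
rewrite /mass; under eq_bigr do rewrite ffunE.
apply: EFin_inj; rewrite -sumEFin.
under eq_bigr do rewrite -probability_fineK //.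
have := @probability_finType _ X predT (fun a => X_rv [set a]).
have -> : [set w | predT (X w)] = setT by apply/seteqP.
by rewrite probability_setT => <-.
Qed.

Lemma probability_matrix (F : finFieldType) n (A : T -> 'M[F]_n) (Q : pred 'M[F]_n) :
  (forall i j, discrete_rv (fun w => A w i j)) ->
  mutually_independent P (fun (ij : 'I_n * 'I_n) w => A w ij.1 ij.2) ->
  P [set w | Q (A w)] = (\sum_(M | Q M)
    \prod_i \prod_j fine (P ((fun w => A w i j) @^-1` [set M i j])))%:E.
Proof.
move=> A_rv A_indep.
have AM M : A @^-1` [set M] = [set w | forall ij : 'I_n * 'I_n, ij \in [set: 'I_n * 'I_n]%SET ->
    [set M ij.1 ij.2] (A w ij.1 ij.2)].
  apply/seteqP; split=> [w <-|w AwM] //=; apply/matrixP => i j.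
  exact: (AwM (i, j) (finset.in_setT _)).
rewrite probability_finType => [|M]; last first.
  have -> : A @^-1` [set M] = \bigcap_(ij in [set: 'I_n * 'I_n])
    ((fun w => A w ij.1 ij.2) @^-1` [set M ij.1 ij.2]).
    by rewrite AM; apply/seteqP; split=> w AwM ij //= _; apply: AwM; rewrite ?inE.
  apply: fin_bigcap_measurable => [|ij _]; first exact: finite_finset.
  exact: A_rv.
rewrite -sumEFin; apply: eq_bigr => M _.
rewrite AM (A_indep _ (fun ij => [set M ij.1 ij.2])) pair_bigA /= -prodEFin.
apply: eq_big => [ij|ij _]; first by rewrite inE.
by rewrite -probability_fineK //; apply: A_rv.
Qed.

End EntryLaws.

Lemma limn_euler_prod (R : realType) (p : nat) (p_prime : prime p) (f : {poly 'F_p}) :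
  limn (fun m => \prod_(1 <= j < m.+1) (1 - p%:R ^- (j * (size f).-1)) : R) =
  limn (euler_prod (#|'F_p|%:R ^+ (size f).-1)).
Proof.
congr (limn _); apply/funext => m; rewrite /euler_prod card_Fp // big_add1 big_mkord.
by apply: eq_bigr => j _; rewrite exprVn -exprM mulnC.
Qed.

Theorem theorem1p1 (R : realType) (p : nat) (p_prime : prime p)
    (eps : R) (eps_gt0 : 0 < eps) (eps_le : eps <= 1 - p%:R^-1)
    (d : nat -> measure_display) (T : forall n, measurableType (d n))
    (P : forall n, probability (T n) R)
    (A : forall n, T n -> 'M['F_p]_n)
    (A_rv : forall n (i j : 'I_n), discrete_rv (fun w => A n w i j))
    (A_indep : forall n, mutually_independent (P n)
       (fun (ij : 'I_n * 'I_n) w => A n w ij.1 ij.2))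
    (A_balanced : forall n (i j : 'I_n),
       balanced (P n) eps (fun w => A n w i j))
    (r : nat) (f : 'I_r -> {poly 'F_p}) (f_inj : injective f)
    (f_monic : forall i, f i \is monic)
    (f_irr : forall i, irreducible_poly (f i))
    (lam : 'I_r -> intpartn) :
  P n [set w | forall i, canonical_partn (f i) (A n w) = lam i] @[n --> \oo]
    --> (\prod_(i < r) limit_measure R (f i) (lam i))%:E.
Proof.
pose B := \mxdiag_(i < r) primary_block (f i) (lam i).
pose w n i j : galg 'F_p R := [ffun a => fine (P n ((fun x => A n x i j) @^-1` [set a]))].
have w_bal n i j : balanced_law eps (w n i j).
  by apply: balanced_law_entry; [apply: A_rv|apply: A_balanced].
pose W n (M : 'M['F_p]_n) : R := \prod_i \prod_j w n i j (M i j).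
have W_ge0 n M : 0 <= W n M.
  by apply: prodr_ge0 => i _; apply: prodr_ge0 => j _; case: (w_bal n i j) => /(_ (M i j))/andP[].
have uc_neq0 : #|unit_centralizer B|%:R != 0 :> R.
  rewrite pnatr_eq0 -lt0n; apply/card_gt0P; exists 1%:M.
  by rewrite inE unitmx1 mul1mx mulmx1 eqxx.
have count n (M : 'M['F_p]_n) : torsion_free_count (codom f) B M =
    if [forall i, canonical_partn (f i) M == lam i] then #|unit_centralizer B| else 0%N.
  rewrite -(card_primary_embeddings lam f_inj f_monic f_irr); apply: eq_card => phi.
  rewrite !inE; congr (_ && _); apply/allP/forallP => [tf i|tf _ /codomP[i ->]] //.
  exact/tf/codom_f.
have event n : P n [set x | forall i, canonical_partn (f i) (A n x) = lam i] =
    ((#|unit_centralizer B|%:R)^-1 *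
     \sum_(M : 'M['F_p]_n) W n M * (torsion_free_count (codom f) B M)%:R)%:E.
  transitivity (P n [set x | [forall i, canonical_partn (f i) (A n x) == lam i]]).
    congr (P n _); apply/seteqP.
    by split=> x /= px; [apply/forallP => i; rewrite px|move=> i; apply/eqP; move/forallP: px].
  rewrite (probability_matrix (fun M => [forall i, canonical_partn (f i) M == lam i])) //.
  congr (_%:E); rewrite mulr_sumr big_mkcond; apply: eq_bigr => M _; rewrite count.
  case: ifP => _; last by rewrite !mulr0.
  rewrite mulrCA mulVf // mulr1 /W; apply: eq_bigr => i _; apply: eq_bigr => j _.
  by rewrite ffunE.
under eq_cvg => n do rewrite event.
apply: cvg_EFin; first exact: nearW.
(* The primary blocks have coprime annihilators, so the automorphism group of the whole module is
   the product of those of its blocks; this is where the limit becomes a product measure. *)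
have -> : \prod_(i < r) limit_measure R (f i) (lam i) = (#|unit_centralizer B|%:R)^-1 *
    \prod_(g <- codom f) limn (euler_prod (#|'F_p|%:R ^+ (size g).-1)).
  rewrite big_image /= (@card_unit_centralizer_mxdiag _ _ _ _ (fun i => f i ^+ sumn (lam i))).
  - rewrite natr_prod -prodfV -big_split; apply: eq_bigr => i _ /=.
    rewrite /limit_measure limn_euler_prod // card_module_Aut //.
    by case: (f_irr i).
  - by move=> i; rewrite -(char_poly_primary_block (lam i)) ?pmx_char_poly.
  - move=> i j ij; rewrite coprimep_expl // coprimep_expr //.
    by apply: monic_irreducible_coprime => //; rewrite (inj_eq f_inj).
apply: cvgM; first exact: cvg_cst.
apply: cvg_torsion_free_count => //.
- move=> m B'; exact: (cvg_embedding_moments p_prime eps_gt0 eps_le w_bal).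
- by move=> _ /codomP[i ->].
- exact/injectiveP.
Qed.
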